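(* Let $n\ge1$ and suppose $\alpha_{\boldsymbol N}(a,b)$ and $\beta_{\boldsymbol N}(a,b)$ form a WP Bailey pair with respect to the matrix $\mathbf B^{(4)}$. For complex parameters $\rho_1,\rho_2$ let \begin{align*} \alpha'_{\boldsymbol N}(a,b)&:=\frac{\prod_{r=1}^n(\rho_1x_r,\,\rho_2x_r;q,p)_{N_r}}{(aq/\rho_1,\,aq/\rho_2;q,p)_{|\boldsymbol N|}}\left(\frac{aq}{\rho_1\rho_2}\right)^{|\boldsymbol N|}\prod_{r=1}^nx_r^{-N_r}\cdot q^{\sum_{r<s}N_rN_s}\,\alpha_{\boldsymbol N}\big(a,b\rho_1\rho_2/(aq)\big),\\ \beta'_{\boldsymbol N}(a,b)&:=\frac{\prod_{r=1}^n(b\rho_1x_r/a,\,b\rho_2x_r/a;q,p)_{N_r}}{(aq/\rho_1,\,aq/\rho_2;q,p)_{|\boldsymbol N|}}\\ &\quad\times\sum_{\substack{0\le k_r\le N_r\\ r=1,\dots,n}}\Bigg(\prod_{r=1}^n\frac{(\rho_1x_r,\,\rho_2x_r;q,p)_{k_r}(aq^{1+|\boldsymbol N|-N_r}/(\rho_1\rho_2x_r);q,p)_{N_r-k_r}}{(b\rho_1x_r/a,\,b\rho_2x_r/a;q,p)_{k_r}}\\ &\qquad\times\prod_{1\le r<s\le n}\frac{\theta(b\rho_1\rho_2x_rx_sq^{k_r+k_s}/(aq);p)}{\theta(b\rho_1\rho_2x_rx_s/(aq);p)}\prod_{r=1}^n\frac{\theta(b\rho_1\rho_2x_r^2q^{2k_r}/(aq);p)}{\theta(b\rho_1\rho_2x_r^2/(aq);p)}\\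 &\qquad\times\frac{\prod_{1\le r<s\le n}(b\rho_1\rho_2x_rx_s/a;q,p)_{N_r+N_s}\prod_{r=1}^n(bx_r;q,p)_{|\boldsymbol N|+k_r}}{\prod_{r,s=1}^n\big[(b\rho_1\rho_2x_rx_s/a;q,p)_{N_s+k_r}(q^{1+k_r-k_s}x_r/x_s;q,p)_{N_r-k_r}\big]}\\ &\qquad\times\left(\frac{aq}{\rho_1\rho_2}\right)^{|\boldsymbol k|}\prod_{r=1}^nx_r^{-k_r}\cdot q^{\sum_{r<s}k_rk_s}\,\beta_{\boldsymbol k}\big(a,b\rho_1\rho_2/(aq)\big)\Bigg). \end{align*} Then $\alpha'_{\boldsymbol N}(a,b)$ and $\beta'_{\boldsymbol N}(a,b)$ form a WP Bailey pair with respect to $\mathbf B^{(1)}$.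
   Context: Let $q,p$ be complex numbers with $q\neq 0$ and $|p|<1$. For $a\ne 0$ put $\theta(a;p)=\prod_{j\ge 0}(1-ap^j)(1-p^{j+1}/a)$. For an integer $k$ the $q,p$-shifted factorial is $(a;q,p)_k=\prod_{j=0}^{k-1}\theta(aq^j;p)$ if $k\ge 0$ (empty product $=1$), and $(a;q,p)_{k}=\big(\prod_{j=k}^{-1}\theta(aq^{j};p)\big)^{-1}$ if $k<0$. Write $(a_1,\dots,a_m;q,p)_k=(a_1;q,p)_k\cdots(a_m;q,p)_k$. For a tuple $\boldsymbol k=(k_1,\dots,k_n)$, $|\boldsymbol k|=k_1+\cdots+k_n$; $\sum_{r<s}$ is over $1\le r<s\le n$. The $x_1,\dots,x_n$ are fixed complex parameters. All parameters are nonzero and generic in the sense that no denominators vanish. WP Bailey pair: given a matrix $\mathbf B=(B_{\boldsymbol k\boldsymbol j}(a,b))$ indexed by $n$-tuples of nonnegative integers, two sequences $\alpha_{\boldsymbol N}(a,b)$ and $\beta_{\boldsymbol N}(a,b)$ (indexed by $n$-tuples of nonnegative integers and depending on parameters $a,b$) form a WP Bailey pair with respect to $\mathbf B$ if for all $\boldsymbol N$ and all (generic) $a,b$ $$\beta_{\boldsymbol N}(a,b)=\sum_{0\le j_r\le N_r,\ r=1,\dots,n}B_{\boldsymbol N\boldsymbol j}(a,b)\,\alpha_{\boldsymbol j}(a,b).$$ The matrices $\mathbf B^{(1)}$ and $\mathbf B^{(4)}$ have entries $$B^{(1)}_{\boldsymbol k\boldsymbol j}(a,b)=\frac{(b/a;q,p)_{|\boldsymbol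 k|-|\boldsymbol j|}}{\prod_{r,s=1}^n(q^{1+j_r-j_s}x_r/x_s;q,p)_{k_r-j_r}}\prod_{r=1}^n\frac{(bx_r;q,p)_{j_r+|\boldsymbol k|}}{(ax_rq;q,p)_{k_r+|\boldsymbol j|}},$$ $$B^{(4)}_{\boldsymbol k\boldsymbol j}(a,b)=\frac{\prod_{r,s=1}^n(bx_rx_s;q,p)_{k_r+j_s}}{\prod_{1\le r<s\le n}(bx_rx_s;q,p)_{j_r+j_s}\prod_{r,s=1}^n(q^{1+j_r-j_s}x_r/x_s;q,p)_{k_r-j_r}}\prod_{r=1}^n\frac{(bx_r/a;q,p)_{k_r-|\boldsymbol j|}}{(bx_r/a;q,p)_{j_r-|\boldsymbol j|}(ax_rq;q,p)_{k_r+|\boldsymbol j|}}.$$ *)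

(* Defs.v *)
From HB Require Import structures.
From mathcomp Require Import all_boot all_order all_algebra.
From mathcomp Require Import all_classical all_reals all_analysis.
From mathcomp Require Import complex.

Set Implicit Arguments.
Unset Strict Implicit.
Unset Printing Implicit Defensive.

Import Order.TTheory GRing.Theory Num.Theory.
Import numFieldNormedType.Exports.

Local Open Scope classical_set_scope.
Local Open Scope ring_scope.
Local Open Scope complex_scope.

Definition multi_index (n : nat) : Type := {ffun 'I_n -> nat}.

Definition weight (n : nat) (k : multi_index n) : nat := (\sum_(r < n) k r)%N.

Definition index_le (n : nat) (j k : multi_index n) : Prop :=
  forall r : 'I_n, (j r <= k r)%N.

(* e2 k is the second elementary symmetric function of k_1, ..., k_n. *)
Definition e2 (n : nat) (k : multi_index n) : nat :=
  (\sum_(r < n) \sum_(s < n | r < s) k r * k s)%N.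

(* The sum of F over the box 0 <= j_r <= N_r. *)
Definition box_sum (V : nmodType) (n : nat) (N : multi_index n)
    (F : multi_index n -> V) : V :=
  \sum_(j : {dffun forall r : 'I_n, 'I_(N r).+1})
     F [ffun r => nat_of_ord (j r)].

Section EllipticFactorials.
Variable R : realType.
Local Notation C := R[i].

(* C^o is C seen as a one-dimensional normed module over itself: this is where
   the library puts the topology given by the modulus. *)
Definition theta (a p : C) : C :=
  lim ((fun m : nat =>
    (\prod_(0 <= j < m) ((1 - a * p ^+ j) * (1 - p ^+ j.+1 / a)) : C^o)) @ \oo).

(* Negz m stands for the integer -(m+1); the exponents -(m+1), ..., -1 are the
   -(j+1) with 0 <= j <= m.  As 0^-1 = 0, for a negative index k the statement
   qpfact q p a k != 0 holds exactly when no inverted theta function vanishes,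
   i.e., when the factorial is well defined. *)
Definition qpfact (q p a : C) (k : int) : C :=
  match k with
  | Posz m => \prod_(0 <= j < m) theta (a * q ^+ j) p
  | Negz m => (\prod_(0 <= j < m.+1) theta (a * q ^- j.+1) p)^-1
  end.

Variables (q p : C) (n : nat) (x : 'I_n -> C).

Definition B1 (k j : multi_index n) (a b : C) : C :=
  qpfact q p (b / a) ((weight k)%:Z - (weight j)%:Z)
  / (\prod_(r < n) \prod_(s < n)
       qpfact q p (q ^ (1 + (j r)%:Z - (j s)%:Z) * x r / x s)
         ((k r)%:Z - (j r)%:Z))
  * \prod_(r < n)
      (qpfact q p (b * x r) ((j r)%:Z + (weight k)%:Z)
       / qpfact q p (a * x r * q) ((k r)%:Z + (weight j)%:Z)).

Definition B4 (k j : multi_index n) (a b : C) : C :=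
  (\prod_(r < n) \prod_(s < n) qpfact q p (b * x r * x s) ((k r)%:Z + (j s)%:Z))
  / ((\prod_(r < n) \prod_(s < n | (r < s)%N)
        qpfact q p (b * x r * x s) ((j r)%:Z + (j s)%:Z))
     * (\prod_(r < n) \prod_(s < n)
          qpfact q p (q ^ (1 + (j r)%:Z - (j s)%:Z) * x r / x s)
            ((k r)%:Z - (j r)%:Z)))
  * \prod_(r < n)
      (qpfact q p (b * x r / a) ((k r)%:Z - (weight j)%:Z)
       / (qpfact q p (b * x r / a) ((j r)%:Z - (weight j)%:Z)
          * qpfact q p (a * x r * q) ((k r)%:Z + (weight j)%:Z))).

(* The parameters a, b are nonzero and no denominator in the entries of the
   lower triangular part of the matrix vanishes. *)
Definition B1_generic (a b : C) : Prop :=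
  [/\ a != 0, b != 0 &
   forall k j : multi_index n, index_le j k ->
     (forall r s, qpfact q p (q ^ (1 + (j r)%:Z - (j s)%:Z) * x r / x s)
                    ((k r)%:Z - (j r)%:Z) != 0) /\
     (forall r, qpfact q p (a * x r * q) ((k r)%:Z + (weight j)%:Z) != 0)].

(* A negative index in the numerator factor of index k_r - |j| hides the
   inverses of theta functions that also occur in the factor of index
   j_r - |j| <= k_r - |j|, so the third condition covers them. *)
Definition B4_generic (a b : C) : Prop :=
  [/\ a != 0, b != 0 &
   forall k j : multi_index n, index_le j k ->
     [/\ forall r s : 'I_n, (r < s)%N ->
           qpfact q p (b * x r * x s) ((j r)%:Z + (j s)%:Z) != 0,
         forall r s, qpfact q p (q ^ (1 + (j r)%:Z - (j s)%:Z) * x r / x s)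
                       ((k r)%:Z - (j r)%:Z) != 0,
         forall r, qpfact q p (b * x r / a) ((j r)%:Z - (weight j)%:Z) != 0 &
         forall r, qpfact q p (a * x r * q) ((k r)%:Z + (weight j)%:Z) != 0]].

(* "generic a b" delimits the parameters for which the relation is required. *)
Definition WP_Bailey_pair (generic : C -> C -> Prop)
    (B : multi_index n -> multi_index n -> C -> C -> C)
    (alpha beta : multi_index n -> C -> C -> C) : Prop :=
  forall (N : multi_index n) (a b : C), generic a b ->
    beta N a b = box_sum N (fun j => B N j a b * alpha j a b).

Variables (rho1 rho2 : C).

Definition alpha' (alpha : multi_index n -> C -> C -> C)
    (N : multi_index n) (a b : C) : C :=
  (\prod_(r < n) (qpfact q p (rho1 * x r) (N r) * qpfact q p (rho2 * x r) (N r)))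
  / (qpfact q p (a * q / rho1) (weight N) * qpfact q p (a * q / rho2) (weight N))
  * (a * q / (rho1 * rho2)) ^+ weight N
  * (\prod_(r < n) x r ^- N r)
  * q ^+ e2 N
  * alpha N a (b * rho1 * rho2 / (a * q)).

Definition beta' (beta : multi_index n -> C -> C -> C)
    (N : multi_index n) (a b : C) : C :=
  (\prod_(r < n) (qpfact q p (b * rho1 * x r / a) (N r)
                  * qpfact q p (b * rho2 * x r / a) (N r)))
  / (qpfact q p (a * q / rho1) (weight N) * qpfact q p (a * q / rho2) (weight N))
  * box_sum N (fun k =>
      (\prod_(r < n)
         (qpfact q p (rho1 * x r) (k r) * qpfact q p (rho2 * x r) (k r)
          * qpfact q p (a * q ^ (1 + (weight N)%:Z - (N r)%:Z) / (rho1 * rho2 * x r))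
              ((N r)%:Z - (k r)%:Z)
          / (qpfact q p (b * rho1 * x r / a) (k r)
             * qpfact q p (b * rho2 * x r / a) (k r))))
      * (\prod_(r < n) \prod_(s < n | (r < s)%N)
           (theta (b * rho1 * rho2 * x r * x s * q ^+ (k r + k s) / (a * q)) p
            / theta (b * rho1 * rho2 * x r * x s / (a * q)) p))
      * (\prod_(r < n)
           (theta (b * rho1 * rho2 * x r ^+ 2 * q ^+ (2 * k r) / (a * q)) p
            / theta (b * rho1 * rho2 * x r ^+ 2 / (a * q)) p))
      * (((\prod_(r < n) \prod_(s < n | (r < s)%N)
             qpfact q p (b * rho1 * rho2 * x r * x s / a) (N r + N s)%N)
          * (\prod_(r < n) qpfact q p (b * x r) ((weight N)%:Z + (k r)%:Z)))
         / \prod_(r < n) \prod_(s < n)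
             (qpfact q p (b * rho1 * rho2 * x r * x s / a) (N s + k r)%N
              * qpfact q p (q ^ (1 + (k r)%:Z - (k s)%:Z) * x r / x s)
                  ((N r)%:Z - (k r)%:Z)))
      * (a * q / (rho1 * rho2)) ^+ weight k
      * (\prod_(r < n) x r ^- k r)
      * q ^+ e2 k
      * beta k a (b * rho1 * rho2 / (a * q))).

Definition alpha'_generic (a b : C) : Prop :=
  forall N : multi_index n,
    qpfact q p (a * q / rho1) (weight N) != 0 /\ qpfact q p (a * q / rho2) (weight N) != 0.

Definition beta'_generic (a b : C) : Prop :=
  forall N k : multi_index n, index_le k N ->
    [/\ qpfact q p (a * q / rho1) (weight N) != 0 /\
        qpfact q p (a * q / rho2) (weight N) != 0,
        forall r, qpfact q p (b * rho1 * x r / a) (k r) != 0 /\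
                  qpfact q p (b * rho2 * x r / a) (k r) != 0,
        forall r s : 'I_n, (r < s)%N ->
          theta (b * rho1 * rho2 * x r * x s / (a * q)) p != 0,
        forall r, theta (b * rho1 * rho2 * x r ^+ 2 / (a * q)) p != 0 &
        forall r s,
          qpfact q p (b * rho1 * rho2 * x r * x s / a) (N s + k r)%N != 0 /\
          qpfact q p (q ^ (1 + (k r)%:Z - (k s)%:Z) * x r / x s)
            ((N r)%:Z - (k r)%:Z) != 0].

(* No denominator vanishes in alpha', beta' and B1 at (a, b), nor in B4 at the
   point (a, b rho1 rho2 / (a q)) where the original pair is evaluated. *)
Definition transformed_generic (a b : C) : Prop :=
  [/\ B1_generic a b, B4_generic a (b * rho1 * rho2 / (a * q)),
      alpha'_generic a b & beta'_generic a b].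

End EllipticFactorials.

(* Main.v *)
Require Import Defs.
From HB Require Import structures.
From mathcomp Require Import all_boot all_order all_algebra.
From mathcomp Require Import all_classical all_reals all_analysis.
From mathcomp Require Import complex.
From mathcomp Require Import ring lra zify.
Import Order.TTheory GRing.Theory Num.Theory.
Import numFieldNormedType.Exports.
Import ComplexField.Normc.
Local Open Scope ring_scope.
Local Open Scope complex_scope.

Set Implicit Arguments.
Unset Strict Implicit.
Unset Printing Implicit Defensive.

(** Both sides of the claim are linear in alpha, so the theorem says that two
    triangular matrices agree: for each j <= N, the sum over j <= k <= N of the
    k-th term of beta' times the entry (k, j) of B4 at (a, c), where
    c = b rho1 rho2 / (a q), equals the entry (N, j) of B1 times the factor
    of alpha'.  After cancellation this is an elliptic Jackson summation of
    type C_n ([jackson_sum]).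

    The multiple sum is a degenerate case of a sum over signs
    ([signsum_summation]): over all choices of z or 1/z for each z in a list of
    n points, of a product of one-point weights, built from four parameters t1,
    t2, t3, t4, and of pairwise interactions.  If the points form geometric
    strings z, z q, z q^2, ..., the interaction of a point with the inverse of
    its successor is theta(1) = 0, so that only an initial part of each string
    can be inverted; the lengths of these parts are the summation indices
    ([signsum_strings]), and the interactions telescope to theta shifted
    factorials ([cross_prefix], [signed_term_prefix]).

    The summation over signs uses only that theta(1/z) = - theta(z)/z, that the
    zeros of theta form a multiplicative group, and the addition formula in the
    form theta(x y) theta(x/y) = x (o(x) e(y) - e(x) o(y)) for two functions o
    and e.  Fix all but t1 and t2, and let these vary with a fixed product r^2:
    t1 = r y, t2 = r / y.  By the addition formula both sides are homogeneous
    forms of degree n in (o(y), e(y)), so it suffices to compare them at n + 1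
    values of y that are pairwise distinct as points of the projective line.
    Such values are those for which t1 is a point or the inverse of a point:
    then one of the two signs of that point gives weight 0, the other one turns
    the interactions into a replacement of t1 by t1 q, and induction on n
    applies.  The n + 1 values are distinct only if t1 t2 avoids finitely many
    zeros of theta; this is arranged by interpolating once more, in t2 and t3
    with fixed product, at values t2 = q^m with m large.

    The addition formula comes from the Jacobi triple product.  The product
    theta(x y) theta(x/y) is up to a constant a double series over pairs (k, l)
    of integers, and splitting the pairs by the parity of k + l writes it as
    x (o(x) e(y) - e(x) o(y)), with o and e the odd and even theta series
    ([sum_parity_pairs]).  The limits are taken by dominated convergence on
    finite sums ([tannery]). *)

(** * Homogeneous forms in two functions *)
Section Forms.
Variables (F : fieldType) (o e : F -> F).

(** This determinant vanishes exactly when (o x, e x) and (o y, e y) are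
    proportional: it separates points of the projective line. *)
Definition wedge (x y : F) : F := o x * e y - e x * o y.

(** Being a homogeneous polynomial of degree d in (o y, e y), said without
    coefficients; only the values at nonzero arguments matter. *)
Fixpoint form (d : nat) (f : F -> F) : Prop :=
  match d with
  | 0%N => exists c, forall y, y != 0 -> f y = c
  | d'.+1 => exists f1 f2, [/\ form d' f1, form d' f2 &
      forall y, y != 0 -> f y = o y * f1 y + e y * f2 y]
  end.

Lemma form_ext d f g : (forall y, y != 0 -> f y = g y) -> form d f -> form d g.
Proof.
case: d => [|d] fg /=.
  by case=> c fc; exists c => y y0; rewrite -fg // fc.
by case=> f1 [f2 [h1 h2 h]]; exists f1, f2; split=> // y y0; rewrite -fg // h.
Qed.

Lemma form_cst c : form 0 (fun=> c). Proof. by exists c. Qed.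

Lemma form_lin d f g a b : form d f -> form d g ->
  form d (fun y => a * f y + b * g y).
Proof.
elim: d f g => [|d IH] f g /=.
  by case=> c fc [c' gc]; exists (a * c + b * c') => y y0; rewrite fc // gc.
case=> f1 [f2 [hf1 hf2 hf]] [g1 [g2 [hg1 hg2 hg]]].
exists (fun y => a * f1 y + b * g1 y), (fun y => a * f2 y + b * g2 y).
by split; [exact: IH|exact: IH|move=> y y0; rewrite hf // hg //; ring].
Qed.

Lemma formD d f g : form d f -> form d g -> form d (fun y => f y + g y).
Proof.
move=> hf hg; apply: form_ext (form_lin 1 1 hf hg) => y _; ring.
Qed.

Lemma formZ d f a : form d f -> form d (fun y => a * f y).
Proof.
move=> hf; apply: form_ext (form_lin a 0 hf hf) => y _; ring.
Qed.

Lemma form_mul_line d f u v :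
  form d f -> form d.+1 (fun y => (u * o y + v * e y) * f y).
Proof.
move=> hf; exists (fun y => u * f y), (fun y => v * f y).
by split; [exact: formZ|exact: formZ|move=> y _; ring].
Qed.

Lemma formM d d' f g : form d f -> form d' g -> form (d + d') (fun y => f y * g y).
Proof.
elim: d f => [|d IH] f /=.
  case=> c fc hg; apply: form_ext (formZ c hg) => y y0; by rewrite fc.
case=> f1 [f2 [h1 h2 hf]] hg.
exists (fun y => f1 y * g y), (fun y => f2 y * g y).
by split; [exact: IH|exact: IH|move=> y y0; rewrite hf //; ring].
Qed.

(** Division by the linear form that vanishes at y: modulo [wedge z y] the
    vector (o z, e z) is a multiple of (o y, e y). *)
Lemma form_divide d f y : y != 0 -> e y != 0 -> form d.+1 f ->
  exists2 f', form d f' & forall z, z != 0 ->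
    f z = wedge z y * f' z + (e z / e y) ^+ d.+1 * f y.
Proof.
move=> y0 ey0; elim: d f => [|d IH] f [f1 [f2 [h1 h2 hf]]].
  case: h1 h2 => c1 h1 [c2 h2].
  exists (fun=> c1 / e y); first exact: form_cst.
  move=> z z0; rewrite !hf // !h1 // !h2 // /wedge; field; exact: ey0.
have hh := @form_lin d.+1 _ _ (o y / e y) 1 h1 h2.
have [h' fh' eh'] := IH _ hh.
exists (fun z => (e y)^-1 * f1 z + e z * h' z).
  apply: (@formD d.+1); first exact: (@formZ d.+1).
  have := @form_mul_line d h' 0 1 fh'.
  by apply: form_ext => z _; ring.
move=> z z0; rewrite (hf z) // (hf y) //.
have -> : o z * f1 z + e z * f2 z =
  wedge z y / e y * f1 z + e z * (o y / e y * f1 z + 1 * f2 z).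
  rewrite /wedge; field; exact: ey0.
rewrite eh' // [in RHS]exprS; field; exact: ey0.
Qed.

End Forms.

Lemma form_swap (F : fieldType) (o e : F -> F) d f : form o e d f -> form e o d f.
Proof.
elim: d f => // d IH f [f1 [f2 [/IH h1 /IH h2 hf]]].
by exists f2, f1; split=> // y y0; rewrite hf // addrC.
Qed.

Section FormRoots.
Variables (F : fieldType) (o e : F -> F).
Local Notation form := (form o e).

(** The witness y' only serves to exclude that o and e both vanish at y. *)
Lemma form_root d f y y' : y != 0 -> wedge o e y y' != 0 -> form d.+1 f -> f y = 0 ->
  exists2 f', form d f' & forall z, z != 0 -> f z = wedge o e z y * f' z.
Proof.
move=> y0 a0 hf fy0.
have [ey0|ey0] := eqVneq (e y) 0; last first.
  have [f' h1 h2] := form_divide y0 ey0 hf.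
  by exists f' => // z z0; rewrite h2 // fy0 mulr0 addr0.
have oy0 : o y != 0.
  by apply: contraNneq a0 => oy0; rewrite /wedge ey0 oy0 !mul0r subr0.
have [f' /form_swap h1 h2] := form_divide y0 oy0 (form_swap hf).
exists (fun z => - f' z); first by apply: form_ext (formZ (-1) h1) => z _; ring.
by move=> z z0; rewrite h2 // fy0 mulr0 addr0 /wedge; ring.
Qed.

Lemma wedgeC x y : wedge o e x y = - wedge o e y x. Proof. by rewrite /wedge; ring. Qed.

(** A nonzero form of degree d has at most d zeros on the projective line. *)
Lemma form_eq0 d f (ys : seq F) : form d f -> size ys = d.+1 ->
  all (fun y => y != 0) ys -> pairwise (fun y y' => wedge o e y y' != 0) ys ->
  all (fun y => f y == 0) ys -> forall z, z != 0 -> f z = 0.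
Proof.
elim: d f ys => [|d IH] f [|y [|y' ys]] //=.
  case=> c fc _ /andP[y0 _] _ /andP[/eqP fy _] z z0.
  by rewrite fc // -fy fc.
move=> hf [sz] /and3P[y0 y'0 ys0] /andP[/andP[ayy' ay] /andP[ay' pw]].
case/and3P => /eqP fy /eqP fy' fys z z0.
have [f' h1 h2] := form_root y0 ayy' hf fy.
rewrite h2 // (IH f' (y' :: ys)) ?mulr0 //=.
- by rewrite sz.
- by rewrite y'0.
- by rewrite ay' pw.
have ok t : t != 0 -> wedge o e y t != 0 -> f t = 0 -> f' t == 0.
  move=> t0 at0; rewrite h2 // => /eqP; rewrite mulf_eq0 => /orP[|//].
  by rewrite wedgeC oppr_eq0 (negPf at0).
rewrite ok //=; apply/allP => t ht.
apply: ok; [exact: (allP ys0)|exact: (allP ay)|].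
by apply/eqP; exact: (allP fys).
Qed.

End FormRoots.

(** * The summation over signs *)
Section SignSum.
Variables (F : numClosedFieldType) (th : F -> F) (q : F).

Definition interaction (w v : F) : F := th (q * w * v) / th (w * v).

(** The sum over all ways to replace each z in zs by z or 1/z, of the product
    of g over the chosen points and of the interactions of the pairs; the
    recursion absorbs the interactions with the points already chosen in g. *)
Fixpoint signsum (g : F -> F) (zs : seq F) : F :=
  if zs is z :: zs' then
    g z * signsum (fun w => g w * interaction w z) zs'
    + g z^-1 * signsum (fun w => g w * interaction w z^-1) zs'
  else 1.

Lemma interactionC w v : interaction w v = interaction v w.
Proof. by rewrite /interaction -!mulrA [w * v]mulrC. Qed.

Lemma eq_signsum g1 g2 zs : {in zs, forall z, g1 z = g2 z /\ g1 z^-1 = g2 z^-1} ->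
  signsum g1 zs = signsum g2 zs.
Proof.
elim: zs g1 g2 => //= z zs IH g1 g2 h.
have [-> ->] := h z (mem_head _ _).
congr (_ * _ + _ * _); apply: IH => w wzs;
  by have [-> ->] := h w (mem_behead (s := z :: zs) wzs).
Qed.

Lemma signsum_swap g y z zs : signsum g [:: y, z & zs] = signsum g [:: z, y & zs].
Proof.
have key (u v : F) : signsum (fun w => g w * interaction w u * interaction w v) zs =
    signsum (fun w => g w * interaction w v * interaction w u) zs.
  by apply: eq_signsum => w _; split; ring.
rewrite /= (key z y) (key z^-1 y) (key z y^-1) (key z^-1 y^-1).
by rewrite (interactionC z y) (interactionC z^-1 y) (interactionC z y^-1) (interactionC z^-1 y^-1); ring.
Qed.

Lemma signsum_rem g z zs : z \in zs -> signsum g zs = signsum g (z :: rem z zs).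
Proof.
elim: zs g => // y zs IH g; rewrite inE /=.
have [->//|yz /= zzs] := eqVneq y z.
by rewrite [RHS]signsum_swap /= !(IH _ zzs).
Qed.

(** For t1 t2 t3 t4 = 1 the numerators at w and 1/w are, up to monomials, two of
    the three products in Weierstrass' relation; the third one contains the
    denominator theta(w^2), and the quotient does not depend on w. *)
Definition site_weight (t1 t2 t3 t4 w : F) : F :=
  w^-1 * (th (t1 * w) * th (t2 * w) * th (t3 * w) * th (t4 * w)) / th (w ^+ 2).

Definition poch (u : F) (n : nat) : F := \prod_(m < n) th (u * q ^+ m).

Definition sum_value (t1 t2 t3 : F) (n : nat) : F :=
  (-1) ^+ n * (poch (t1 * t2) n * poch (t1 * t3) n * poch (t2 * t3) n)
  / ((t1 * t2 * t3) ^+ n * q ^+ (n * n.-1)).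

(** No denominator of the sum over signs vanishes. *)
Definition generic_points (zs : seq F) : Prop :=
  [/\ uniq zs, {in zs, forall z, z != 0 /\ th (z ^+ 2) != 0} &
      {in zs &, forall y z, y != z -> th (y * z) != 0 /\ th (y / z) != 0}].

Definition summation_at (zs : seq F) (t1 t2 t3 t4 : F) : Prop :=
  signsum (site_weight t1 t2 t3 t4) zs = sum_value t1 t2 t3 (size zs).

Hypothesis q0 : q != 0.
Hypothesis thV : forall z : F, z != 0 -> th z^-1 = - th z / z.

Lemma th1 : th 1 = 0.
Proof.
have := thV (oner_neq0 F); rewrite invr1 mulr1 => h; apply/eqP.
by rewrite -eqNr -h.
Qed.

Lemma thV_eq0 z : z != 0 -> (th z^-1 == 0) = (th z == 0).
Proof. by move=> z0; rewrite thV // mulNr oppr_eq0 mulf_eq0 invr_eq0 (negPf z0) orbF. Qed.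

Lemma pochS u n : poch u n.+1 = th u * poch (u * q) n.
Proof.
rewrite /poch big_ord_recl expr0 mulr1; congr (_ * _).
by apply: eq_bigr => i _; rewrite -mulrA -exprS.
Qed.

Lemma pochSr u n : poch u n.+1 = poch u n * th (u * q ^+ n).
Proof. by rewrite /poch big_ord_recr. Qed.

Lemma generic_cons z zs : generic_points (z :: zs) -> generic_points zs.
Proof.
case=> /= /andP[_ u] h1 h2; split=> // [y yzs|x y xzs yzs].
  by apply: h1; rewrite inE yzs orbT.
by apply: h2; rewrite inE ?xzs ?yzs orbT.
Qed.

Lemma generic_rem z zs : z \in zs -> generic_points zs ->
  generic_points (z :: rem z zs).
Proof.
move=> zzs [u h1 h2].
have sub : {subset z :: rem z zs <= zs}.
  by move=> y; rewrite -(perm_mem (perm_to_rem zzs)).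
split; first by rewrite -(perm_uniq (perm_to_rem zzs)).
  by move=> y /sub; exact: h1.
by move=> x y /sub xz /sub yz; exact: h2.
Qed.

(** One of t1 z and t1 / z is 1, so one of the two choices for z has weight
    zero; for the other one, the chosen point is t1, and its interaction with w
    turns theta(t1 w) into theta(t1 q w). *)
Lemma signsum_collapse z zs t1 t2 t3 t4 : generic_points (z :: zs) ->
  t1 = z \/ t1 = z^-1 ->
  signsum (site_weight t1 t2 t3 t4) (z :: zs) =
  site_weight t1 t2 t3 t4 t1 * signsum (site_weight (t1 * q) t2 t3 t4) zs.
Proof.
move=> gz tz.
have [/= /andP[zzs u] h1 h2] := gz.
have [z0 zz] := h1 z (mem_head _ _).
have t0 : t1 != 0 by case: tz => ->; rewrite ?invr_eq0.
have van : site_weight t1 t2 t3 t4 t1^-1 = 0.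
  by rewrite /site_weight divff // th1 !(mul0r, mulr0).
have cong : signsum (fun w => site_weight t1 t2 t3 t4 w * interaction w t1) zs =
    signsum (site_weight (t1 * q) t2 t3 t4) zs.
  have step w : th (w * t1) != 0 ->
      site_weight t1 t2 t3 t4 w * interaction w t1 = site_weight (t1 * q) t2 t3 t4 w.
    move=> wt0; rewrite /site_weight /interaction (mulrC t1 w).
    have -> : t1 * q * w = q * w * t1 by ring.
    have [->|w0] := eqVneq w 0; first by rewrite invr0 !mul0r.
    have [->|tw] := eqVneq (th (w ^+ 2)) 0; first by rewrite invr0 !mulr0 mul0r.
    by field; rewrite w0 wt0 tw.
  apply: eq_signsum => w wzs.
  have wz : w != z by apply: contraNneq zzs => <-.
  have w0 : w != 0 by have [] := h1 w; rewrite // inE wzs orbT.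
  have ws : w \in z :: zs by rewrite inE wzs orbT.
  have [a b] := h2 w z ws (mem_head _ _) wz.
  have [|a' b'] := h2 z w (mem_head _ _) ws; first by rewrite eq_sym.
  split; apply: step; case: tz => -> //.
    by rewrite mulrC.
  by rewrite -invfM thV_eq0 // mulf_neq0.
case: tz => tz; rewrite /= -!tz ?van; first by rewrite cong mul0r addr0.
have ez : z = t1^-1 by rewrite tz invrK.
by rewrite [in site_weight _ _ _ _ z]ez van mul0r add0r cong.
Qed.

Section Interpolation.
Variables o e : F -> F.
Hypothesis thA : forall x y : F, x != 0 -> y != 0 ->
  th (x * y) * th (x / y) = x * wedge o e x y.

(** This is what the addition formula is used for. *)
Lemma form_th R : R != 0 -> form o e 1 (fun y => th (R * y) * th (R / y)).
Proof.
move=> R0; have := @form_mul_line F o e 0 _ (- (R * e R)) (R * o R) (form_cst o e 1).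
by apply: form_ext => y y0; rewrite thA // /wedge; ring.
Qed.

Lemma form_signsum (G : F -> F -> F) zs :
  (forall w, w != 0 -> form o e 1 (G^~ w)) -> {in zs, forall z, z != 0} ->
  form o e (size zs) (fun y => signsum (G y) zs).
Proof.
elim: zs G => [|z zs IH] G hG hz; first exact: form_cst.
have z0 : z != 0 by apply: hz; rewrite mem_head.
have hz' : {in zs, forall z, z != 0} by move=> w wzs; apply: hz; rewrite inE wzs orbT.
have step u : u != 0 -> form o e (size zs).+1
    (fun y => G y u * signsum (fun w => G y w * interaction w u) zs).
  move=> u0; apply: (@formM F o e 1 _ _ _ (hG u u0)).
  apply: IH => // w w0; apply: form_ext (formZ (interaction w u) (hG w w0)) => y _.
  by rewrite mulrC.
apply: (@formD F o e (size zs).+1 _ _ (step z z0) (step z^-1 _)).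
by rewrite invr_eq0.
Qed.

Lemma form_poch R n : R != 0 -> form o e n (fun y => poch (R * y) n * poch (R / y) n).
Proof.
move=> R0; elim: n => [|n IH].
  apply: form_ext (form_cst o e 1) => y _.
  by rewrite /poch !big_ord0 mulr1.
have h := form_th (mulf_neq0 R0 (expf_neq0 n q0)).
have := formM IH h; rewrite addn1; apply: form_ext => y _; rewrite !pochSr.
by rewrite (mulrAC R y) (mulrAC R y^-1); ring.
Qed.

(** With t1 = R y and t2 = R / y, both sides are forms in y: on the left each
    point brings one factor theta(R y z) theta(R z / y), on the right the form
    is the product of the factorials of t1 t3 and t2 t3. *)
Lemma summation_interpolation zs R t3 t4 ys :
  R != 0 -> t3 != 0 -> {in zs, forall z, z != 0} ->
  size ys = (size zs).+1 -> all (fun y => y != 0) ys ->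
  pairwise (fun y y' => (th (y * y') != 0) && (th (y / y') != 0)) ys ->
  {in ys, forall y, summation_at zs (R * y) (R / y) t3 t4} ->
  forall y, y != 0 -> summation_at zs (R * y) (R / y) t3 t4.
Proof.
move=> R0 t30 zs0 szy ys0 pwy hys y y0.
pose D y := signsum (site_weight (R * y) (R / y) t3 t4) zs
  + - 1 * sum_value (R * y) (R / y) t3 (size zs).
suff : D y = 0.
  by move/eqP; rewrite /D mulN1r subr_eq0 => /eqP.
have Dys : {in ys, forall y, D y = 0}.
  by move=> x /hys; rewrite /D => ->; rewrite mulN1r subrr.
apply: (@form_eq0 F o e (size zs) D ys) => //.
- apply: formD.
    apply: form_signsum => // w w0.
    have := formZ (th (t3 * w) * th (t4 * w) / th (w ^+ 2) / w)
       (form_th (mulf_neq0 R0 w0)).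
    apply: form_ext => x x0; rewrite /site_weight.
    by rewrite (mulrAC R w x) (mulrAC R w x^-1); ring.
  apply: formZ.
  have := formZ ((-1) ^+ size zs * poch (R ^+ 2) (size zs) /
      ((R ^+ 2 * t3) ^+ size zs * q ^+ (size zs * (size zs).-1)))
    (form_poch (size zs) (mulf_neq0 R0 t30)).
  apply: form_ext => x x0; rewrite /sum_value.
  have -> : R * x * (R / x) = R ^+ 2 by field.
  by rewrite (mulrAC R t3 x) (mulrAC R t3 x^-1); ring.
- apply: sub_in_pairwise pwy; last exact: ys0.
  move=> a b a0 b0 /andP[h1 h2]; have := mulf_neq0 h1 h2.
  by rewrite thA // mulf_eq0 negb_or => /andP[].
by apply/allP => x /Dys ->.
Qed.

Hypothesis thq : forall m, th (q ^+ m.+1) != 0.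
Hypothesis thU : forall a b : F, a != 0 -> b != 0 ->
  th a = 0 -> th b = 0 -> th (a / b) = 0.

Lemma thq_ratio i j : i != j -> th (q ^+ i / q ^+ j) != 0.
Proof.
wlog ij : i j / (i < j)%N => [H|_].
  case: (ltngtP i j) => // ij _; first by apply: H => //; rewrite ltn_eqF.
  rewrite -invf_div thV_eq0; first by apply: H => //; rewrite ltn_eqF.
  by rewrite mulf_neq0 ?invr_eq0 ?expf_neq0.
rewrite -invf_div thV_eq0 ?mulf_neq0 ?invr_eq0 ?expf_neq0 //.
by rewrite -expfB // -(subnSK ij) thq.
Qed.

(** Two zeros a q^m and a q^m' of theta would make q^(m - m') a zero. *)
Lemma eventually_nonzero (L : seq F) : all (fun a => a != 0) L ->
  exists M, forall m, (M <= m)%N -> all (fun a => th (a * q ^+ m) != 0) L.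
Proof.
elim: L => [|a L IH] /=; first by exists 0%N.
case/andP => a0 /IH[M hM].
have [[m0 hm0]|none] := pselect (exists m, th (a * q ^+ m) = 0); last first.
  exists M => m /hM ->; rewrite andbT.
  by apply/eqP => h; apply: none; exists m.
exists (maxn M m0.+1) => m; rewrite geq_max => /andP[Mm m0m].
rewrite hM // andbT; apply/eqP => hm.
have nz k : a * q ^+ k != 0 by rewrite mulf_neq0 ?expf_neq0.
have /eqP := thU (nz m) (nz m0) hm hm0.
by rewrite -mulf_div divff // mul1r (negPf (thq_ratio _)) // gtn_eqF.
Qed.

(** The factor split off by [signsum_collapse] contains theta(t1 t4), and t1 t4
    is the inverse of t2 t3 q^n because the parameters are balanced. *)
Lemma sum_value_collapse t1 t2 t3 t4 n :
  t1 != 0 -> t2 != 0 -> t3 != 0 -> t4 != 0 -> th (t1 ^+ 2) != 0 ->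
  t1 * t2 * t3 * t4 * q ^+ n.+1 = q ->
  site_weight t1 t2 t3 t4 t1 * sum_value (t1 * q) t2 t3 n = sum_value t1 t2 t3 n.+1.
Proof.
move=> t10 t20 t30 t40 tt bal; have qn0 := expf_neq0 n q0.
have e14 : t4 * t1 = (t2 * t3 * q ^+ n)^-1.
  apply: (mulIf (mulf_neq0 (mulf_neq0 t20 t30) qn0)).
  rewrite mulVf ?mulf_neq0 //; apply: (mulIf q0); rewrite mul1r -[RHS]bal exprS; ring.
rewrite /site_weight /sum_value e14 thV ?mulf_neq0 //.
rewrite (pochS (t1 * t2)) (pochS (t1 * t3)) (pochSr (t2 * t3)) /=.
rewrite (mulrAC t1 q t2) (mulrAC t1 q t3).
have -> : t1 * t2 * q * t3 = t1 * t2 * t3 * q by ring.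
have -> : q ^+ (n.+1 * n) = q ^+ (n * n.-1) * q ^+ n * q ^+ n.
  by rewrite -!exprD; congr (_ ^+ _); case: n {bal qn0 e14} => // n /=; lia.
rewrite (exprMn_comm _ (mulrC (t1 * t2 * t3) q)).
have tn0 := expf_neq0 n (mulf_neq0 (mulf_neq0 t10 t20) t30).
have qnn0 := expf_neq0 (n * n.-1) q0.
rewrite (exprS (-1)) (exprS (t1 * t2 * t3)) (mulrC t2 t1) (mulrC t3 t1).
by rewrite expr2 in tt *; field; rewrite tt qnn0 qn0 tn0 t10 t20 t30.
Qed.

Lemma summation_swap12 zs t1 t2 t3 t4 : summation_at zs t1 t2 t3 t4 -> summation_at zs t2 t1 t3 t4.
Proof.
rewrite /summation_at => h; transitivity (signsum (site_weight t1 t2 t3 t4) zs).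
  by apply: eq_signsum => z _; rewrite /site_weight; split; ring.
by rewrite h /sum_value (mulrC t2 t1); congr (_ / _); ring.
Qed.

Lemma summation_swap23 zs t1 t2 t3 t4 : summation_at zs t1 t2 t3 t4 -> summation_at zs t1 t3 t2 t4.
Proof.
rewrite /summation_at => h; transitivity (signsum (site_weight t1 t2 t3 t4) zs).
  by apply: eq_signsum => z _; rewrite /site_weight; split; ring.
by rewrite h /sum_value (mulrAC t1 t3 t2) (mulrC t3 t2); congr (_ / _); ring.
Qed.

(** The balancing condition is written with both sides multiplied by q, which
    avoids a predecessor when there are no points. *)
Theorem signsum_summation zs t1 t2 t3 t4 : generic_points zs ->
  t1 != 0 -> t2 != 0 -> t3 != 0 -> t4 != 0 ->
  t1 * t2 * t3 * t4 * q ^+ size zs = q -> summation_at zs t1 t2 t3 t4.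
Proof.
move: {2}(size zs) (erefl (size zs)) => n szs.
elim: n zs szs t1 t2 t3 t4 => [|n IH] zs szs t1 t2 t3 t4 gz t10 t20 t30 t40 bal.
  move/size0nil: szs => ->; rewrite /summation_at /sum_value /poch !big_ord0 /=.
  by rewrite !expr0 !mul1r invr1.
case: (gz) => uz hz1 hz2; have z0 z (h : z \in zs) := (hz1 z h).1.
(* If u1 is a point or the inverse of a point, that point is summed first and
   the induction hypothesis applies to the other ones. *)
have special u1 u2 u3 z : z \in zs -> u1 = z \/ u1 = z^-1 ->
    u2 != 0 -> u3 != 0 -> u1 * u2 * u3 * t4 * q ^+ size zs = q ->
    summation_at zs u1 u2 u3 t4.
  move=> zzs uz1 u20 u30 ubal.
  have u10 : u1 != 0 by case: uz1 => ->; rewrite ?invr_eq0 (hz1 z zzs).1.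
  have uu : th (u1 ^+ 2) != 0.
    case: uz1 => ->; first exact: (hz1 z zzs).2.
    by rewrite exprVn thV_eq0 ?expf_neq0 ?(z0 z zzs) // (hz1 z zzs).2.
  have gr := generic_rem zzs gz.
  have sr : size (rem z zs) = n by rewrite size_rem // szs.
  rewrite /summation_at (signsum_rem _ zzs) (signsum_collapse _ _ _ gr uz1).
  rewrite IH ?mulf_neq0 //; last 2 first.
    exact: generic_cons gr.
    by rewrite sr -[RHS]ubal szs exprS; ring.
  by rewrite sr szs sum_value_collapse // -szs.
have z1zs : head 0 zs \in zs by case: (zs) szs => // *; rewrite mem_head.
set z1 := head 0 zs in z1zs; have z10 := z0 _ z1zs.
(* Interpolation in u1 and u2 with fixed product: the nodes are u1 = 1/z for
   all points z, and u1 = z1 for one of them.  The two genericity assumptions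
   say that no two of these n + 1 nodes give proportional values of (o, e). *)
have level1 u1 u2 u3 : u1 != 0 -> u2 != 0 -> u3 != 0 ->
    u1 * u2 * u3 * t4 * q ^+ size zs = q ->
    {in zs &, forall y z, y != z -> th (y * z * (u1 * u2)) != 0} ->
    {in zs, forall z, th (z / z1 * (u1 * u2)) != 0} ->
    summation_at zs u1 u2 u3 t4.
  move=> u10 u20 u30 ubal g1 g2.
  pose y := sqrtC (u1 / u2); have y0 : y != 0 by rewrite sqrtC_eq0 mulf_neq0 ?invr_eq0.
  have yy : y ^+ 2 = u1 / u2 by rewrite sqrtCK.
  pose R := u2 * y; have R0 : R != 0 by rewrite mulf_neq0.
  have RR : R ^+ 2 = u1 * u2 by rewrite exprMn yy; field.
  have -> : u1 = R * y by rewrite /R -mulrA -expr2 yy; field.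
  have -> : u2 = R / y by rewrite /R mulfK.
  apply: (@summation_interpolation zs R u3 t4 (z1 / R :: [seq (z * R)^-1 | z <- zs])) => //; first by rewrite /= size_map.
  - rewrite /= mulf_neq0 ?invr_eq0 //= all_map; apply/allP => z zzs /=.
    by rewrite invr_eq0 mulf_neq0 ?(z0 _ zzs).
  - rewrite /= all_map pairwise_map; apply/andP; split.
      apply/allP => z zzs /=.
      have -> : z1 / R * (z * R)^-1 = (z / z1 * (u1 * u2))^-1.
        by rewrite -RR; field; rewrite ?R0 ?z0.
      have -> : z1 / R / (z * R)^-1 = z1 * z by field; rewrite ?R0 ?z0.
      rewrite thV_eq0 ?g2 ?mulf_neq0 ?invr_eq0 ?(z0 _ zzs) //=.
      have [->|ne] := eqVneq z z1; first exact: (hz1 _ z1zs).2.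
      by have [] := hz2 z1 z z1zs zzs; rewrite 1?eq_sym.
    have := uz; rewrite uniq_pairwise; apply: sub_in_pairwise (allss zs).
    move=> a b azs bzs /= ab.
    have -> : (a * R)^-1 * (b * R)^-1 = (a * b * (u1 * u2))^-1.
      by rewrite -RR; field; rewrite ?R0 ?z0.
    have -> : (a * R)^-1 / (b * R)^-1 = b / a by field; rewrite ?R0 ?z0.
    rewrite thV_eq0 ?g1 ?mulf_neq0 ?(z0 _ azs) ?(z0 _ bzs) //=.
    by have [] := hz2 b a bzs azs; rewrite 1?eq_sym.
  - move=> x; rewrite inE => /orP[/eqP ->|/mapP[z zzs ->]].
      apply: (special _ _ _ z1) => //; [left; by field|by rewrite !mulf_neq0 ?invr_eq0 ?mulf_neq0 ?invr_eq0|].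
      rewrite -[RHS]ubal -RR; congr (_ * _); field; by rewrite R0 z10.
    apply: (special _ _ _ z) => //; [right; by field; rewrite R0 z0|by rewrite !mulf_neq0 ?invr_eq0 ?invr_eq0 ?mulf_neq0 ?(z0 _ zzs)|].
    rewrite -[RHS]ubal -RR; congr (_ * _); field; by rewrite R0 z0.
(* Interpolation in t2 and t3 with fixed product, with nodes t2 = q^m: for m
   large, t1 t2 satisfies the genericity assumptions of the previous step, and
   the nodes are separated; the list L collects the conditions. *)
pose L := [seq y * z * t1 | y <- zs, z <- zs] ++ [seq z / z1 * t1 | z <- zs]
  ++ [:: (t2 * t3)^-1].
have L0 : all (fun a => a != 0) L.
  rewrite !all_cat /= andbT invr_eq0 mulf_neq0 // andbT; apply/andP; split.
    by apply/allP => _ /allpairsP[[y z] /= [yz zz ->]]; rewrite !mulf_neq0 ?(z0 _ yz) ?(z0 _ zz).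
  by apply/allP => _ /mapP[z zz ->]; rewrite !mulf_neq0 ?invr_eq0 ?(z0 _ zz).
have [M hM] := eventually_nonzero L0.
apply: summation_swap12; apply: summation_swap23.
pose y := sqrtC (t2 / t3); have y0 : y != 0 by rewrite sqrtC_eq0 mulf_neq0 ?invr_eq0.
have yy : y ^+ 2 = t2 / t3 by rewrite sqrtCK.
pose R := t3 * y; have R0 : R != 0 by rewrite mulf_neq0.
have RR : R ^+ 2 = t2 * t3 by rewrite exprMn yy; field.
have -> : t2 = R * y by rewrite /R -mulrA -expr2 yy; field.
have -> : t3 = R / y by rewrite /R mulfK.
apply: (@summation_interpolation zs R t1 t4 [seq q ^+ m / R | m <- iota M (size zs).+1]) => //.
- by rewrite size_map size_iota.
- by rewrite all_map; apply/allP => m _ /=; rewrite mulf_neq0 ?invr_eq0 ?expf_neq0.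
- rewrite pairwise_map.
  have := iota_uniq M (size zs).+1; rewrite uniq_pairwise.
  apply: sub_in_pairwise (allss _) => i j; rewrite !mem_iota => /andP[Mi _] /andP[Mj _] ij /=.
  have -> : q ^+ i / R * (q ^+ j / R) = (t2 * t3)^-1 * q ^+ (i + j).
    by rewrite -RR exprD; field.
  have -> : q ^+ i / R / (q ^+ j / R) = q ^+ i / q ^+ j by field; rewrite R0 expf_neq0.
  rewrite thq_ratio // andbT.
  have /allP -> // : all (fun a => th (a * q ^+ (i + j)) != 0) L.
    by apply: hM; rewrite (leq_trans Mi) ?leq_addr.
  by rewrite !mem_cat inE eqxx !orbT.
move=> x /mapP[m]; rewrite mem_iota => /andP[Mm _] ->.
have -> : R * (q ^+ m / R) = q ^+ m by field.
have -> : R / (q ^+ m / R) = t2 * t3 / q ^+ m by rewrite -RR; field; rewrite R0 expf_neq0.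
apply: summation_swap23; apply: summation_swap12.
have /allP hL := hM _ Mm.
apply: level1 => //; rewrite ?mulf_neq0 ?invr_eq0 ?expf_neq0 //.
- by rewrite -[RHS]bal; congr (_ * _); field; rewrite expf_neq0.
- move=> y' z' hy hz _; rewrite mulrA; apply: hL.
  by rewrite mem_cat; apply/orP; left; apply/allpairsP; exists (y', z').
move=> z hz; rewrite mulrA; apply: hL.
by rewrite !mem_cat; apply/orP; right; apply/orP; left; apply/mapP; exists z.
Qed.

End Interpolation.
End SignSum.

(** * Sums over boxes of multi-indices *)
Section Box.

Definition box n (N : {ffun 'I_n -> nat}) : seq {ffun 'I_n -> nat} :=
  [seq [ffun r => nat_of_ord (j r)] | j : {dffun forall r : 'I_n, 'I_(N r).+1}].

Lemma mem_box n (N k : {ffun 'I_n -> nat}) :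
  (k \in box N) = [forall r, (k r <= N r)%N].
Proof.
apply/fintype.imageP/forallP => [[j _ ->] r|h].
  by rewrite ffunE -ltnS.
exists [ffun r => Ordinal (h r : k r < (N r).+1)%N] => //.
by apply/ffunP => r; rewrite !ffunE.
Qed.

Lemma box_uniq n (N : {ffun 'I_n -> nat}) : uniq (box N).
Proof.
rewrite /box map_inj_uniq ?enum_uniq // => j j' /ffunP h.
by apply/ffunP => r; have := h r; rewrite !ffunE => /val_inj.
Qed.

Lemma eq_big_box (V : nmodType) n (N : {ffun 'I_n -> nat}) (s : seq {ffun 'I_n -> nat}) (F : _ -> V) :
  uniq s -> s =i box N -> \sum_(k <- box N) F k = \sum_(k <- s) F k.
Proof.
by move=> us es; apply: perm_big; apply: uniq_perm => //; rewrite ?box_uniq.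
Qed.

Definition fcons n (k0 : nat) (k : {ffun 'I_n -> nat}) : {ffun 'I_n.+1 -> nat} :=
  [ffun i => oapp k k0 (unlift ord0 i)].

Definition ftail n (k : {ffun 'I_n.+1 -> nat}) : {ffun 'I_n -> nat} :=
  [ffun i => k (lift ord0 i)].

Lemma fcons0 n k0 (k : {ffun 'I_n -> nat}) : fcons k0 k ord0 = k0.
Proof. by rewrite ffunE unlift_none. Qed.

Lemma fconsS n k0 (k : {ffun 'I_n -> nat}) i : fcons k0 k (lift ord0 i) = k i.
Proof. by rewrite ffunE liftK. Qed.

Lemma fcons_ftail n (k : {ffun 'I_n.+1 -> nat}) : fcons (k ord0) (ftail k) = k.
Proof.
apply/ffunP => i; case: (unliftP ord0 i) => [j|] ->; last by rewrite fcons0.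
by rewrite fconsS ffunE.
Qed.

Lemma big_boxS (V : nmodType) n (N : {ffun 'I_n.+1 -> nat}) (F : _ -> V) :
  \sum_(k <- box N) F k =
  \sum_(k0 < (N ord0).+1) \sum_(k <- box (ftail N)) F (fcons k0 k).
Proof.
rewrite (@eq_big_box _ _ N
  [seq fcons k0 k | k0 <- iota 0 (N ord0).+1, k <- box (ftail N)]).
- have -> : iota 0 (N ord0).+1 = index_iota 0 (N ord0).+1 by rewrite /index_iota subn0.
  by rewrite big_allpairs_dep big_mkord.
- apply: allpairs_uniq; rewrite ?iota_uniq ?box_uniq //.
  move=> [a k] [a' k'] _ _ /= h.
  have := congr1 (fun f : {ffun _ -> nat} => f ord0) h; rewrite !fcons0 => <-.
  congr pair; apply/ffunP => i.
  by have := congr1 (fun f : {ffun _ -> nat} => f (lift ord0 i)) h; rewrite !fconsS.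
move=> k; rewrite mem_box; apply/allpairsP/forallP => [[[a k'] [ha hk ->]] i|h].
  case: (unliftP ord0 i) => [j|] ->.
    by rewrite fconsS; move: hk; rewrite /= mem_box => /forallP/(_ j); rewrite ffunE.
  by rewrite fcons0; rewrite mem_iota add0n ltnS in ha.
exists (k ord0, ftail k); split; last by rewrite fcons_ftail.
  by rewrite mem_iota add0n ltnS h.
by rewrite mem_box; apply/forallP => i; rewrite !ffunE.
Qed.

Lemma big_box_shift (V : nmodType) n (N j : {ffun 'I_n -> nat}) (F : _ -> V) :
  (forall r, (j r <= N r)%N) ->
  \sum_(k <- box N | [forall r, (j r <= k r)%N]) F k =
  \sum_(m <- box [ffun r => (N r - j r)%N]) F [ffun r => (j r + m r)%N].
Proof.
move=> jN; rewrite -big_filter.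
transitivity (\sum_(k <- [seq [ffun r => (j r + (m : {ffun _ -> nat}) r)%N]
   | m <- box [ffun r => (N r - j r)%N]]) F k); last by rewrite big_map.
apply: perm_big; apply: uniq_perm.
- by rewrite filter_uniq ?box_uniq.
- rewrite map_inj_uniq ?box_uniq // => m m' /ffunP h; apply/ffunP => r.
  by have := h r; rewrite !ffunE => /addnI.
move=> k; rewrite mem_filter mem_box; apply/andP/mapP => [[/forallP h1 /forallP h2]|].
  exists [ffun r => (k r - j r)%N]; last by apply/ffunP => r; rewrite !ffunE subnKC.
  by rewrite mem_box; apply/forallP => r; rewrite !ffunE leq_sub2r.
case=> m; rewrite mem_box => /forallP h ->; split; apply/forallP => r.
  by rewrite ffunE leq_addr.
by rewrite ffunE -(subnKC (jN r)) leq_add2l; have := h r; rewrite ffunE.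
Qed.

End Box.

(** * Sums over signs on strings of points *)
Section Strings.
Variables (F : numClosedFieldType) (th : F -> F) (q : F).
Local Notation interaction := (interaction th q).
Local Notation signsum := (signsum th q).

Definition invert_prefix (k : nat) (zs : seq F) : seq F :=
  [seq z^-1 | z <- take k zs] ++ drop k zs.

(** The term of [signsum] that belongs to the choice ws. *)
Fixpoint signed_term (g : F -> F) (ws : seq F) : F :=
  if ws is w :: ws' then g w * signed_term (fun v => g v * interaction v w) ws' else 1.

Lemma eq_signed_term g1 g2 ws : g1 =1 g2 -> signed_term g1 ws = signed_term g2 ws.
Proof.
by elim: ws g1 g2 => //= w ws IH g1 g2 h; rewrite h; congr (_ * _); apply: IH => v; rewrite h.
Qed.

Lemma signed_termM g h ws : signed_term (fun v => g v * h v) ws = signed_term g ws * \prod_(w <- ws) h w.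
Proof.
elim: ws g => [|w ws IH] g /=; first by rewrite big_nil mulr1.
rewrite big_cons (@eq_signed_term _ (fun v => g v * interaction v w * h v)); last by move=> v; ring.
by rewrite IH; ring.
Qed.

(** A point that keeps its sign annihilates the inversion of its successor, so
    the inverted points form a prefix. *)
Lemma signsum_string g zs rest :
  sorted (fun y z => interaction z^-1 y == 0) zs ->
  signsum g (zs ++ rest) =
  \sum_(k < (size zs).+1) signed_term g (invert_prefix k zs) *
     signsum (fun v => g v * \prod_(w <- invert_prefix k zs) interaction v w) rest.
Proof.
elim: zs g => [|z zs IH] g /= srt.
  rewrite big_ord_recl big_ord0 addr0 /= mul1r; apply: eq_signsum => v _.
  by rewrite !big_nil !mulr1.
rewrite !IH ?(path_sorted srt) // !mulr_sumr [in RHS]big_ord_recl; congr (_ + _).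
  rewrite big_ord_recl big1 ?addr0.
    rewrite /invert_prefix !take0 !drop0 /= mulrA; congr (_ * _).
    by apply: eq_signsum => v _; rewrite !big_cons; split; ring.
  move=> i _; case: zs {IH} srt i => [|y zs] srt i; first by case: i.
  rewrite /invert_prefix /=; case/andP: srt => /eqP -> _.
  by rewrite mulr0 !mul0r mulr0.
apply: eq_bigr => i _; rewrite mulrA; congr (_ * _).
by apply: eq_signsum => v _; rewrite !big_cons; split; ring.
Qed.

Lemma signsum_strings n (zss : 'I_n -> seq F) g :
  (forall r, sorted (fun y z => interaction z^-1 y == 0) (zss r)) ->
  signsum g (flatten [seq zss r | r <- enum 'I_n]) =
  \sum_(k <- box [ffun r => size (zss r)])
    \prod_(r < n) signed_term g (invert_prefix (k r) (zss r)) *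
    \prod_(r < n) \prod_(s < n | (r < s)%N)
      \prod_(v <- invert_prefix (k s) (zss s))
        \prod_(w <- invert_prefix (k r) (zss r)) interaction v w.
Proof.
elim: n zss g => [|n IH] zss g srt.
  rewrite enum_ord0 /=.
  rewrite (@eq_big_box _ _ _ [:: [ffun=> 0%N]]) //.
    by rewrite big_seq1 !big_ord0 mulr1.
  move=> k; rewrite inE mem_box; apply/eqP/forallP => [_ []//|_].
  by apply/ffunP => -[].
rewrite enum_ordSl /= -map_comp signsum_string // big_boxS ffunE.
apply: eq_bigr => k0 _; rewrite IH; last by move=> r; exact: srt.
rewrite mulr_sumr.
have -> : ftail [ffun r => size (zss r)] = [ffun r => size (zss (lift ord0 r))].
  by apply/ffunP => r; rewrite !ffunE.
apply: eq_bigr => k _.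
rewrite !big_ord_recl !fcons0.
under [X in _ = _ * X * _]eq_bigr do rewrite fconsS.
under [X in _ * (X * _) = _]eq_bigr do rewrite signed_termM.
rewrite big_split /= -!mulrA; congr (_ * (_ * _)).
congr (_ * _).
  rewrite [RHS]big_mkcond big_ord_recl /= mul1r.
  by apply: eq_bigr => i _; rewrite fconsS.
apply: eq_bigr => r _; rewrite [RHS]big_mkcond big_ord_recl /= mul1r -big_mkcond.
by apply: eq_bigr => s _; rewrite !fconsS.
Qed.

End Strings.

(** * Closed forms of the terms *)
Section ClosedForms.
Variables (F : numClosedFieldType) (th : F -> F) (q : F).
Local Notation interaction := (interaction th q).
Local Notation signed_term := (signed_term th q).
Local Notation P := (poch th q).
Hypothesis q0 : q != 0.
Hypothesis thV : forall z : F, z != 0 -> th z^-1 = - th z / z.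

Definition string (A : F) (L : nat) : seq F := [seq A * q ^+ l | l <- iota 0 L].

Lemma size_string A L : size (string A L) = L.
Proof. by rewrite size_map size_iota. Qed.

Lemma stringS A L : string A L.+1 = A :: string (A * q) L.
Proof.
rewrite /string /= expr0 mulr1; congr (_ :: _).
by rewrite -[1%N]addn0 iotaDl -map_comp; apply: eq_map => i /=; rewrite exprS mulrA.
Qed.

Lemma stringSr A L : string A L.+1 = rcons (string A L) (A * q ^+ L).
Proof. by rewrite /string -addn1 iotaD map_cat cats1. Qed.

Lemma string_split A L m : (m <= L)%N ->
  string A L = string A m ++ string (A * q ^+ m) (L - m).
Proof.
move=> mL; rewrite -{1}(subnKC mL) /string iotaD map_cat; congr (_ ++ _).
rewrite add0n -[m in iota m]addn0 iotaDl -map_comp.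
by apply: eq_map => i /=; rewrite exprD mulrA.
Qed.

Lemma prefix_string A L m : (m <= L)%N ->
  invert_prefix m (string A L) = [seq z^-1 | z <- string A m] ++ string (A * q ^+ m) (L - m).
Proof.
move=> mL; rewrite /invert_prefix (string_split A mL).
by rewrite take_size_cat ?drop_size_cat // size_string.
Qed.

Lemma big_string (G : F -> F) A L :
  \prod_(z <- string A L) G z = \prod_(l < L) G (A * q ^+ l).
Proof.
have -> : string A L = [seq A * q ^+ l | l <- index_iota 0 L].
  by rewrite /index_iota subn0.
by rewrite big_map big_mkord.
Qed.

Lemma pochD u m n : P u (m + n) = P u m * P (u * q ^+ m) n.
Proof.
rewrite /poch big_split_ord /=; congr (_ * _).
by apply: eq_bigr => i _; rewrite exprD mulrA.
Qed.

Lemma poch_neq0 u n : (forall i, th (u * q ^+ i) != 0) -> P u n != 0.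
Proof. by move=> h; apply/prodf_neq0 => i _. Qed.

(** The factorial with its factors listed from the last one to the first. *)
Lemma poch_rev u n : \prod_(i < n) th (u * q ^+ n / q ^+ i) = P (u * q) n.
Proof.
rewrite /poch (reindex_inj rev_ord_inj); apply: eq_bigr => i _ /=; congr th.
rewrite -!mulrA; congr (_ * _); apply: (mulIf (expf_neq0 (n - i.+1) q0)).
rewrite -mulrA mulVf ?expf_neq0 // mulr1 -mulrA -exprD -exprS; congr (_ ^+ _).
by have := ltn_ord i; lia.
Qed.

Lemma telescope_up (f : nat -> F) n : (forall i, f i != 0) ->
  \prod_(i < n) (f i.+1 / f i) = f n / f 0%N.
Proof.
move=> f0; elim: n => [|n IH]; first by rewrite big_ord0 divff.
by rewrite big_ord_recr /= IH; field; rewrite !f0.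
Qed.

Lemma telescope_down (f : nat -> F) n : (forall i, f i != 0) ->
  \prod_(i < n) (f i / f i.+1) = f 0%N / f n.
Proof.
move=> f0; elim: n => [|n IH]; first by rewrite big_ord0 divff.
by rewrite big_ord_recr /= IH; field; rewrite !f0.
Qed.

(** Along a string, the numerator of each interaction is the denominator of the
    next one; for the inverted points it is the other way around. *)
Lemma prod_interaction_prefix (w B : F) L m : (m <= L)%N ->
  (forall i, th (w * B * q ^+ i) != 0) -> (forall i, th (w / B * q / q ^+ i) != 0) ->
  \prod_(v <- invert_prefix m (string B L)) interaction v w =
  th (w * B * q ^+ L) / th (w * B * q ^+ m) *
  (th (w / B * q) / th (w / B * q / q ^+ m)).
Proof.
move=> mL h1 h2; rewrite prefix_string // big_cat big_map !big_string /= mulrC.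
congr (_ * _).
  have := @telescope_up (fun i => th (w * B * q ^+ (m + i))) (L - m) (fun i => h1 _).
  rewrite /= addn0 subnKC // => <-; apply: eq_bigr => i _; rewrite /interaction addnS exprS exprD.
  by congr (th _ / th _); ring.
have := @telescope_down (fun i => th (w / B * q / q ^+ i)) m h2.
rewrite /= expr0 invr1 mulr1 => <-; apply: eq_bigr => i _; rewrite /interaction exprS.
by rewrite !invfM; congr (th _ / th _); first ring;
  rewrite -[LHS]mul1r -(divff q0); ring.
Qed.

(** The interactions telescope along the string of B, and what remains is a
    product of factorials along the string of A.  The factor q^(m m') comes from
    reflecting the factors in which both points are inverted. *)
Lemma cross_prefix (A B : F) L L' m m' : (m <= L)%N -> (m' <= L')%N ->
  A != 0 -> B != 0 ->
  (forall i, th (A * B / q * q ^+ i) != 0) -> (forall i : int, th (q ^ i * (A / B)) != 0) ->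
  \prod_(v <- invert_prefix m' (string B L')) \prod_(w <- invert_prefix m (string A L)) interaction v w =
  q ^+ (m * m') *
  (P (A * B) (L + L') * P (A * B / q) m * P (A * B / q) m' * th (A * B / q * q ^+ (m + m'))
   / (P (A * B) (m + L') * P (A * B) (L + m') * th (A * B / q))) *
  (P (q * (A / B)) L * P (q * (B / A)) L'
   / (P (q ^ (1 + m%:Z - m'%:Z) * (A / B)) (L - m)
      * P (q ^ (1 + m'%:Z - m%:Z) * (B / A)) (L' - m')
      * P (q * (A / B)) m * P (q * (B / A)) m')).
Proof.
move=> mL mL' A0 B0 hU hD.
have qn n : q ^+ n != 0 by rewrite expf_neq0.
have [U eU] : exists U, U = A * B / q by exists (A * B / q).
have [D eD] : exists D, D = A / B by exists (A / B).
have U0 : U != 0 by rewrite eU !mulf_neq0 ?invr_eq0.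
have D0 : D != 0 by rewrite eD mulf_neq0 ?invr_eq0.
have eAB : A * B = U * q by rewrite eU; field.
have eA : A = D * B by rewrite eD; field.
have eBdA : B / A = D^-1 by rewrite eD invf_div.
rewrite -eU in hU *; rewrite -eD in hD *; rewrite eAB eBdA.
have hDV (i : int) : th (q ^ i * D^-1) != 0.
  have -> : q ^ i * D^-1 = (q ^ (- i) * D)^-1 by rewrite invfM -invr_expz invrK.
  by rewrite (thV_eq0 thV (mulf_neq0 (expfz_neq0 _ q0) D0)) hD.
have hDn i j : th (D * q ^+ i / q ^+ j) != 0.
  have -> : D * q ^+ i / q ^+ j = q ^ (i%:Z - j%:Z) * D.
    by rewrite expfzDr // -invr_expz -!exprnP; ring.
  exact: hD.
have hDVn i j : th (D^-1 * q ^+ i / q ^+ j) != 0.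
  have -> : D^-1 * q ^+ i / q ^+ j = q ^ (i%:Z - j%:Z) / D.
    by rewrite expfzDr // -invr_expz -!exprnP; ring.
  exact: hDV.
have nzU a k : P (U * q ^+ a) k != 0.
  by apply: poch_neq0 => i; rewrite -mulrA -exprD hU.
have nzD a b k : P (D * q ^+ a / q ^+ b) k != 0.
  by apply: poch_neq0 => i; rewrite mulrAC -(mulrA D) -exprD hDn.
have nzDV a b k : P (D^-1 * q ^+ a / q ^+ b) k != 0.
  by apply: poch_neq0 => i; rewrite mulrAC -(mulrA D^-1) -exprD hDVn.
have lo : \prod_(l < m) \prod_(i <- invert_prefix m' (string B L')) interaction i (A * q ^+ l)^-1
    = q ^+ (m * m') * (P U m / P (U * q ^+ m') m) *
      (P (D^-1 * q ^+ L' / q ^+ m * q) m / P (D^-1 * q ^+ m' / q ^+ m * q) m).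
  have -> : q ^+ (m * m') = \prod_(l < m) q ^+ m'.
    by rewrite prodr_const card_ord -exprM mulnC.
  rewrite -!poch_rev /poch -!prodf_div -!big_split /=.
  apply: eq_bigr => l _.
  have ewB : (A * q ^+ l)^-1 * B = D^-1 / q ^+ l.
    by rewrite eA; field; rewrite B0 D0 qn.
  have ewq : (A * q ^+ l)^-1 / B * q = (U * q ^+ l)^-1.
    by rewrite eU; field; rewrite q0 A0 B0 qn.
  rewrite prod_interaction_prefix //.
  - rewrite ewB ewq.
    have g a : D^-1 * q ^+ a / q ^+ m * q ^+ m / q ^+ l = D^-1 / q ^+ l * q ^+ a.
      by field; rewrite D0 !qn.
    rewrite !g (thV (mulf_neq0 U0 (qn _))).
    have -> : (U * q ^+ l)^-1 / q ^+ m' = (U * q ^+ m' * q ^+ l)^-1.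
      by rewrite -invfM mulrAC.
    rewrite (thV (mulf_neq0 (mulf_neq0 U0 (qn _)) (qn _))).
    have gD a : th (D^-1 / q ^+ l * q ^+ a) != 0 by rewrite mulrAC hDVn.
    have gU : th (U * q ^+ m' * q ^+ l) != 0 by rewrite -mulrA -exprD hU.
    by field; rewrite ?gD ?gU ?U0 ?qn ?hU.
  - by move=> a; rewrite ewB mulrAC hDVn.
  move=> a; rewrite ewq -invfM (thV_eq0 thV) -mulrA -exprD ?hU //.
  by rewrite mulf_neq0.
have hi : \prod_(l < L - m) \prod_(i <- invert_prefix m' (string B L'))
      interaction i (A * q ^+ m * q ^+ l) =
    P (U * q * q ^+ (m + L')) (L - m) / P (U * q * q ^+ (m + m')) (L - m) *
    (P (q * D * q ^+ m) (L - m) / P (q * D * q ^+ m / q ^+ m') (L - m)).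
  rewrite /poch -!prodf_div -!big_split /=; apply: eq_bigr => l _.
  have ewB : A * q ^+ m * q ^+ l * B = U * q * q ^+ m * q ^+ l.
    by rewrite -eAB; ring.
  have ewq : A * q ^+ m * q ^+ l / B * q = q * D * q ^+ m * q ^+ l.
    by rewrite eD; ring.
  rewrite prod_interaction_prefix // ?ewB ?ewq.
  - by rewrite !exprD; congr (th _ / th _ * (th _ / th _)); ring.
  - by move=> a; rewrite -!mulrA -!exprD -exprS hU.
  move=> a; have -> : q * D * q ^+ m * q ^+ l / q ^+ a = D * q ^+ (m + l).+1 / q ^+ a.
    by rewrite exprS exprD; ring.
  exact: hDn.
rewrite exchange_big /= prefix_string // big_cat big_map !big_string /= lo hi.
have -> : q ^ (1 + m%:Z - m'%:Z) * D = q * D * q ^+ m / q ^+ m'.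
  by rewrite !expfzDr // -invr_expz -!exprnP expr1; ring.
have -> : q ^ (1 + m'%:Z - m%:Z) / D = D^-1 * q ^+ m' / q ^+ m * q.
  by rewrite !expfzDr // -invr_expz -!exprnP expr1; ring.
have nzU1 k : P U k != 0 by have := nzU 0%N k; rewrite expr0 mulr1.
have nzUq k : P (U * q) k != 0 by have := nzU 1%N k; rewrite expr1.
have p1 : P (U * q) (L + L') =
    P (U * q) (m + L') * P (U * q * q ^+ (m + L')) (L - m).
  by rewrite -pochD; congr P; lia.
have p2 : P (U * q) (L + m') =
    P (U * q) (m + m') * P (U * q * q ^+ (m + m')) (L - m).
  by rewrite -pochD; congr P; lia.
have p3 : P U (m + m') = P U m' * P (U * q ^+ m') m by rewrite -pochD addnC.
have p4 : th U * P (U * q) (m + m') = P U (m + m') * th (U * q ^+ (m + m')).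
  by rewrite -pochS pochSr.
have p5 : P (q * D) L = P (q * D) m * P (q * D * q ^+ m) (L - m).
  by rewrite -pochD subnKC.
pose W := D^-1 / q ^+ m * q.
have eW a : D^-1 * q ^+ a / q ^+ m * q = W * q ^+ a by rewrite /W; ring.
rewrite !eW.
have p6 : P (W * q ^+ L') m * P (W * q ^+ m') (L' - m') =
    P (W * q ^+ m') m * P (q / D * q ^+ m') (L' - m').
  transitivity (P (W * q ^+ m') (m + (L' - m'))).
    rewrite addnC pochD mulrC -(mulrA W) -exprD subnKC //.
  rewrite pochD; congr (_ * P _ _); rewrite /W; field; by rewrite D0 qn.
have p7 : P (q / D) L' = P (q / D) m' * P (q / D * q ^+ m') (L' - m').
  by rewrite -pochD subnKC.
have nzW a k : P (W * q ^+ a) k != 0.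
  have -> : W * q ^+ a = D^-1 * q ^+ a.+1 / q ^+ m by rewrite /W exprS; ring.
  exact: nzDV.
have nzqD k : P (q * D) k != 0.
  have -> : q * D = D * q ^+ 1 / q ^+ 0 by rewrite expr1 expr0; field.
  exact: nzD.
have nzqDV k : P (q / D) k != 0.
  have -> : q / D = D^-1 * q ^+ 1 / q ^+ 0 by rewrite expr1 expr0; field.
  exact: nzDV.
have nz8 : P (q * D * q ^+ m / q ^+ m') (L - m) != 0.
  have -> : q * D * q ^+ m / q ^+ m' = D * q ^+ m.+1 / q ^+ m' by rewrite exprS; ring.
  exact: nzD.
have nz9 : P (U * q * q ^+ (m + m')) (L - m) != 0.
  by rewrite -(mulrA U) -exprS nzU.
have thU0 : th U != 0 by have := hU 0%N; rewrite expr0 mulr1.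
have p8 : P (W * q ^+ L') m =
    P (W * q ^+ m') m * P (q / D * q ^+ m') (L' - m') / P (W * q ^+ m') (L' - m').
  by rewrite -p6 mulfK.
have p9 : th (U * q ^+ (m + m')) = th U * P (U * q) (m + m') / (P U m' * P (U * q ^+ m') m).
  by rewrite p4 -p3 mulrAC divff ?mul1r.
rewrite p1 p2 p5 p7 p8 p9; field.
by rewrite ?nzU1 ?nzUq ?nzU ?nzW ?nzqD ?nzqDV ?nz8 ?nz9 ?thU0.
Qed.

Lemma signed_term_cat g ws1 ws2 : signed_term g (ws1 ++ ws2) =
  signed_term g ws1 * signed_term g ws2 * \prod_(v <- ws2) \prod_(w <- ws1) interaction v w.
Proof.
elim: ws1 g => [|w ws1 IH] g /=.
  by rewrite mul1r [X in _ * X]big1 ?mulr1 // => v _; rewrite big_nil.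
rewrite IH (signed_termM _ _ g _ ws2); under [X in _ = _ * X]eq_bigr do rewrite big_cons.
by rewrite [X in _ = _ * X]big_split /=; ring.
Qed.

Hypothesis thq : forall m, th (q ^+ m.+1) != 0.

Section Weights.
Variables t1 t2 t3 t4 : F.
Hypotheses (t10 : t1 != 0) (t20 : t2 != 0) (t30 : t3 != 0) (t40 : t4 != 0).
Local Notation g := (site_weight th t1 t2 t3 t4).

(** The factors of t4 are reflected, because in the summation formula they
    occur with decreasing arguments. *)
Lemma signed_term_string (A : F) n : A != 0 -> (forall i, th (A ^+ 2 * q ^+ i) != 0) ->
  signed_term g (string A n) =
  (- t4) ^+ n * P (q / (t4 * A * q ^+ n)) n * (P (t1 * A) n * P (t2 * A) n * P (t3 * A) n)
  * (P (A ^+ 2 * q ^+ n) n / P (A ^+ 2) (2 * n)).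
Proof.
elim: n A => [|n IH] A A0 hA.
  by rewrite /poch !big_ord0 expr0 !mul1r invr1.
have qn k : q ^+ k != 0 by rewrite expf_neq0.
rewrite stringS /= (signed_termM _ _ g) IH ?mulf_neq0 //; last first.
  by move=> i; rewrite exprMn -mulrA -exprD hA.
have -> : \prod_(w <- string (A * q) n) interaction w A =
    th (A ^+ 2 * q * q ^+ n) / th (A ^+ 2 * q).
  rewrite big_string.
  have := @telescope_up (fun i => th (A ^+ 2 * q * q ^+ i)) n.
  rewrite /= expr0 mulr1 => <-; last by move=> i; rewrite -mulrA -exprS hA.
  by apply: eq_bigr => i _; rewrite /interaction (exprS q); congr (th _ / th _); ring.
have -> : g A = - t4 * th (t4 * A)^-1 * (th (t1 * A) * th (t2 * A) * th (t3 * A))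
    / th (A ^+ 2).
  rewrite /site_weight thV ?mulf_neq0 //; have := hA 0%N; rewrite expr0 mulr1 => hA0.
  by field; rewrite A0 t40 hA0.
have -> : (2 * n.+1 = (2 * n).+2)%N by lia.
rewrite (pochSr th q (q / _)) !pochS !mulrA.
have -> : q / (t4 * A * q ^+ n.+1) * q ^+ n = (t4 * A)^-1.
  by rewrite (exprS q); field; rewrite t40 A0 q0 qn.
have -> : t4 * A * q * q ^+ n = t4 * A * q ^+ n.+1 by rewrite (exprS q); ring.
have -> : A ^+ 2 * q * q ^+ n = A ^+ 2 * q ^+ n.+1 by rewrite (exprS q); ring.
have -> : (A * q) ^+ 2 * q ^+ n = A ^+ 2 * q ^+ n.+1 * q by rewrite (exprS q); ring.
have -> : (A * q) ^+ 2 = A ^+ 2 * q * q by ring.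
have h0 : th (A ^+ 2) != 0 by have := hA 0%N; rewrite expr0 mulr1.
have h1 : th (A ^+ 2 * q) != 0 by have := hA 1%N; rewrite expr1.
have h2 : P (A ^+ 2 * q * q) (2 * n) != 0.
  by apply: poch_neq0 => k; rewrite -(mulrA (A ^+ 2 * q)) -exprS -(mulrA (A ^+ 2)) -exprS hA.
by rewrite (exprS (- t4)); field; rewrite h0 h1 h2.
Qed.

(** All theta functions are reflected; the signs and powers left over combine to
    the power of the product of the parameters. *)
Lemma signed_term_inverted_string (A : F) m : A != 0 ->
  (forall i, th (A ^+ 2 / q * q ^+ i) != 0) ->
  signed_term g [seq z^-1 | z <- string A m] =
  (- (t1 * t2 * t3 * t4) / A) ^+ m
  * (P (A / t1) m * P (A / t2) m * P (A / t3) m * P (A / t4) m)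
  * (P (A ^+ 2 / q) m / P (A ^+ 2 / q) (2 * m)).
Proof.
move=> A0 hA; elim: m => [|m IH].
  by rewrite /poch !big_ord0 expr0 !mul1r invr1.
have qn k : q ^+ k != 0 by rewrite expf_neq0.
rewrite stringSr map_rcons -cats1 signed_term_cat IH /= big_seq1 mulr1.
have [U eU] : exists U, U = A ^+ 2 / q by exists (A ^+ 2 / q).
have U0 : U != 0 by rewrite eU mulf_neq0 ?expf_neq0 ?invr_eq0.
rewrite -eU in hA *.
have -> : \prod_(w <- [seq z^-1 | z <- string A m]) interaction (A * q ^+ m)^-1 w =
    q ^+ m * (th (U * q ^+ m) / th (U * q ^+ (m + m))).
  rewrite big_map big_string.
  have := @telescope_down (fun i => th (U * q ^+ (m + i))) m (fun i => hA _).
  have em : q ^+ m = \prod_(l < m) q by rewrite prodr_const card_ord.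
  rewrite /= addn0 => <-; rewrite [X in _ = X * _]em -big_split /=.
  apply: eq_bigr => i _; rewrite /interaction.
  have -> : q * (A * q ^+ m)^-1 * (A * q ^+ i)^-1 = (U * q ^+ (m + i))^-1.
    by rewrite eU exprD; field; rewrite q0 A0 !qn.
  have -> : (A * q ^+ m)^-1 * (A * q ^+ i)^-1 = (U * q ^+ (m + i.+1))^-1.
    by rewrite eU exprD (exprS q i); field; rewrite q0 A0 !qn.
  rewrite !thV ?mulf_neq0 // addnS (exprS q).
  by have := hA (m + i).+1; rewrite (exprS q) => h; field; rewrite h U0 q0 qn.
have -> : g (A * q ^+ m)^-1 = - (t1 * t2 * t3 * t4) / (A * q ^+ m) *
    (th (A / t1 * q ^+ m) * th (A / t2 * q ^+ m) * th (A / t3 * q ^+ m)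
     * th (A / t4 * q ^+ m)) / th (U * q ^+ (m + m).+1).
  have flip t : t != 0 -> th (t * (A * q ^+ m)^-1) =
      - th (A / t * q ^+ m) * t / (A * q ^+ m).
    move=> t0; have -> : t * (A * q ^+ m)^-1 = (A / t * q ^+ m)^-1.
      by field; rewrite t0 A0 qn.
    by rewrite thV ?mulf_neq0 ?invr_eq0 //; field; rewrite t0 A0 qn.
  have eW : (A * q ^+ m) ^+ 2 = U * q ^+ (m + m).+1.
    by rewrite eU (exprS q) exprD; field; rewrite q0.
  rewrite /site_weight (flip t1) // (flip t2) // (flip t3) // (flip t4) // exprVn thV ?expf_neq0 ?mulf_neq0 // eW.
  have h := hA (m + m).+1; rewrite -eW; rewrite -eW in h.
  by field; rewrite A0 qn h.
have -> : (2 * m.+1 = (m + m).+2)%N by lia.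
have -> : (2 * m = m + m)%N by lia.
rewrite !pochSr.
have h2 : P U (m + m) != 0 by apply: poch_neq0.
by rewrite (exprS (- _ / _)); field; rewrite h2 !hA A0 qn.
Qed.

(** The interactions within the two parts of the string, together with the
    denominators theta(w^2) of the weights, give the very-well-poised factor; those
    between the two parts give the q-binomial coefficient of L and m. *)
Lemma signed_term_prefix (A : F) L m : (m <= L)%N -> A != 0 ->
  (forall i, th (A ^+ 2 / q * q ^+ i) != 0) ->
  signed_term g (invert_prefix m (string A L)) =
  (- t4) ^+ (L - m) * (- (t1 * t2 * t3 * t4) / A) ^+ m
  * (P (q / (t4 * A * q ^+ L)) (L - m) * P (t1 * A * q ^+ m) (L - m)
     * P (t2 * A * q ^+ m) (L - m) * P (t3 * A * q ^+ m) (L - m))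
  * (P (A / t1) m * P (A / t2) m * P (A / t3) m * P (A / t4) m)
  * (P (A ^+ 2 / q) m * th (A ^+ 2 / q * q ^+ (2 * m))
     / (th (A ^+ 2 / q) * P (A ^+ 2) (m + L)))
  * (P q L / (P q (L - m) * P q m)).
Proof.
move=> mL A0 hA; have qn k : q ^+ k != 0 by rewrite expf_neq0.
rewrite prefix_string // signed_term_cat signed_term_inverted_string //.
have [n en] : exists n, n = (L - m)%N by exists (L - m)%N.
have eL : L = (m + n)%N by rewrite en subnKC.
rewrite -en {en mL} eL.
have [U eU] : exists U, U = A ^+ 2 / q by exists (A ^+ 2 / q).
have eA : A ^+ 2 = U * q by rewrite eU; field.
rewrite -eU in hA *.
have hA2 i : th (A ^+ 2 * q ^+ i) != 0 by rewrite eA -mulrA -exprS hA.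
rewrite signed_term_string ?mulf_neq0 //; last first.
  by move=> i; rewrite exprMn -mulrA -exprM -exprD hA2.
have -> : \prod_(v <- string (A * q ^+ m) n)
    \prod_(w <- [seq z^-1 | z <- string A m]) interaction v w =
    P q (m + n) / (P q n * P q m).
  rewrite exchange_big big_map big_string /=.
  transitivity (\prod_(l < m) (th (q ^+ n * q ^+ m / q ^+ l) / th (1 * q ^+ m / q ^+ l))).
    apply: eq_bigr => l _; rewrite big_string mul1r.
    have := @telescope_up (fun i => th (q ^+ m / q ^+ l * q ^+ i)) n.
    rewrite /= expr0 mulr1 (mulrC (q ^+ n)) (mulrAC (q ^+ m)) => <-.
      apply: eq_bigr => i _; rewrite /interaction (exprS q).
      by congr (th _ / th _); field; rewrite A0 qn.
    move=> i; rewrite -expfB // -exprD -(subnSK (ltn_ord l)) addSn; exact: thq.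
  rewrite prodf_div !poch_rev mul1r addnC pochD -(mulrC q).
  have h k : P q k != 0 by apply: poch_neq0 => i; rewrite -exprS; exact: thq.
  by field; rewrite !h.
have -> : q / (t4 * (A * q ^+ m) * q ^+ n) = q / (t4 * A * q ^+ (m + n)).
  by rewrite exprD !mulrA.
rewrite !(mulrA _ A (q ^+ m)).
have e2 : (A * q ^+ m) ^+ 2 = U * q * q ^+ (2 * m).
  by rewrite exprMn eA -exprM mulnC.
rewrite e2 eA.
have p1 : P (U * q) (m + (m + n)) * P (U * q * q ^+ (2 * m) * q ^+ n) n =
    P (U * q) (2 * m) * P (U * q * q ^+ (2 * m)) (2 * n).
  rewrite -pochD -(mulrA (U * q)) -exprD.
  have -> : (2 * m + n = m + (m + n))%N by lia.
  by rewrite -pochD; congr P; lia.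
have p2 : th U * P (U * q) (2 * m) = P U (2 * m) * th (U * q ^+ (2 * m)).
  by rewrite -pochS pochSr.
have nz k i : P (U * q ^+ i) k != 0.
  by apply: poch_neq0 => a; rewrite -mulrA -exprD hA.
have nz0 k : P U k != 0 by have := nz k 0%N; rewrite expr0 mulr1.
have nz1 k : P (U * q) k != 0 by have := nz k 1%N; rewrite expr1.
have nz2 k i : P (U * q * q ^+ i) k != 0 by rewrite -(mulrA U) -exprS.
have hq k : P q k != 0 by apply: poch_neq0 => i; rewrite -exprS; exact: thq.
have hU0 : th U != 0 by have := hA 0%N; rewrite expr0 mulr1.
have p3 : P (U * q * q ^+ (2 * m) * q ^+ n) n =
    P U (2 * m) * th (U * q ^+ (2 * m)) * P (U * q * q ^+ (2 * m)) (2 * n)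
    / (th U * P (U * q) (m + (m + n))).
  apply: (canRL (mulfK (mulf_neq0 hU0 (nz1 _)))).
  by rewrite -p2 -[RHS]mulrA -p1; ring.
by rewrite p3; field; rewrite !nz0 !nz1 !nz2 !hq hU0.
Qed.

End Weights.
End ClosedForms.

(** * The factors of the Jackson sum *)
Section Factors.
Variables (F : numClosedFieldType) (th : F -> F) (q : F).
Local Notation interaction := (interaction th q).
Local Notation P := (poch th q).
Hypothesis q0 : q != 0.
Hypothesis thV : forall z : F, z != 0 -> th z^-1 = - th z / z.
Hypothesis thq : forall m, th (q ^+ m.+1) != 0.

Variables (c gamma : F).
Hypotheses (c0 : c != 0) (gamma2 : gamma ^+ 2 = c * q).

Let gamma0 : gamma != 0.
Proof. by rewrite -sqrf_eq0 gamma2 mulf_neq0. Qed.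

(** Makes the theta functions and the powers of q opaque, so that the remaining
    identity is one of rational functions in independent variables. *)
Ltac generalize_factors :=
  repeat match goal with
  | |- context [poch ?t ?x ?u ?n] => generalize (poch t x u n)
  | |- context [th ?x] => generalize (th x)
  | |- context [q ^+ ?n] => generalize (q ^+ n)
  end.

(** The factors of the summand that mix two rows r < s, compared with the
    interactions of their strings, for j + m and j' + m' the entries of the
    summation index. *)
Lemma pair_factor (X Y : F) j j' L L' m m' : (m <= L)%N -> (m' <= L')%N ->
  X != 0 -> Y != 0 -> (forall i, th (c * X * Y * q ^+ i) != 0) ->
  (forall i : int, th (q ^ i * X / Y) != 0) ->
  (th (c * X * Y * q ^+ (j + m + (j' + m'))) / th (c * X * Y))
  * P (c * q * X * Y) (j + L + (j' + L'))
  / (P (c * q * X * Y) (j' + L' + (j + m)) * P (q ^ (1 + (j + m)%:Z - (j' + m')%:Z) * X / Y) (L - m)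
     * (P (c * q * X * Y) (j + L + (j' + m'))
        * P (q ^ (1 + (j' + m')%:Z - (j + m)%:Z) * Y / X) (L' - m')))
  * q ^+ ((j + m) * (j' + m'))
  * (P (c * X * Y) (j + m + j') * P (c * X * Y) (j' + m' + j))
  / (P (c * X * Y) (j + j')
     * (P (q ^ (1 + j%:Z - j'%:Z) * X / Y) m * P (q ^ (1 + j'%:Z - j%:Z) * Y / X) m')) =
  q ^+ (j * j') * (q ^+ (m * j') * q ^+ (m' * j)) *
  (\prod_(v <- invert_prefix m' (string q (gamma * Y * q ^+ j') L'))
     \prod_(w <- invert_prefix m (string q (gamma * X * q ^+ j) L)) interaction v w)
  / (P (q ^ (1 + j%:Z - j'%:Z) * X / Y) L * P (q ^ (1 + j'%:Z - j%:Z) * Y / X) L').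
Proof.
move=> mL mL' X0 Y0 hc hD; have qn k : q ^+ k != 0 by rewrite expf_neq0.
set A := gamma * X * q ^+ j; set B := gamma * Y * q ^+ j'.
have A0 : A != 0 by rewrite !mulf_neq0.
have B0 : B != 0 by rewrite !mulf_neq0.
have eAB : A * B = c * q * X * Y * q ^+ (j + j').
  rewrite -gamma2 exprD /A /B; ring.
have eU : A * B / q = c * X * Y * q ^+ (j + j').
  by rewrite eAB; field.
have qzE (i i' : nat) : q ^ (i%:Z - i'%:Z) = q ^+ i / q ^+ i'.
  by rewrite expfzDr // -invr_expz -!exprnP.
have eD (e : int) : q ^ e * (A / B) = q ^ (e + j%:Z - j'%:Z) * X / Y.
  by rewrite !expfzDr // -invr_expz -!exprnP /A /B; field; rewrite gamma0 Y0 qn.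
have eDV (e : int) : q ^ e * (B / A) = q ^ (e + j'%:Z - j%:Z) * Y / X.
  by rewrite !expfzDr // -invr_expz -!exprnP /A /B; field; rewrite gamma0 X0 qn.
rewrite (cross_prefix q0 thV mL mL' A0 B0); last 2 first.
- by move=> i; rewrite eU -mulrA -exprD hc.
- by move=> i; rewrite eD hD.
have eD1 : q * (A / B) = q ^ (1 + j%:Z - j'%:Z) * X / Y by rewrite -eD expr1z.
have eDV1 : q * (B / A) = q ^ (1 + j'%:Z - j%:Z) * Y / X by rewrite -eDV expr1z.
rewrite eU eAB eD1 eDV1 eD eDV.
have -> : (1 + m%:Z - m'%:Z) + j%:Z - j'%:Z = 1 + (j + m)%:Z - (j' + m')%:Z by lia.
have -> : (1 + m'%:Z - m%:Z) + j'%:Z - j%:Z = 1 + (j' + m')%:Z - (j + m)%:Z by lia.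
have nzD (e : int) k : P (q ^ e * X / Y) k != 0.
  apply: poch_neq0 => i.
  have -> : q ^ e * X / Y * q ^+ i = q ^ (e + i%:Z) * X / Y.
    by rewrite expfzDr // -exprnP; ring.
  exact: hD.
have nzDV (e : int) k : P (q ^ e * Y / X) k != 0.
  apply: poch_neq0 => i.
  have -> : q ^ e * Y / X * q ^+ i = (q ^ (- (e + i%:Z)) * X / Y)^-1.
    rewrite -invr_expz expfzDr // -exprnP.
    by field; rewrite X0 Y0 expfz_neq0 ?qn.
  by rewrite (thV_eq0 thV) ?hD // !mulf_neq0 ?invr_eq0 ?expfz_neq0.
have [V eV] : exists V, V = c * X * Y by exists (c * X * Y).
have eW : c * q * X * Y = V * q by rewrite eV; ring.
rewrite -eV eW in hc *.
have nzV k i : P (V * q ^+ i) k != 0 by apply: poch_neq0 => a; rewrite -mulrA -exprD hc.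
have nzV0 k : P V k != 0 by have := nzV k 0%N; rewrite expr0 mulr1.
have nzW k : P (V * q) k != 0 by have := nzV k 1%N; rewrite expr1.
have nzWq k i : P (V * q * q ^+ i) k != 0 by rewrite -(mulrA V) -exprS.
have thV0 : th V != 0 by have := hc 0%N; rewrite expr0 mulr1.
have splitW a b n : n = (j + j' + (a + b))%N ->
    P (V * q) n = P (V * q) (j + j') * P (V * q * q ^+ (j + j')) (a + b).
  by move=> ->; rewrite -pochD.
have splitV a n : n = (j + j' + a)%N ->
    P V n = P V (j + j') * P (V * q ^+ (j + j')) a.
  by move=> ->; rewrite -pochD.
rewrite (splitW L L' (j + L + (j' + L'))%N); last by lia.
rewrite (splitW m L' (j' + L' + (j + m))%N); last by lia.
rewrite (splitW L m' (j + L + (j' + m'))%N); last by lia.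
rewrite (splitV m (j + m + j')%N); last by lia.
rewrite (splitV m' (j' + m' + j)%N); last by lia.
have -> : V * q ^+ (j + m + (j' + m')) = V * q ^+ (j + j') * q ^+ (m + m').
  by rewrite -mulrA -exprD; congr (_ * q ^+ _); lia.
have p4 : P V (j + j') = th V * P (V * q) (j + j') / th (V * q ^+ (j + j')).
  by rewrite -pochS pochSr mulfK.
have -> : ((j + m) * (j' + m') = j * j' + (m * j' + m' * j) + m * m')%N by lia.
rewrite !(exprD q (_ + _)%N (m * m')) (exprD q (j * j')) (exprD q (m * j')) p4.
move: thV0 (hc (j + j')%N) (nzW (j + j')%N) (nzWq (m + L')%N (j + j')%N)
  (nzWq (L + m')%N (j + j')%N) (nzD (1 + (j + m)%:Z - (j' + m')%:Z) (L - m)%N)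
  (nzDV (1 + (j' + m')%:Z - (j + m)%:Z) (L' - m')%N)
  (nzD (1 + j%:Z - j'%:Z) m) (nzDV (1 + j'%:Z - j%:Z) m')
  (nzD (1 + j%:Z - j'%:Z) L) (nzDV (1 + j'%:Z - j%:Z) L').
generalize_factors.
by move=> *; field; do ?(apply/andP; split).
Qed.

(** The factors of the summand that belong to one row.  The numbers cJ and cK
    stand for the factorials of c X / a, whose index may be negative.  The power
    of q on the left comes from the pairs of rows, see [prod_pairs_pow]. *)
Lemma diag_factor (X a b rho1 rho2 : F) j L m J NN (cJ cK : F) : (m <= L)%N ->
  c = b * rho1 * rho2 / (a * q) ->
  X != 0 -> a != 0 -> b != 0 -> rho1 != 0 -> rho2 != 0 ->
  (forall i, th (c * X * X * q ^+ i) != 0) ->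
  (forall k, P (b * rho1 * X / a) k != 0) -> (forall k, P (b * rho2 * X / a) k != 0) ->
  (forall k, P (a * X * q) k != 0) ->
  cJ != 0 -> cK = cJ * P (c * X / a * q ^ (j%:Z - J%:Z)) m ->
  let t1 := gamma / rho1 in let t2 := gamma / rho2 in
  let t3 := gamma * a * q ^+ J / c in let t4 := gamma / (b * q ^+ NN) in
  P (b * rho1 * X / a) (j + L) * P (b * rho2 * X / a) (j + L)
  * (P (rho1 * X) (j + m) * P (rho2 * X) (j + m)
     * P (a * q ^ (1 + NN%:Z - (j + L)%:Z) / (rho1 * rho2 * X)) (L - m)
     / (P (b * rho1 * X / a) (j + m) * P (b * rho2 * X / a) (j + m)))
  * (th (c * X * X * q ^+ (2 * (j + m))) / th (c * X * X))
  * (P (b * X) (NN + (j + m)) / (P (c * q * X * X) (j + L + (j + m)) * P q (L - m)))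
  * (a * q / (rho1 * rho2)) ^+ (j + m) * X ^- (j + m)
  * (P (c * X * X) (j + m + j) / P q m * (cK / (cJ * P (a * X * q) (j + m + J))))
  * (q ^+ (m * J) / q ^+ (m * j)) =
  P (rho1 * X) j * P (rho2 * X) j * P (b * X) (NN + j) / (P q L * P (a * X * q) (j + L + J))
  * ((a * q / (rho1 * rho2)) ^+ j * X ^- j) / (- t4) ^+ L
  * signed_term th q (site_weight th t1 t2 t3 t4) (invert_prefix m (string q (gamma * X * q ^+ j) L)).
Proof.
move=> mL ec X0 a0 b0 r10 r20 hc nz1 nz2 nz3 cJ0 -> t1 t2 t3 t4.
have qn k : q ^+ k != 0 by rewrite expf_neq0.
set A := gamma * X * q ^+ j.
have A0 : A != 0 by rewrite !mulf_neq0.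
have t10 : t1 != 0 by rewrite mulf_neq0 ?invr_eq0.
have t20 : t2 != 0 by rewrite mulf_neq0 ?invr_eq0.
have t30 : t3 != 0 by rewrite !mulf_neq0 ?invr_eq0.
have t40 : t4 != 0 by rewrite mulf_neq0 ?invr_eq0 ?mulf_neq0.
have eA2 : A ^+ 2 = c * q * X * X * q ^+ (2 * j).
  by rewrite -gamma2 mul2n -addnn exprD /A; ring.
have eU : A ^+ 2 / q = c * X * X * q ^+ (2 * j) by rewrite eA2; field.
have qzE (i i' : nat) : q ^ (i%:Z - i'%:Z) = q ^+ i / q ^+ i'.
  by rewrite expfzDr // -invr_expz -!exprnP.
rewrite (signed_term_prefix q0 thV thq t10 t20 t30 t40 mL A0); last first.
  by move=> i; rewrite eU -mulrA -exprD hc.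
have gg : gamma * gamma = b * rho1 * rho2 / a by rewrite -expr2 gamma2 ec; field; rewrite a0 q0.
have e4 : q / (t4 * A * q ^+ L) = a * q ^ (1 + NN%:Z - (j + L)%:Z) / (rho1 * rho2 * X).
  rewrite -addrA expfzDr // qzE expr1z exprD.
  have -> : t4 * A * q ^+ L = gamma * gamma * X * q ^+ j * q ^+ L / (b * q ^+ NN).
    by rewrite /t4 /A; field; rewrite b0 qn.
  by rewrite gg; field; rewrite a0 b0 r10 r20 X0 !qn.
have e1 : t1 * A * q ^+ m = b * rho2 * X / a * q ^+ (j + m).
  rewrite exprD; transitivity (gamma * gamma / rho1 * X * q ^+ j * q ^+ m).
    by rewrite /t1 /A; ring.
  by rewrite gg; field; rewrite a0 r10.
have e2 : t2 * A * q ^+ m = b * rho1 * X / a * q ^+ (j + m).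
  rewrite exprD; transitivity (gamma * gamma / rho2 * X * q ^+ j * q ^+ m).
    by rewrite /t2 /A; ring.
  by rewrite gg; field; rewrite a0 r20.
have e3 : t3 * A * q ^+ m = a * X * q * q ^+ (j + m + J).
  rewrite !exprD; transitivity (gamma ^+ 2 / c * a * q ^+ J * X * q ^+ j * q ^+ m).
    by rewrite /t3 /A; ring.
  by rewrite gamma2; field.
have f1 : A / t1 = rho1 * X * q ^+ j by rewrite /t1 /A; field; rewrite r10 gamma0.
have f2 : A / t2 = rho2 * X * q ^+ j by rewrite /t2 /A; field; rewrite r20 gamma0.
have f3 : A / t3 = c * X / a * q ^ (j%:Z - J%:Z).
  by rewrite qzE /t3 /A; field; rewrite a0 c0 gamma0 qn.
have f4 : A / t4 = b * X * q ^+ (NN + j).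
  by rewrite exprD /t4 /A; field; rewrite b0 gamma0 qn.
rewrite e4 e1 e2 e3 f1 f2 f3 f4 eU eA2.
have [V eV] : exists V, V = c * X * X by exists (c * X * X).
have eW : c * q * X * X = V * q by rewrite eV; ring.
rewrite -eV eW in hc *.
have nzV k i : P (V * q ^+ i) k != 0 by apply: poch_neq0 => i'; rewrite -mulrA -exprD hc.
have nzV0 k : P V k != 0 by have := nzV k 0%N; rewrite expr0 mulr1.
have nzW k : P (V * q) k != 0 by have := nzV k 1%N; rewrite expr1.
have nzWq k i : P (V * q * q ^+ i) k != 0 by rewrite -(mulrA V) -exprS.
have nzq k : P q k != 0 by apply: poch_neq0 => i; rewrite -exprS; exact: thq.
have thV0 : th V != 0 by have := hc 0%N; rewrite expr0 mulr1.
have sp u i n : P u (i + n) = P u i * P (u * q ^+ i) n by exact: pochD.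
have jL : (j + L = j + m + (L - m))%N by rewrite -addnA subnKC.
have s1 u : P u (j + L) = P u (j + m) * P (u * q ^+ (j + m)) (L - m).
  by rewrite {1}jL pochD.
have s3 : P (a * X * q) (j + L + J) = P (a * X * q) (j + m + J) *
    P (a * X * q * q ^+ (j + m + J)) (L - m).
  by rewrite -pochD jL addnAC.
have s5 : P (b * X) (NN + (j + m)) = P (b * X) (NN + j) * P (b * X * q ^+ (NN + j)) m.
  by rewrite -pochD addnA.
have s6 : P V (j + m + j) = P V (2 * j) * P (V * q ^+ (2 * j)) m.
  by rewrite -pochD mul2n -addnn addnAC.
have s7 : P (V * q) (j + L + (j + m)) = P (V * q) (2 * j) * P (V * q * q ^+ (2 * j)) (m + L).
  by rewrite -pochD mul2n -addnn addnACA (addnC L).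
have s8 : V * q ^+ (2 * (j + m)) = V * q ^+ (2 * j) * q ^+ (2 * m).
  by rewrite -mulrA -exprD -mulnDr.
have p4 : P V (2 * j) = th V * P (V * q) (2 * j) / th (V * q ^+ (2 * j)).
  by rewrite -pochS pochSr mulfK.
have u1 : P (b * rho1 * X / a) (j + m) != 0 by [].
have u2 : P (b * rho2 * X / a) (j + m) != 0 by [].
have u3 : P (a * X * q) (j + m + J) != 0 by [].
have u4 : P (a * X * q * q ^+ (j + m + J)) (L - m) != 0.
  by have := nz3 (j + L + J)%N; rewrite s3 mulf_eq0 negb_or => /andP[].
rewrite (s1 (b * rho1 * X / a)) (s1 (b * rho2 * X / a)) s3 s5 s6 s7 s8 p4.
rewrite (sp (rho1 * X)) (sp (rho2 * X)).
have monomials : (a * q / (rho1 * rho2)) ^+ (j + m) * X ^- (j + m) * (q ^+ (m * J) / q ^+ (m * j)) =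
    (a * q / (rho1 * rho2)) ^+ j * X ^- j / (- t4) ^+ L *
    ((- t4) ^+ (L - m) * (- (t1 * t2 * t3 * t4) / A) ^+ m).
  have e5 : - (t1 * t2 * t3 * t4) / A = - t4 * (a * q / (rho1 * rho2) / X * (q ^+ J / q ^+ j)).
    transitivity (- t4 * (gamma ^+ 2 / c * a * q ^+ J / (rho1 * rho2 * X * q ^+ j))).
      by rewrite /t1 /t2 /t3 /A; field; rewrite r10 r20 c0 gamma0 X0 qn.
    by rewrite gamma2; field; rewrite r10 r20 c0 X0 qn.
  rewrite e5; move: (a * q / (rho1 * rho2)) => S.
  have -> : (- t4) ^+ L = (- t4) ^+ (L - m) * (- t4) ^+ m by rewrite -exprD subnK.
  have : - t4 != 0 by rewrite oppr_eq0.
  move: (- t4) => T T0; have t4n k : T ^+ k != 0 by rewrite expf_neq0.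
  rewrite !exprMn !exprVn -!exprM !(exprD _ j m) (mulnC J) (mulnC j).
  have Xn k : X ^+ k != 0 by rewrite expf_neq0.
  by field; rewrite !t4n !Xn !qn.
move: monomials; set M1 := (a * q / _) ^+ _; set M2 := X ^- _.
set M3 := (a * q / _) ^+ _; set M4 := X ^- _.
move=> monomials.
transitivity ((M1 * M2 * (q ^+ (m * J) / q ^+ (m * j))) *
  (P (rho1 * X) j * P (rho1 * X * q ^+ j) m * (P (rho2 * X) j * P (rho2 * X * q ^+ j) m)
   * P (b * rho1 * X / a * q ^+ (j + m)) (L - m) * P (b * rho2 * X / a * q ^+ (j + m)) (L - m)
   * P (a * q ^ (1 + NN%:Z - (j + L)%:Z) / (rho1 * rho2 * X)) (L - m)
   * (th (V * q ^+ (2 * j) * q ^+ (2 * m)) / th (V * q ^+ (2 * j)))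
   * (P (b * X) (NN + j) * P (b * X * q ^+ (NN + j)) m)
   * P (V * q ^+ (2 * j)) m / P (V * q * q ^+ (2 * j)) (m + L)
   / (P q (L - m) * P q m) * P (c * X / a * q ^ (j%:Z - J%:Z)) m
   / P (a * X * q) (j + m + J))).
  move: thV0 (hc (2 * j)%N) (nzW (2 * j)%N) (nzWq (m + L)%N (2 * j)%N)
    (nzq (L - m)%N) (nzq m) u1 u2 u3 cJ0 (qn (m * j)%N) (qn (m * J)%N).
  by clear; generalize_factors; move=> *; field; do ?(apply/andP; split).
have t4L : (- t4) ^+ L != 0 by rewrite expf_neq0 // oppr_eq0.
rewrite monomials; move: t4L; move: ((- t4) ^+ L) ((- t4) ^+ (L - m)) ((_ / A) ^+ m) => w1 w2 w3 w10.
move: (hc (2 * j)%N) (nzWq (m + L)%N (2 * j)%N) (nzq (L - m)%N) (nzq m) (nzq L) u3 u4.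
generalize_factors; move=> *; field; do ?(apply/andP; split); rewrite ?w10 //.
Qed.

End Factors.

(** * Limits of complex sequences *)
Section ComplexLimits.
Variable R : realType.
Local Notation C := R[i].
Implicit Types (u v : nat -> C) (l : C).

Lemma normc_ge0 (x : C) : 0 <= normc x.
Proof. by case: x => a b; rewrite /normc sqrtr_ge0. Qed.

Lemma normc_eq0 (x : C) : (normc x == 0) = (x == 0).
Proof.
by apply/eqP/eqP => [/eq0_normc//|->]; rewrite (normc0 R).
Qed.

Lemma normc_gt0 (x : C) : (0 < normc x) = (x != 0).
Proof. by rewrite lt_neqAle normc_ge0 andbT eq_sym normc_eq0. Qed.

Lemma normcX (x : C) n : normc (x ^+ n) = normc x ^+ n.
Proof. by elim: n => [|n IH]; rewrite ?expr0 ?normc1 // !exprS normcM IH. Qed.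

Lemma normcXz (x : C) (n : int) : normc (x ^ n) = normc x ^ n.
Proof. by case: n => n; rewrite ?NegzE -?invr_expz -?exprnP ?normcV normcX. Qed.

Lemma normc_add (x y : C) : normc (x + y) <= normc x + normc y.
Proof. exact: le_normcD. Qed.

Lemma normc_opp (x : C) : normc (- x) = normc x.
Proof. exact: complex.normcN. Qed.

Lemma normc_sum (I : Type) (s : seq I) (F : I -> C) :
  normc (\sum_(i <- s) F i) <= \sum_(i <- s) normc (F i).
Proof.
elim: s => [|i s IH]; first by rewrite !big_nil (normc0 R).
by rewrite !big_cons; apply: le_trans (normc_add _ _) _; rewrite lerD2l.
Qed.

Lemma normc_distC (x y : C) : normc (x - y) = normc (y - x).
Proof. by rewrite -normc_opp opprB. Qed.

(** Convergence measured by the real modulus, so that the order and the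
    completeness of R apply. *)
Definition clim u l : Prop := forall eps : R, 0 < eps ->
  exists N, forall n, (N <= n)%N -> normc (u n - l) < eps.

Lemma clim_cst l : clim (fun=> l) l.
Proof. by move=> eps e0; exists 0%N => n _; rewrite subrr (normc0 R). Qed.

Lemma clim_ext u v l N : (forall n, (N <= n)%N -> u n = v n) -> clim u l -> clim v l.
Proof.
move=> uv hu eps /hu [M hM]; exists (maxn N M) => n; rewrite geq_max => /andP[Nn Mn].
by rewrite -uv // hM.
Qed.

Lemma clim_unique u l l' : clim u l -> clim u l' -> l = l'.
Proof.
move=> h h'; apply/eqP; rewrite -subr_eq0 -normc_eq0; apply/eqP/le_anti.
rewrite normc_ge0 andbT; apply/ler_addgt0Pr => eps e0; rewrite add0r.
have e2 : 0 < eps / 2 by rewrite divr_gt0.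
have [N hN] := h _ e2; have [M hM] := h' _ e2.
have := hN (maxn N M) (leq_maxl _ _); have := hM (maxn N M) (leq_maxr _ _).
move: (u _) => t a b; have -> : l - l' = (l - t) + (t - l') by ring.
apply: le_trans (normc_add _ _) _; rewrite (normc_distC l t); lra.
Qed.

Lemma climD u v l l' : clim u l -> clim v l' -> clim (fun n => u n + v n) (l + l').
Proof.
move=> h h' eps e0; have e2 : 0 < eps / 2 by rewrite divr_gt0.
have [N hN] := h _ e2; have [M hM] := h' _ e2.
exists (maxn N M) => n; rewrite geq_max => /andP[/hN a /hM b].
have -> : u n + v n - (l + l') = (u n - l) + (v n - l') by ring.
apply: le_lt_trans (normc_add _ _) _; lra.
Qed.

Lemma clim_bounded u l : clim u l -> exists2 B : R, 0 < B & forall n, normc (u n) <= B.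
Proof.
move=> /(_ 1 ltr01) [N hN].
exists (normc l + 1 + \sum_(i < N) normc (u i)).
  by rewrite ltr_wpDr ?sumr_ge0 ?ltr_wpDl ?normc_ge0 // => *; exact: normc_ge0.
move=> n; have [Nn|nN] := leqP N n.
  rewrite -[normc (u n)]addr0 lerD ?sumr_ge0 // => [|*]; last exact: normc_ge0.
  rewrite -[u n](subrK l) addrC; apply: le_trans (normc_add _ _) _.
  by rewrite lerD2l ltW ?hN.
rewrite (bigD1 (Ordinal nN)) //= addrCA lerDl.
by rewrite !addr_ge0 ?normc_ge0 ?sumr_ge0 // => *; exact: normc_ge0.
Qed.

Lemma clim0_bounded u v (B : R) : clim u 0 -> (forall n, normc (v n) <= B) ->
  clim (fun n => u n * v n) 0.
Proof.
move=> hu hv eps e0.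
have B0 : 0 <= B by apply: le_trans (hv 0%N); exact: normc_ge0.
have B1 : 0 < B + 1 by rewrite ltr_wpDl.
have [N hN] := hu _ (divr_gt0 e0 B1); exists N => n /hN; rewrite !subr0 normcM => h.
apply: (@le_lt_trans _ _ (normc (u n) * (B + 1))).
  by rewrite ler_wpM2l ?normc_ge0 // (le_trans (hv n)) // lerDl.
by rewrite -ltr_pdivlMr.
Qed.

Lemma clim_sub0 u l : clim u l <-> clim (fun n => u n - l) 0.
Proof. by split=> h eps /h [N hN]; exists N => n /hN; rewrite subr0. Qed.

Lemma climM u v l l' : clim u l -> clim v l' -> clim (fun n => u n * v n) (l * l').
Proof.
move=> hu hv; apply/clim_sub0.
have [B _ hB] := clim_bounded hv.
have h1 := clim0_bounded ((clim_sub0 _ _).1 hu) hB.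
have h2 := clim0_bounded ((clim_sub0 _ _).1 hv) (fun n => lexx (normc l)).
have := climD h1 h2; rewrite addr0; apply: (@clim_ext _ _ _ 0) => n _; ring.
Qed.

Lemma climN u l : clim u l -> clim (fun n => - u n) (- l).
Proof.
move=> h; have := climM (clim_cst (-1)) h; rewrite mulN1r.
by apply: (@clim_ext _ _ _ 0) => n _; rewrite mulN1r.
Qed.

Lemma climB u v l l' : clim u l -> clim v l' -> clim (fun n => u n - v n) (l - l').
Proof. by move=> h /climN h'; exact: climD h h'. Qed.

Lemma clim_comp u l (f : nat -> nat) :
  (forall M, exists N, forall n, (N <= n)%N -> (M <= f n)%N) ->
  clim u l -> clim (fun n => u (f n)) l.
Proof.
move=> hf h eps /h [M hM]; have [N hN] := hf M.
by exists N => n /hN /hM.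
Qed.

Lemma climV u l : l != 0 -> clim u l -> clim (fun n => (u n)^-1) l^-1.
Proof.
move=> l0 h; have l2 : 0 < normc l / 2 by rewrite divr_gt0 ?normc_gt0.
have [N hN] := h _ l2.
have low n : (N <= n)%N -> normc l / 2 <= normc (u n).
  move=> /hN; have := normc_add (u n) (l - u n); rewrite addrC subrK (normc_distC l); lra.
have un0 n : (N <= n)%N -> u n != 0.
  by move=> /low hn; rewrite -normc_gt0 (lt_le_trans l2).
pose v n := if (N <= n)%N then (u n * l)^-1 else 0.
have bv n : normc (v n) <= (normc l / 2 * normc l)^-1.
  rewrite /v; case: ifP => [Nn|_]; last first.
    by rewrite (normc0 R) invr_ge0 mulr_ge0 ?normc_ge0 // ltW.
  rewrite normcV normcM lef_pV2 ?posrE ?mulr_gt0 ?normc_gt0 ?un0 //.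
  by rewrite ler_wpM2r ?normc_ge0 ?low.
have := climN ((clim_sub0 _ _).1 h); rewrite oppr0 => /clim0_bounded /(_ bv) h0.
apply/clim_sub0; move: h0; apply: (@clim_ext _ _ _ N) => n Nn; rewrite /v Nn.
by field; rewrite l0 un0.
Qed.

Lemma clim_lim u l : clim u l -> lim ((u : nat -> C^o) @ \oo)%classic = l.
Proof.
move=> h; apply: cvg_lim => //; apply/cvgrPdist_lt => eps e0.
have eE : eps = (complex.Re eps)%:C by rewrite RRe_real // ger0_real // ltW.
have [|N hN] := h (complex.Re eps); first by move: e0; rewrite eE ltcR.
exists N => // n /= Nn; rewrite eE [X in X < _](_ : _ = (normc (l - u n))%:C) //.
by rewrite ltcR normc_distC hN.
Qed.

(** Completeness, for sequences whose increments decay geometrically; the real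
    and imaginary parts are absolutely convergent telescoping series. *)
Lemma clim_geometric u (K r : R) : 0 <= r -> r < 1 ->
  (forall n, normc (u n.+1 - u n) <= K * r ^+ n) -> exists l, clim u l.
Proof.
move=> r0 r1 hK.
have real_lim (f : C -> R) : (forall x y, f (x - y) = f x - f y) ->
    (forall x, `|f x| <= normc x) -> cvgn (f \o u).
  move=> fB fn.
  have : cvgn (series (fun n => f (u n.+1) - f (u n))).
    apply: normed_cvg.
    apply: (@series_le_cvg _ _ (geometric K r)) => [n|n|n|].
    - exact: normr_ge0.
    - by apply: le_trans (hK n); exact: normc_ge0.
    - by rewrite /= -fB; apply: le_trans (fn _) _; exact: hK.
    by apply: is_cvg_geometric_series; rewrite ger0_norm.
  move=> h; have -> : f \o u = fun n => series (fun n => f (u n.+1) - f (u n)) n + f (u 0%N).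
    apply/funext => n; rewrite /series /= telescope_sumr //; by rewrite subrK.
  by apply: is_cvgD => //; exact: is_cvg_cst.
have cRe : cvgn (@complex.Re R \o u).
  apply: real_lim => [[a b] [c d]//|[a b]] /=.
  by rewrite -sqrtr_sqr ler_sqrt ?lerDl ?sqr_ge0 // addr_ge0 ?sqr_ge0.
have cIm : cvgn (@complex.Im R \o u).
  apply: real_lim => [[a b] [c d]//|[a b]] /=.
  by rewrite -sqrtr_sqr ler_sqrt ?lerDr ?sqr_ge0 // addr_ge0 ?sqr_ge0.
exists (limn (@complex.Re R \o u) +i* limn (@complex.Im R \o u)) => eps e0.
have e2 : 0 < eps / 2 by rewrite divr_gt0.
have [N _ hN] := (cvgrPdist_lt _ _).1 cRe _ e2.
have [M _ hM] := (cvgrPdist_lt _ _).1 cIm _ e2.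
exists (maxn N M) => n; rewrite geq_max => /andP[/hN /= a /hM /= b].
case: (u n) a b => x y /= a b.
apply: (@le_lt_trans _ _ (`|x - limn (@complex.Re R \o u)| + `|y - limn (@complex.Im R \o u)|)).
  rewrite -(ler_sqr (sqrtr_ge0 _)) ?nnegrE ?addr_ge0 // ?sqrtr_ge0 //.
  rewrite sqr_sqrtr ?addr_ge0 ?sqr_ge0 // [X in _ <= X]sqrrD !real_normK ?num_real //.
  by rewrite lerD2r lerDl mulrn_wge0 ?mulr_ge0.
by move: a b; rewrite distrC [X in _ -> X < _ -> _]distrC; lra.
Qed.

End ComplexLimits.

(** * Infinite products and the theta function *)
Section Products.
Variable R : realType.
Local Notation C := R[i].
Variables (r : R).
Hypotheses (r0 : 0 <= r) (r1 : r < 1).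

Lemma geometric_sum_le m : \sum_(j < m) r ^+ j <= (1 - r)^-1.
Proof.
have h : 0 < 1 - r by rewrite subr_gt0.
rewrite -[leRHS]mul1r ler_pdivlMr // mulrC -(opprB r 1) mulNr -subrX1 opprB.
by rewrite lerBlDr lerDl exprn_ge0.
Qed.

Lemma real_prod_bounded (c : R) : 0 <= c ->
  forall m, \prod_(j < m) (1 + c * r ^+ j) <= expR (c / (1 - r)).
Proof.
move=> c0 m; apply: (@le_trans _ _ (expR (\sum_(j < m) c * r ^+ j))).
  rewrite expR_sum; apply: ler_prod => j _.
  by rewrite expR_ge1Dx andbT addr_ge0 // mulr_ge0 ?exprn_ge0.
by rewrite ler_expR -mulr_sumr ler_wpM2l // geometric_sum_le.
Qed.

Lemma clim_geom0 (a : nat -> C) (c : R) : (forall j, normc (a j) <= c * r ^+ j) -> clim a 0.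
Proof.
move=> ha eps e0.
have c0 : 0 <= c by have := ha 0%N; rewrite expr0 mulr1; apply: le_trans; exact: normc_ge0.
have c1 : 0 < c + 1 by rewrite ltr_wpDl.
have h : `|r| < 1 by rewrite ger0_norm.
have [N _ hN] := (cvgrPdist_lt _ _).1 (cvg_expr h) _ (divr_gt0 e0 c1).
exists N => n /hN /=; rewrite sub0r normrN ger0_norm ?exprn_ge0 // => hn.
rewrite subr0; apply: le_lt_trans (ha n) _.
apply: (@le_lt_trans _ _ ((c + 1) * r ^+ n)).
  by rewrite ler_wpM2r ?exprn_ge0 // lerDl.
by rewrite mulrC -ltr_pdivlMr.
Qed.

Variables (a : nat -> C) (c : R).
Hypothesis ha : forall j, normc (a j) <= c * r ^+ j.

Let c0 : 0 <= c.
Proof. by have := ha 0%N; rewrite expr0 mulr1; apply: le_trans; exact: normc_ge0. Qed.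

Lemma prod_bounded m : normc (\prod_(j < m) (1 + a j)) <= expR (c / (1 - r)).
Proof.
apply: le_trans (real_prod_bounded c0 m).
elim: m => [|m IH]; first by rewrite !big_ord0 normc1.
rewrite !big_ord_recr normcM /= ler_pM ?normc_ge0 //.
by apply: le_trans (normc_add _ _) _; rewrite normc1 lerD2l.
Qed.

Lemma prod_cvg : exists l, clim (fun m => \prod_(j < m) (1 + a j)) l.
Proof.
apply: (@clim_geometric _ _ (expR (c / (1 - r)) * c) r) => // m.
rewrite big_ord_recr /=; set t := \prod_(j < m) _.
have -> : t * (1 + a m) - t = t * a m by ring.
by rewrite normcM -mulrA ler_pM ?normc_ge0 // prod_bounded.
Qed.

End Products.

(** The inverses of the factors again satisfy a geometric bound, so the inverse
    products converge as well. *)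
Lemma prod_neq0 (R : realType) (r : R) (a : nat -> R[i]) (c : R) l : 0 <= r -> r < 1 ->
  (forall j, normc (a j) <= c * r ^+ j) -> (forall j, 1 + a j != 0) ->
  clim (fun m => \prod_(j < m) (1 + a j)) l -> l != 0.
Proof.
move=> r0 r1 ha na hl.
have inv1 : clim (fun j => (1 + a j)^-1) 1.
  have := climD (clim_cst 1) (clim_geom0 r0 r1 ha); rewrite addr0 => /climV.
  by rewrite invr1; apply; exact: oner_neq0.
have [B B0 hB] := clim_bounded inv1.
pose b j := - a j / (1 + a j).
have hb j : normc (b j) <= (c * B) * r ^+ j.
  rewrite /b normcM normc_opp mulrAC ler_pM ?normc_ge0 //; exact: hB.
have eb j : 1 + b j = (1 + a j)^-1 by rewrite /b; field.
have [l' hl'] := prod_cvg r0 r1 hb.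
have h := climM hl hl'.
have one : clim (fun m => (\prod_(j < m) (1 + a j)) * (\prod_(j < m) (1 + b j))) 1.
  apply: (@clim_ext _ (fun=> 1) _ _ 0) => [m _|]; last exact: clim_cst.
  by rewrite -big_split big1 //= => j _; rewrite eb divff.
have e := clim_unique h one.
by apply/eqP => l0; move: e; rewrite l0 mul0r => /esym/eqP; rewrite oner_eq0.
Qed.

Section Theta.
Variable R : realType.
Local Notation C := R[i].
Variable p : C.
Hypothesis p1 : normc p < 1.

Definition theta_prod (a : C) (m : nat) : C :=
  \prod_(j < m) ((1 - a * p ^+ j) * (1 - p ^+ j.+1 / a)).

Lemma theta_prodE a m : theta_prod a m =
  \prod_(j < m) (1 + - a * p ^+ j) * \prod_(j < m) (1 + - (p / a) * p ^+ j).
Proof.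
rewrite /theta_prod -big_split; apply: eq_bigr => j _ /=.
by rewrite exprS; congr (_ * _); ring.
Qed.

Lemma geom_le (x : C) j : normc (x * p ^+ j) <= normc x * normc p ^+ j.
Proof. by rewrite normcM normcX. Qed.

Lemma theta_cvg a : clim (theta_prod a) (theta a p).
Proof.
have [l1 h1] := prod_cvg (normc_ge0 p) p1 (geom_le (- a)).
have [l2 h2] := prod_cvg (normc_ge0 p) p1 (geom_le (- (p / a))).
have h : clim (theta_prod a) (l1 * l2).
  by apply: (@clim_ext _ _ _ _ 0) (climM h1 h2) => m _; rewrite theta_prodE.
suff -> : theta a p = l1 * l2 by [].
rewrite /theta (_ : (fun m : nat => _) = theta_prod a); first exact: clim_lim.
by apply/funext => m; rewrite big_mkord.
Qed.

Lemma clim_pX : clim (fun m => p ^+ m) 0.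
Proof.
apply: (@clim_geom0 _ (normc p) (normc_ge0 p) p1 _ 1) => j.
by rewrite normcX mul1r.
Qed.

Lemma theta1 : theta 1 p = 0.
Proof.
apply: (clim_unique (theta_cvg 1)); apply: (@clim_ext _ (fun=> 0) _ _ 1) => [[//|m] _|].
  by rewrite /theta_prod big_ord_recl expr0 mulr1 subrr !mul0r.
exact: clim_cst.
Qed.

Lemma prod_shift (u : nat -> C) m :
  u 0%N * \prod_(j < m) u j.+1 = (\prod_(j < m) u j) * u m.
Proof.
elim: m => [|m IH]; first by rewrite !big_ord0 mulr1 mul1r.
by rewrite !big_ord_recr /= mulrA IH.
Qed.

(** The partial products at a and 1/a differ only in their first and last
    factors. *)
Lemma thetaV a : a != 0 -> theta a^-1 p = - theta a p / a.
Proof.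
move=> a0; have [->|a1] := eqVneq a 1; first by rewrite invr1 theta1 oppr0 mul0r.
have b1 : 1 - a != 0 by rewrite subr_eq0 eq_sym.
have cx (x : C) : clim (fun m => 1 - x * p ^+ m) 1.
  have := climB (clim_cst 1) (climM (clim_cst x) clim_pX).
  by rewrite mulr0 subr0.
have h1 := climM (climM (theta_cvg a^-1) (cx a^-1)) (clim_cst (1 - a)).
have h2 := climM (climM (theta_cvg a) (cx a)) (clim_cst (1 - a^-1)).
have : theta a^-1 p * 1 * (1 - a) = theta a p * 1 * (1 - a^-1).
  apply: (clim_unique h1); apply: (@clim_ext _ _ _ _ 0) h2 => m _.
  rewrite /theta_prod !big_split /=.
  have e1 := @prod_shift (fun j => 1 - a * p ^+ j) m.
  have e2 := @prod_shift (fun j => 1 - a^-1 * p ^+ j) m.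
  rewrite /= expr0 !mulr1 in e1 e2.
  have -> : \prod_(j < m) (1 - p ^+ j.+1 / a) = \prod_(j < m) (1 - a^-1 * p ^+ j.+1).
    by apply: eq_bigr => j _; rewrite mulrC.
  have -> : \prod_(j < m) (1 - p ^+ j.+1 / a^-1) = \prod_(j < m) (1 - a * p ^+ j.+1).
    by apply: eq_bigr => j _; rewrite invrK mulrC.
  rewrite -!mulrA [X in _ * X]mulrCA (mulrA (\prod_(i < m) _) (1 - a * _)) -e1.
  by rewrite (mulrC _ (1 - a^-1)) e2; ring.
rewrite !mulr1 => e; apply: (mulIf b1); rewrite e; field; exact: a0.
Qed.

(** This says that a is an integer power of p; the conditions on p^i and p^j
    reduce it to a = 1 when p = 0. *)
Definition theta_zero (a : C) : Prop :=
  exists i j, [/\ a * p ^+ i = p ^+ j, p ^+ i != 0 & p ^+ j != 0].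

Lemma theta_eq0P a : a != 0 -> theta a p = 0 <-> theta_zero a.
Proof.
move=> a0; split; last first.
  case=> i [j [e pi pj]].
  suff [k hk] : exists k, (1 - a * p ^+ k) * (1 - p ^+ k.+1 / a) = 0.
    apply: (clim_unique (theta_cvg a)).
    apply: (@clim_ext _ (fun=> 0) _ _ k.+1) => [m km|]; last exact: clim_cst.
    by rewrite /theta_prod (bigD1 (Ordinal km)) //= hk mul0r.
  have [ij|ji] := leqP j i.
    exists (i - j)%N; have -> : a * p ^+ (i - j) = 1; last by rewrite subrr mul0r.
    by apply: (mulIf pj); rewrite mul1r -mulrA -exprD subnK.
  exists (j - i.+1)%N; have -> : p ^+ (j - i.+1).+1 = a; last by rewrite divff // subrr mulr0.
  by apply: (mulIf pi); rewrite e -exprD -subSn // subSS subnK // ltnW.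
move=> th0; apply: contrapT => nz.
have [l1 h1] := prod_cvg (normc_ge0 p) p1 (geom_le (- a)).
have [l2 h2] := prod_cvg (normc_ge0 p) p1 (geom_le (- (p / a))).
have h := climM h1 h2.
have e : l1 * l2 = 0.
  rewrite -th0; apply: (clim_unique h).
  by apply: (@clim_ext _ _ _ _ 0) (theta_cvg a) => m _; rewrite theta_prodE.
have l10 : l1 != 0.
  apply: (prod_neq0 (normc_ge0 p) p1 (geom_le (- a)) _ h1) => j.
  rewrite mulNr subr_eq0; apply/eqP => e1; apply: nz; exists j, 0%N; split=> //.
    by apply: contra_eq_neq e1 => ->; rewrite mulr0 oner_neq0.
  exact: oner_neq0.
have l20 : l2 != 0.
  apply: (prod_neq0 (normc_ge0 p) p1 (geom_le (- (p / a))) _ h2) => j.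
  rewrite mulNr subr_eq0; apply/eqP => e1.
  have e2 : p ^+ j.+1 = a by rewrite exprS -[RHS]mul1r e1; field.
  apply: nz; exists 0%N, j.+1; split; rewrite ?e2 ?mulr1 //; exact: oner_neq0.
by move/eqP: e; rewrite mulf_eq0 (negPf l10) (negPf l20).
Qed.

Lemma theta_eq0_div a b : a != 0 -> b != 0 -> theta a p = 0 -> theta b p = 0 ->
  theta (a / b) p = 0.
Proof.
move=> a0 b0 /(theta_eq0P a0) [i [j [e1 pi pj]]] /(theta_eq0P b0) [k [l [e2 pk pl]]].
apply/theta_eq0P; first by rewrite mulf_neq0 ?invr_eq0.
exists (i + l)%N, (j + k)%N; rewrite !exprD !mulf_neq0 //; split=> //.
by rewrite -e1 -e2; field.
Qed.

End Theta.

(** The integer k (k - 1) / 2, see [triangularE]. *)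
Definition triangular (k : int) : nat :=
  match k with Posz n => 'C(n, 2) | Negz n => 'C(n.+2, 2) end.

Lemma triangularE k : (triangular k)%:Z *+ 2 = k * (k - 1).
Proof.
have b n : ('C(n, 2) * 2 = n * n.-1)%N by rewrite mulnC -mul_bin_diag bin1.
case: k => n; rewrite /= -mulr_natr natz -PoszM b; first by case: n => //= n; lia.
by rewrite NegzE /=; lia.
Qed.

Definition sym_range (m : nat) : seq int := [seq i%:Z - m%:Z | i <- iota 0 (2 * m).+1].

Arguments sym_range : simpl never.

Lemma sym_range_uniq m : uniq (sym_range m).
Proof. by rewrite map_inj_uniq ?iota_uniq // => i j /addIr; case. Qed.

Lemma mem_sym_range m k : (k \in sym_range m) = (- m%:Z <= k <= m%:Z).
Proof.
apply/mapP/idP => [[n]|h].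
  by rewrite mem_iota => hn ->; lia.
by exists (absz (k + m%:Z)); [rewrite mem_iota; lia|lia].
Qed.

Lemma mem_sym_range_pair k l m : (absz k + absz l <= m)%N ->
  k \in sym_range m /\ l \in sym_range m.
Proof. by rewrite !mem_sym_range; lia. Qed.

Section TripleProduct.
Variables (F : fieldType) (p : F).
Hypothesis np : forall j, 1 - p ^+ j.+1 != 0.

Definition euler_product (m : nat) : F := \prod_(j < m) (1 - p ^+ j.+1).

Definition gauss_binomial (N i : nat) : F := euler_product N / (euler_product i * euler_product (N - i)).

Lemma euler_neq0 m : euler_product m != 0.
Proof. by apply/prodf_neq0 => j _. Qed.

Lemma eulerS m : euler_product m.+1 = euler_product m * (1 - p ^+ m.+1).
Proof. by rewrite /euler_product big_ord_recr. Qed.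

Lemma gauss_binomial_pascal N i : (i < N)%N ->
  gauss_binomial N.+1 i.+1 = gauss_binomial N i.+1 + p ^+ (N - i) * gauss_binomial N i.
Proof.
move=> iN; rewrite /gauss_binomial subSS -(subnSK iN) !eulerS.
have -> : (N.+1 = (N - i.+1).+1 + i.+1)%N by lia.
rewrite exprD.
have e0 := euler_neq0 i; have e1 := euler_neq0 (N - i.+1); have e2 := euler_neq0 N.
have := np i; have := np (N - i.+1); move: (_ ^+ _) (_ ^+ _) => s t h1 h2.
by field; rewrite e0 e1 h1 h2.
Qed.

Lemma gauss_binomial0 N : gauss_binomial N 0 = 1.
Proof. by rewrite /gauss_binomial subn0 {2}/euler_product big_ord0 mul1r divff ?euler_neq0. Qed.

Lemma gauss_binomialnn N : gauss_binomial N N = 1.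
Proof. by rewrite /gauss_binomial subnn {3}/euler_product big_ord0 mulr1 divff ?euler_neq0. Qed.

Lemma gauss_binomial_theorem N y : \prod_(j < N) (1 + y * p ^+ j) =
  \sum_(i < N.+1) p ^+ 'C(i, 2) * gauss_binomial N i * y ^+ i.
Proof.
elim: N => [|N IH].
  by rewrite big_ord0 big_ord_recl big_ord0 gauss_binomial0 !expr0 !mulr1 addr0.
rewrite big_ord_recr /= IH mulrDr mulr1 mulr_suml.
rewrite [RHS]big_ord_recr [RHS]/= big_ord_recl [X in _ = X + _]big_ord_recl.
rewrite !gauss_binomial0 -!addrA; congr (_ + _).
rewrite [X in _ + X = _]big_ord_recr /= addrA -big_split; congr (_ + _).
  apply: eq_bigr => i _ /=; rewrite /bump leq0n add1n gauss_binomial_pascal //.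
  rewrite binS bin1 addnC exprD exprS -[in p ^+ N](subnKC (ltnW (ltn_ord i))) exprD; ring.
by rewrite !gauss_binomialnn binS bin1 exprD exprS; ring.
Qed.

Hypothesis p0 : p != 0.

(** The q-binomial theorem for 2 m factors, shifted to be symmetric about m. *)
Lemma finite_triple_product z m : z != 0 ->
  \prod_(j < m) ((1 - z * p ^+ j) * (1 - p ^+ j.+1 / z)) =
  \sum_(k <- sym_range m)
     (- z) ^ k * p ^+ triangular k * gauss_binomial (2 * m) (absz (k + m%:Z)).
Proof.
move=> z0; have nz0 : - z != 0 by rewrite oppr_eq0.
have pn n : p ^+ n != 0 by rewrite expf_neq0.
have := gauss_binomial_theorem (2 * m) (- z / p ^+ m).
have -> : \prod_(j < 2 * m) (1 + - z / p ^+ m * p ^+ j) =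
    (- z) ^+ m / p ^+ 'C(m.+1, 2) *
    \prod_(j < m) ((1 - z * p ^+ j) * (1 - p ^+ j.+1 / z)).
  rewrite mul2n -addnn big_split_ord /= big_split /= [RHS]mulrCA mulrC.
  congr (_ * _).
    by apply: eq_bigr => i _; rewrite exprD; field.
  have -> : (- z) ^+ m / p ^+ 'C(m.+1, 2) = \prod_(j < m) (- z / p ^+ j.+1).
    elim: m => [|m IH]; first by rewrite big_ord0 expr0 mul1r invr1.
    by rewrite big_ord_recr /= -IH binS bin1 exprD (exprS (- z)); field; rewrite !pn.
  rewrite -big_split (reindex_inj rev_ord_inj); apply: eq_bigr => i _ /=.
  have -> : p ^+ m = p ^+ (m - i.+1) * p ^+ i.+1 by rewrite -exprD subnK.
  by field; rewrite !pn z0.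
move=> e.
have c0 : (- z) ^+ m / p ^+ 'C(m.+1, 2) != 0 by rewrite mulf_neq0 ?invr_eq0 ?expf_neq0.
apply: (mulfI c0); rewrite e big_map -(big_mkord xpredT (fun i =>
  p ^+ 'C(i, 2) * gauss_binomial (2 * m) i * (- z / p ^+ m) ^+ i)).
rewrite /index_iota subn0 mulr_sumr; apply: eq_big_seq => i _.
rewrite subrK absz_nat expfzDr // -invr_expz -!exprnP exprMn exprVn -exprM.
have h : ('C(i, 2) + 'C(m.+1, 2) = m * i + triangular (i%:Z - m%:Z))%N.
  have := triangularE (i%:Z - m%:Z); have := triangularE i; have := triangularE m.+1.
  by rewrite /=; nia.
have e2 : p ^+ 'C(i, 2) * p ^+ 'C(m.+1, 2) = p ^+ (m * i) * p ^+ triangular (i%:Z - m%:Z).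
  by rewrite -!exprD h.
have -> : p ^+ 'C(i, 2) = p ^+ (m * i) * p ^+ triangular (i%:Z - m%:Z) / p ^+ 'C(m.+1, 2).
  by rewrite -e2 mulfK.
by field; rewrite !pn expf_neq0.
Qed.

End TripleProduct.

(** * The addition formula of theta *)
Section Tannery.
Variables (R : realType) (T : choiceType).
Local Notation C := R[i].

Lemma big_mem_seq (V : nmodType) (J U : seq T) (c : T -> V) : uniq J -> uniq U -> {subset J <= U} ->
  \sum_(t <- J) c t = \sum_(t <- U) (if t \in J then c t else 0).
Proof.
move=> uJ uU sJU; rewrite -big_mkcond -big_filter; apply: perm_big.
apply: uniq_perm => //; first by rewrite filter_uniq.
by move=> t; rewrite mem_filter; case: (boolP (t \in J)) => //= /sJU ->.
Qed.

Lemma sum_normc_small (s : seq T) (f : nat -> T -> C) :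
  (forall t, clim (f^~ t) 0) -> forall eps : R, 0 < eps ->
  exists N, forall m, (N <= m)%N -> \sum_(t <- s) normc (f m t) < eps.
Proof.
move=> hf; elim: s => [|t s IH] eps e0.
  by exists 0%N => m _; rewrite big_nil.
have e2 : 0 < eps / 2 by rewrite divr_gt0.
have [N hN] := IH _ e2; have [M hM] := hf t _ e2.
exists (maxn N M) => m; rewrite geq_max => /andP[/hN a /hM].
by rewrite subr0 big_cons => b; lra.
Qed.

(** Dominated convergence for two families of finite sums that exhaust the same
    index set: outside a finite set that carries almost all of the sum of w, both
    sums are small, and on this set the terms converge. *)
Lemma tannery (w : T -> R) (B : R) (c d : nat -> T -> C) (J K : nat -> seq T) :
  (forall t, 0 <= w t) -> (forall s, uniq s -> \sum_(t <- s) w t <= B) ->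
  (forall m, uniq (J m)) -> (forall m, uniq (K m)) ->
  (forall m t, normc (c m t) <= w t) -> (forall m t, normc (d m t) <= w t) ->
  (forall t, exists M, forall m, (M <= m)%N -> t \in J m /\ t \in K m) ->
  (forall t, clim (fun m => c m t - d m t) 0) ->
  clim (fun m => \sum_(t <- J m) c m t - \sum_(t <- K m) d m t) 0.
Proof.
move=> w0 hB uJ uK hc hd hJK hcd.
pose f m t := (if t \in J m then c m t else 0) - (if t \in K m then d m t else 0).
have hf t : clim (f^~ t) 0.
  have [M hM] := hJK t; apply: (@clim_ext _ _ _ _ M) (hcd t) => m /hM [a b].
  by rewrite /f a b.
have fw m t : normc (f m t) <= 2 * w t.
  apply: le_trans (normc_add _ _) _; rewrite normc_opp.
  have bnd b (z : C) : normc z <= w t -> normc (if b then z else 0) <= w t.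
    by case: b => // _; rewrite (normc0 R).
  by have := bnd (t \in J m) _ (hc m t); have := bnd (t \in K m) _ (hd m t); lra.
pose E := [set S : R | exists2 s, uniq s & S = \sum_(t <- s) w t]%classic.
have hE : has_sup E.
  split; first by exists 0; exists [::]; rewrite ?big_nil.
  by exists B => _ [s us ->]; exact: hB.
move=> eps e0; have e4 : 0 < eps / 4 by rewrite divr_gt0.
have [_ [s us ->] hs] := sup_adherent e4 hE.
have e2 : 0 < eps / 2 by rewrite divr_gt0.
have [N hN] := sum_normc_small s hf e2.
exists N => m Nm; rewrite subr0.
pose U := undup (J m ++ K m); have uU : uniq U by exact: undup_uniq.
rewrite (big_mem_seq _ (uJ m) uU); last by move=> t; rewrite mem_undup mem_cat => ->.
rewrite (big_mem_seq _ (uK m) uU); last by move=> t; rewrite mem_undup mem_cat orbC => ->.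
rewrite -sumrB; apply: le_lt_trans (normc_sum _ _) _.
rewrite (bigID (mem s)) /= -/(f m _).
have h1 : \sum_(t <- U | t \in s) normc (f m t) <= \sum_(t <- s) normc (f m t).
  rewrite -big_filter (@big_mem_seq _ _ s _ _ us).
  - by rewrite ler_sum // => t _; case: ifP => // _; exact: normc_ge0.
  - by rewrite filter_uniq.
  by move=> t; rewrite mem_filter => /andP[].
have h2 : \sum_(t <- U | t \notin s) normc (f m t) <= 2 * (eps / 4).
  apply: (@le_trans _ _ (2 * \sum_(t <- U | t \notin s) w t)).
    by rewrite mulr_sumr ler_sum.
  rewrite ler_wpM2l //.
  have : \sum_(t <- s ++ [seq t <- U | t \notin s]) w t <= sup E.
    apply: ub_le_sup; first by case: hE.
    exists (s ++ [seq t <- U | t \notin s]) => //.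
    rewrite cat_uniq us filter_uniq // andbT; apply/hasPn => t.
    by rewrite mem_filter => /andP[].
  by rewrite big_cat big_filter /=; lra.
by have := hN m Nm; move: h1 h2; rewrite /f; lra.
Qed.

End Tannery.

Section Addition.
Variable R : realType.
Local Notation C := R[i].

(** For 0 <= r < 1 this bounds the q-binomial coefficients from below by 1. *)
Lemma eulerD_ge (r : R) i n : 0 <= r -> r < 1 -> euler_product r i * euler_product r n <= euler_product r (i + n).
Proof.
move=> r0 r1; have e0 k : 0 <= euler_product r k.
  by apply: prodr_ge0 => j _; rewrite subr_ge0 exprn_ile1 // ltW.
elim: n => [|n IH]; first by rewrite addn0 {2}/euler_product big_ord0 mulr1.
rewrite addnS !eulerS mulrA; apply: (@le_trans _ _ (euler_product r (i + n) * (1 - r ^+ n.+1))).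
  by rewrite ler_wpM2r // subr_ge0 exprn_ile1 // ltW.
rewrite ler_wpM2l // lerD2l lerN2 -addnS exprD -[leRHS]mul1r.
by rewrite ler_wpM2r ?exprn_ge0 // exprn_ile1 // ltW.
Qed.

Definition triple_term (p z : C) (k : int) : C := (- z) ^ k * p ^+ triangular k.

(** The absolute values are terms of a finite triple product for |p| and - |z|,
    up to binomial coefficients that are at least 1, and this product is bounded. *)
Lemma triple_term_summable (p z : C) : p != 0 -> normc p < 1 -> z != 0 ->
  exists B : R, forall s, uniq s -> \sum_(k <- s) normc (triple_term p z k) <= B.
Proof.
move=> p0 p1 z0; pose r : R := normc p; pose x : R := normc z.
have r0 : 0 < r by rewrite normc_gt0.
have x0 : 0 < x by rewrite normc_gt0.
have nr j : 1 - r ^+ j.+1 != 0.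
  by rewrite gt_eqF // subr_gt0 exprn_ilt1 // ltW.
have bnd m : \sum_(k <- sym_range m) x ^ k * r ^+ triangular k
    <= expR (x / (1 - r)) * expR (r / x / (1 - r)).
  have nx : - x != 0 by rewrite oppr_eq0 gt_eqF.
  have e := finite_triple_product nr (lt0r_neq0 r0) m nx.
  have le1 : \sum_(k <- sym_range m) x ^ k * r ^+ triangular k <= 
      \prod_(j < m) ((1 - - x * r ^+ j) * (1 - r ^+ j.+1 / - x)).
    rewrite e opprK; rewrite big_seq [leRHS]big_seq; apply: ler_sum => k.
    rewrite mem_sym_range => km; rewrite ler_peMr //.
      by rewrite mulr_ge0 ?exprz_ge0 ?exprn_ge0 // ltW.
    have en n : 0 < euler_product r n.
      by apply: prodr_gt0 => j _; rewrite subr_gt0 exprn_ilt1 // ltW.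
    rewrite /gauss_binomial ler_pdivlMr ?mulr_gt0 // mul1r.
    set i := absz _; have {2}-> : (2 * m = i + (2 * m - i))%N by rewrite /i; lia.
    by apply: eulerD_ge => //; exact: ltW.
  apply: (le_trans le1); rewrite big_split /= ler_pM //.
  - apply: prodr_ge0 => j _; rewrite mulNr opprK addr_ge0 ?mulr_ge0 ?exprn_ge0 ?ltW //.
  - apply: prodr_ge0 => j _; rewrite invrN mulrN opprK.
    by rewrite addr_ge0 ?mulr_ge0 ?exprn_ge0 ?invr_ge0 ?ltW.
  - under eq_bigr do rewrite mulNr opprK; apply: real_prod_bounded => //; exact: ltW.
  under eq_bigr => j _ do rewrite invrN mulrN opprK exprS mulrAC.
  by apply: real_prod_bounded => //; rewrite ?divr_ge0 ?ltW.
exists (expR (x / (1 - r)) * expR (r / x / (1 - r))) => s us.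
pose M := (\max_(k <- s) absz k)%N.
apply: le_trans (bnd M).
have nE k : normc (triple_term p z k) = x ^ k * r ^+ triangular k.
  by rewrite normcM normcXz normc_opp normcX.
under eq_bigr do rewrite nE.
rewrite (@big_mem_seq _ _ s (sym_range M)) ?sym_range_uniq //.
  by rewrite ler_sum // => k _; case: ifP => // _; rewrite mulr_ge0 ?exprz_ge0 ?exprn_ge0 // ltW.
move=> k ks; rewrite mem_sym_range.
have : (absz k <= M)%N by rewrite /M; apply: leq_bigmax_seq.
by lia.
Qed.

Variable p : C.
Hypotheses (p0 : p != 0) (p1 : normc p < 1).

Lemma one_sub_pX_neq0 j : 1 - p ^+ j.+1 != 0.
Proof.
rewrite subr_eq0; apply/eqP => /(congr1 (fun z : C => normc z)).
rewrite normc1 normcX => e.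
have : normc p ^+ j.+1 < 1 by rewrite exprn_ilt1 // normc_ge0.
by rewrite -e ltxx.
Qed.

Lemma euler_clim : exists2 A, A != 0 & clim (euler_product p) A.
Proof.
have h j : normc (- p ^+ j.+1) <= 1 * normc p ^+ j.
  rewrite normc_opp normcX mul1r exprS -[leRHS]mul1r ler_wpM2r ?exprn_ge0 ?normc_ge0 //.
  exact: ltW.
have [A hA] := prod_cvg (normc_ge0 p) p1 h.
exists A; last by apply: (@clim_ext _ _ _ _ 0) hA.
by apply: (prod_neq0 (normc_ge0 p) p1 h _ hA) => j; exact: one_sub_pX_neq0.
Qed.

(** The coefficient of the k-th term in the m-th partial product of theta, extended
    by zero to all integers. *)
Definition binom_coef (m : nat) (k : int) : C :=
  if k \in sym_range m then gauss_binomial p (2 * m) (absz (k + m%:Z)) else 0.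

Lemma binom_coef_bounded : exists B : R, forall m k, normc (binom_coef m k) <= B.
Proof.
have [A A0 hA] := euler_clim.
have [B B0 hB] := clim_bounded hA.
have [D D0 hD] := clim_bounded (climV A0 hA).
exists (B * (D * D)) => m k; rewrite /binom_coef; case: ifP => _; last first.
  by rewrite (normc0 R) !mulr_ge0 // ltW.
rewrite /gauss_binomial normcM ler_pM ?normc_ge0 //.
by rewrite invfM normcM ler_pM ?normc_ge0.
Qed.

Lemma binom_coef_clim A : A != 0 -> clim (euler_product p) A ->
  forall k, clim (binom_coef^~ k) A^-1.
Proof.
move=> A0 hA k.
have h1 : clim (fun m => euler_product p (2 * m)) A.
  by apply: clim_comp hA => M; exists M => n; lia.
have h2 : clim (fun m => euler_product p (absz (k + m%:Z))) A.
  by apply: (clim_comp (f := fun m => absz (k + m%:Z))) hA => M; exists (M + absz k)%N => n; lia.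
have h3 : clim (fun m => euler_product p (2 * m - absz (k + m%:Z)%R)%N) A.
  have hf M : exists N, forall n, (N <= n)%N -> (M <= 2 * n - absz (k + n%:Z)%R)%N.
    by exists (M + absz k)%N => n; lia.
  exact: (clim_comp hf hA).
have := climM h1 (climV (mulf_neq0 A0 A0) (climM h2 h3)).
have -> : A * (A * A)^-1 = A^-1 by field.
apply: (@clim_ext _ _ _ _ (absz k)) => m km; rewrite /binom_coef mem_sym_range.
have -> : - m%:Z <= k <= m%:Z by lia.
by [].
Qed.

Lemma theta_prod_triple_terms z m : z != 0 ->
  theta_prod p z m = \sum_(k <- sym_range m) triple_term p z k * binom_coef m k.
Proof.
move=> z0; rewrite /theta_prod (finite_triple_product one_sub_pX_neq0 p0) //.
by apply: eq_big_seq => k km; rewrite /binom_coef km.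
Qed.

(** Truncated theta series in odd and in even powers of x, for the nome p. *)
Definition odd_part (m : nat) (x : C) : C :=
  \sum_(i <- sym_range m) p ^ (i * i + i) * x ^ (2 * i + 1).
Definition even_part (m : nat) (x : C) : C :=
  \sum_(i <- sym_range m) p ^ (i * i) * x ^ (2 * i).

(** The pairs (k, l) with k + l even (first list) or odd (second list), indexed so
    that the powers of x and y separate. *)
Definition parity_pairs (m : nat) : seq (int * int) :=
  [seq (i + 1 + j, i + 1 - j) | i <- sym_range m, j <- sym_range m] ++
  [seq (i + j + 1, i - j) | i <- sym_range m, j <- sym_range m].

Lemma parity_pairs_uniq m : uniq (parity_pairs m).
Proof.
rewrite cat_uniq; apply/and3P; split.
- apply: allpairs_uniq; rewrite ?sym_range_uniq // => -[i j] [i' j'] _ _ /= [e1 e2].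
  by congr pair; lia.
- apply/hasPn => t /allpairsP [[i j] [_ _ ->]].
  by apply/negP => /allpairsP [[i' j'] [_ _ /= []]]; lia.
apply: allpairs_uniq; rewrite ?sym_range_uniq // => -[i j] [i' j'] _ _ /= [e1 e2].
by congr pair; lia.
Qed.

Lemma mem_parity_pairs k l m : (absz k + absz l + 2 <= m)%N -> (k, l) \in parity_pairs m.
Proof.
move=> hm; rewrite mem_cat; pose h := ((k - l) %/ 2)%Z.
have : k - l = 2 * h \/ k - l = 2 * h + 1 by rewrite /h; lia.
case=> e; apply/orP; [left|right]; apply/allpairsP.
  by exists (l + h - 1, h); split; rewrite /= ?mem_sym_range; try lia; congr pair; lia.
by exists (l + h, h); split; rewrite /= ?mem_sym_range; try lia; congr pair; lia.
Qed.

(** For k + l and k - l of the same parity, the exponent of p is a sum of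
    functions of k + l and of k - l, so each of the two lists gives a product. *)
Lemma sum_parity_pairs m (x y : C) : x != 0 -> y != 0 ->
  \sum_(t <- parity_pairs m) triple_term p (x * y) t.1 * triple_term p (x / y) t.2 =
  x * (odd_part m x * even_part m y - even_part m x * odd_part m y).
Proof.
move=> x0 y0.
have E k l : triple_term p (x * y) k * triple_term p (x / y) l =
    (-1) ^ (k + l) * p ^ ((triangular k)%:Z + (triangular l)%:Z) * x ^ (k + l) * y ^ (k - l).
  have N1 : (-1 : C) != 0 by rewrite oppr_eq0 oner_neq0.
  rewrite /triple_term -(mulN1r (x * y)) -(mulN1r (x / y)) !expfzMl exprz_inv.
  rewrite !expfzDr // -!exprnP; ring.
have pow2 (i : int) : (-1 : C) ^ (2 * i) = 1.
  by rewrite -exprz_exp -exprnP sqrrN expr1n exp1rz.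
rewrite big_cat !big_allpairs_dep /= mulrBr; congr (_ + _).
  rewrite /odd_part /even_part mulr_suml mulr_sumr; apply: eq_bigr => i _.
  rewrite mulr_sumr mulr_sumr; apply: eq_bigr => j _; rewrite E.
  have -> : i + 1 + j + (i + 1 - j) = 2 * (i + 1) by ring.
  have -> : i + 1 + j - (i + 1 - j) = 2 * j by ring.
  have -> : (triangular (i + 1 + j))%:Z + (triangular (i + 1 - j))%:Z = i * i + i + j * j.
    by have := triangularE (i + 1 + j); have := triangularE (i + 1 - j); rewrite !mulr2n; nia.
  rewrite pow2; have -> : 2 * (i + 1) = 2 * i + 1 + 1 by ring.
  by rewrite !(expfzDr _ _ p0) (expfzDr _ 1 x0) expr1z; ring.
rewrite -mulrN /odd_part /even_part mulr_suml -sumrN mulr_sumr; apply: eq_bigr => i _.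
rewrite mulr_sumr -sumrN mulr_sumr; apply: eq_bigr => j _; rewrite E.
have -> : i + j + 1 + (i - j) = 2 * i + 1 by ring.
have -> : i + j + 1 - (i - j) = 2 * j + 1 by ring.
have -> : (triangular (i + j + 1))%:Z + (triangular (i - j))%:Z = i * i + (j * j + j).
  by have := triangularE (i + j + 1); have := triangularE (i - j); rewrite !mulr2n; nia.
have N1 : (-1 : C) != 0 by rewrite oppr_eq0 oner_neq0.
rewrite (expfzDr _ 1 N1) pow2 expr1z (expfzDr _ (j * j + j) p0) (expfzDr _ 1 x0) expr1z.
by ring.
Qed.

(** Two finite versions of one double series: the product of the partial products
    runs over the square of pairs (k, l), with coefficients tending to 1 after
    multiplication by A^2, and the right side over [parity_pairs]. *)
Lemma theta_product_clim A (x y : C) : A != 0 -> clim (euler_product p) A -> x != 0 -> y != 0 ->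
  clim (fun m => odd_part m x * even_part m y - even_part m x * odd_part m y)
    (A ^+ 2 * (theta (x * y) p * theta (x / y) p) / x).
Proof.
move=> A0 hA x0 y0.
have xy0 : x * y != 0 by rewrite mulf_neq0.
have xy'0 : x / y != 0 by rewrite mulf_neq0 ?invr_eq0.
have [B1 hB1] := triple_term_summable p0 p1 xy0.
have [B2 hB2] := triple_term_summable p0 p1 xy'0.
have [D hD] := binom_coef_bounded.
have D0 : 0 <= D by apply: le_trans (hD 0%N 0); exact: normc_ge0.
pose t1 := triple_term p (x * y); pose t2 := triple_term p (x / y).
pose E : R := normc (A ^+ 2) * (D * D) + 1.
have E1 : 1 <= E by rewrite lerDr !mulr_ge0 ?normc_ge0.
pose w (t : int * int) : R := E * (normc (t1 t.1) * normc (t2 t.2)).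
pose c m (t : int * int) := A ^+ 2 * (binom_coef m t.1 * binom_coef m t.2) * (t1 t.1 * t2 t.2).
pose d (m : nat) (t : int * int) := t1 t.1 * t2 t.2.
pose J m := [seq (k, l) | k <- sym_range m, l <- sym_range m].
have w0 t : 0 <= w t by rewrite !mulr_ge0 ?normc_ge0 // (le_trans _ E1).
have wB s : uniq s -> \sum_(t <- s) w t <= E * (B1 * B2).
  move=> us; pose M := (\max_(t <- s) (absz t.1 + absz t.2))%N.
  have uJ : uniq (J M) by rewrite allpairs_uniq ?sym_range_uniq // => -[? ?] [? ?].
  apply: (@le_trans _ _ (\sum_(t <- J M) w t)).
    rewrite (@big_mem_seq _ _ s (J M)) //.
      by rewrite ler_sum // => t _; case: ifP.
    move=> [k l] kls; apply/allpairsP; exists (k, l).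
    have /mem_sym_range_pair [] : (absz k + absz l <= M)%N.
      by apply: (leq_bigmax_seq (P := xpredT)
        (F := fun t : int * int => (absz t.1 + absz t.2)%N) (k, l)).
    by split.
  rewrite big_allpairs_dep /w /=.
  under eq_bigr do rewrite -mulr_sumr -mulr_sumr.
  rewrite -mulr_sumr -mulr_suml ler_wpM2l ?(le_trans _ E1) // ler_pM ?sumr_ge0 //.
  - by move=> *; exact: normc_ge0.
  - by move=> *; exact: normc_ge0.
  - by apply: hB1; exact: sym_range_uniq.
  by apply: hB2; exact: sym_range_uniq.
have hc m t : normc (c m t) <= w t.
  rewrite /c /w !normcM ler_wpM2r ?mulr_ge0 ?normc_ge0 //.
  apply: (@le_trans _ _ (normc (A ^+ 2) * (D * D))); last by rewrite lerDl.
  by rewrite -normcM ler_wpM2l ?normc_ge0 // ler_pM ?normc_ge0.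
have hd m t : normc (d m t) <= w t.
  by rewrite /d /w normcM ler_peMl ?mulr_ge0 ?normc_ge0.
have lim0 t : clim (fun m => c m t - d m t) 0.
  have h1 := binom_coef_clim A0 hA t.1; have h2 := binom_coef_clim A0 hA t.2.
  have := climM (climM (clim_cst (A ^+ 2)) (climM h1 h2)) (clim_cst (t1 t.1 * t2 t.2)).
  have -> : A ^+ 2 * (A^-1 * A^-1) = 1 by field.
  by rewrite mul1r => /clim_sub0.
have uJ m : uniq (J m) by rewrite allpairs_uniq ?sym_range_uniq // => -[? ?] [? ?].
have hJK t : exists M, forall m, (M <= m)%N -> t \in J m /\ t \in parity_pairs m.
  case: t => k l; exists (absz k + absz l + 2)%N => m hm; split.
    have /mem_sym_range_pair [ks ls] : (absz k + absz l <= m)%N.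
      by apply: leq_trans hm; rewrite leq_addr.
    by apply/allpairsP; exists (k, l).
  exact: mem_parity_pairs.
have main := tannery w0 wB uJ parity_pairs_uniq hc hd hJK lim0.
have hT := climM (clim_cst (A ^+ 2)) (climM (theta_cvg p1 (x * y)) (theta_cvg p1 (x / y))).
have := climM (climB hT main) (clim_cst x^-1); rewrite subr0.
apply: (@clim_ext _ _ _ _ 0) => m _; rewrite /d sum_parity_pairs // !theta_prod_triple_terms //.
suff -> : \sum_(t <- J m) c m t = A ^+ 2 *
    ((\sum_(k <- sym_range m) triple_term p (x * y) k * binom_coef m k) *
     (\sum_(k <- sym_range m) triple_term p (x / y) k * binom_coef m k)).
  move: (A ^+ 2 * _) (odd_part m x * _ - _) => u v.
  by field.
rewrite big_allpairs_dep /= mulr_suml mulr_sumr; apply: eq_bigr => k _.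
by rewrite !mulr_sumr; apply: eq_bigr => l _; rewrite /c /t1 /t2 /=; ring.
Qed.

End Addition.

(** The limits of o_m(x) e_m(y) - e_m(x) o_m(y) satisfy the Pluecker relation, and
    expanding along a pair (u, v) with nonzero limit gives o and e.  The case
    p = 0, where the triple product degenerates, is 1 - a = theta(a). *)
Lemma theta_addition (R : realType) (p : R[i]) : normc p < 1 ->
  exists o e : R[i] -> R[i], forall x y, x != 0 -> y != 0 ->
    theta (x * y) p * theta (x / y) p = x * wedge o e x y.
Proof.
move=> p1; have [p0|p0] := eqVneq p 0.
  have th0 (a : R[i]) : theta a p = 1 - a.
    apply: (clim_unique (theta_cvg p1 a)).
    apply: (@clim_ext _ (fun=> 1 - a) _ _ 1) (clim_cst _) => -[//|m] _.
    rewrite /theta_prod big_ord_recl big1 => [|j _].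
      by rewrite p0 expr0 expr1 mul0r subr0 !mulr1.
    by rewrite p0 !expr0n /= mulr0 mul0r subr0 mul1r.
  exists (fun x => x + x^-1), (fun=> 1) => x y x0 y0.
  by rewrite !th0 /wedge; field; rewrite x0 y0.
have [A A0 hA] := euler_clim p1.
pose G x y := A ^+ 2 * (theta (x * y) p * theta (x / y) p) / x.
have limG x y (x0 : x != 0) (y0 : y != 0) := theta_product_clim p0 p1 A0 hA x0 y0.
have plucker x y u v : x != 0 -> y != 0 -> u != 0 -> v != 0 ->
    G x y * G u v = G x u * G y v - G x v * G y u.
  move=> x0 y0 u0 v0.
  have h1 := climM (limG _ _ x0 y0) (limG _ _ u0 v0).
  have h2 := climB (climM (limG _ _ x0 u0) (limG _ _ y0 v0))
                   (climM (limG _ _ x0 v0) (limG _ _ y0 u0)).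
  apply: (clim_unique h1); apply: (@clim_ext _ _ _ _ 0) h2 => m _.
  move: (odd_part p m x) (odd_part p m y) (odd_part p m u) (odd_part p m v)
    (even_part p m x) (even_part p m y) (even_part p m u) (even_part p m v) => *.
  by ring.
have theta_G x y : x != 0 -> theta (x * y) p * theta (x / y) p = x * (G x y / A ^+ 2).
  by move=> x0; rewrite /G; field; rewrite A0 x0.
have [[u [v [u0 v0 uv]]]|none] := pselect (exists u v, [/\ u != 0, v != 0 & G u v != 0]).
  exists (fun x => G x u / G u v / A ^+ 2), (fun x => G x v) => x y x0 y0.
  rewrite theta_G //; congr (_ * _).
  have -> : G x y = (G x u * G y v - G x v * G y u) / G u v by rewrite -plucker // mulfK.
  by rewrite /wedge; field; rewrite A0 uv.
exists (fun=> 0), (fun=> 0) => x y x0 y0.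
rewrite theta_G // /wedge mul0r subr0 mulr0.
have -> : G x y = 0 by apply/eqP; apply: contrapT => /negP h; apply: none; exists x, y.
by rewrite mul0r mulr0.
Qed.

(** * The elliptic Jackson sum *)
Lemma prod_pairs (F : comNzRingType) n (f : 'I_n -> 'I_n -> F) :
  \prod_(r < n) \prod_(s < n) f r s =
  \prod_(r < n) f r r * \prod_(r < n) \prod_(s < n | (r < s)%N) (f r s * f s r).
Proof.
have -> : \prod_(r < n) \prod_(s < n | (r < s)%N) (f r s * f s r) =
    \prod_(r < n) \prod_(s < n | (r < s)%N) f r s *
    \prod_(r < n) \prod_(s < n | (s < r)%N) f r s.
  rewrite [X in _ = _ * X](exchange_big_dep xpredT) //= -big_split /=.
  by apply: eq_bigr => r _; rewrite -big_split.
rewrite -!big_split; apply: eq_bigr => r _ /=.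
rewrite (bigD1 r) //= (bigID (fun s : 'I_n => (r < s)%N)) /=; congr (_ * (_ * _)).
  by apply: eq_bigl => s; case: ltngtP => //; rewrite ?andbT ?andbF // => h;
    apply/negP => /eqP e; rewrite e ltnn in h.
apply: eq_bigl => s; rewrite -leqNgt [RHS]ltn_neqAle; congr (_ && _).
Qed.

(** Separates the summand into factors of single rows and of pairs of rows; the
    variables name its products in the order in which they occur. *)
Lemma regroup_products (F : fieldType) n (p1 s1 s2 s3 s4 cx xx : 'I_n -> F)
    (t1 t2 t3 d d' e nn : 'I_n -> 'I_n -> F) (w : F) :
  (\prod_(r < n) p1 r) / w *
  (((\prod_(r < n) s1 r) * (\prod_(r < n) \prod_(s < n | (r < s)%N) t1 r s)
    * (\prod_(r < n) s2 r)
    * (((\prod_(r < n) \prod_(s < n | (r < s)%N) t2 r s) * (\prod_(r < n) s3 r))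
       / (\prod_(r < n) \prod_(s < n) d r s))
    * (\prod_(r < n) cx r) * (\prod_(r < n) xx r)
    * (\prod_(r < n) \prod_(s < n | (r < s)%N) e r s))
   * ((\prod_(r < n) \prod_(s < n) nn r s)
      / ((\prod_(r < n) \prod_(s < n | (r < s)%N) t3 r s)
         * (\prod_(r < n) \prod_(s < n) d' r s))
      * \prod_(r < n) s4 r)) =
  w^-1 * \prod_(r < n) (p1 r * s1 r * s2 r * (s3 r / d r r) * cx r * xx r
                * (nn r r / d' r r * s4 r))
  * \prod_(r < n) \prod_(s < n | (r < s)%N)
      (t1 r s * t2 r s / (d r s * d s r) * e r s * (nn r s * nn s r)
       / (t3 r s * (d' r s * d' s r))).
Proof.
rewrite !prod_pairs !big_split /= !prodfV.
have inner (G H : 'I_n -> 'I_n -> F) :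
   \prod_(r < n) \prod_(s < n | (r < s)%N) (G r s * H r s) =
   (\prod_(r < n) \prod_(s < n | (r < s)%N) G r s) *
   (\prod_(r < n) \prod_(s < n | (r < s)%N) H r s).
  by rewrite -big_split; apply: eq_bigr => r _; rewrite big_split.
have innerV (G : 'I_n -> 'I_n -> F) :
   \prod_(r < n) \prod_(s < n | (r < s)%N) (G r s)^-1 =
   (\prod_(r < n) \prod_(s < n | (r < s)%N) G r s)^-1.
  by rewrite -prodfV; apply: eq_bigr => r _; rewrite prodfV.
rewrite !(inner, innerV) !invfM; ring.
Qed.

Lemma string_sorted (F : numClosedFieldType) (th : F -> F) (q : F) A k :
  q != 0 -> th 1 = 0 -> A != 0 ->
  sorted (fun y z => interaction th q z^-1 y == 0) (string q A k).
Proof.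
move=> q0 th1; elim: k A => // k IH A A0; rewrite stringS /=.
case: k IH => // k /(_ (A * q)); rewrite stringS /= => IH.
rewrite IH ?mulf_neq0 // andbT /interaction.
have -> : q * (A * q)^-1 * A = 1 by field; rewrite q0 A0.
by rewrite th1 mul0r.
Qed.

Section Final.
Variable R : realType.
Local Notation C := R[i].
Variables (q p : C) (n : nat) (x : 'I_n -> C).
Local Notation th := (fun a : C => theta a p).
Local Notation P := (poch th q).
Local Notation qf := (qpfact q p).

Local Arguments qpfact : simpl never.

Lemma qpfact_nat (a : C) (m : nat) : qf a m%:Z = P a m.
Proof. by rewrite /qpfact /poch big_mkord. Qed.

Lemma qpfact_natD (a : C) (m l : nat) : qf a (m%:Z + l%:Z) = P a (m + l).
Proof. by rewrite -PoszD qpfact_nat. Qed.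

Lemma qpfactS (a : C) (k : int) : (k < 0 -> th (a * q ^ k) != 0) ->
  qf a (k + 1) = qf a k * th (a * q ^ k).
Proof.
case: k => [m|[|m]] hk.
- by rewrite -PoszD !qpfact_nat addn1 pochSr.
- by rewrite /qpfact /= big_nil big_nat1 mulVf ?hk.
have -> : Negz m.+1 + 1 = Negz m by lia.
rewrite /qpfact [in RHS]big_nat_recr //= invfM -[in RHS]mulrA mulVf ?mulr1 //.
exact: hk.
Qed.

(** For negative k, the assumption on the factorial says that none of the inverted
    theta functions vanishes, which allows to cancel them. *)
Lemma qpfact_shift (a : C) (k : int) (i : nat) : q != 0 -> qf a k != 0 ->
  qf a (k + i%:Z) = qf a k * P (a * q ^ k) i.
Proof.
move=> q0 hk; elim: i => [|i IH].
  by rewrite addr0 /poch big_ord0 mulr1.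
have -> : k + i.+1%:Z = k + i%:Z + 1 by lia.
rewrite qpfactS ?IH; first by rewrite pochSr expfzDr // -exprnP !mulrA.
move=> neg; case: k hk neg {IH} => m; first by lia.
rewrite /qpfact invr_eq0 big_mkord => /prodf_neq0 hm neg.
have lt : (m - i < m.+1)%N by lia.
have := hm (Ordinal lt) isT.
by have -> : Negz m + i%:Z = - (m - i).+1%:Z by lia.
Qed.

Variables (rho1 rho2 : C).
Hypotheses (q0 : q != 0) (p1 : normc p < 1) (n0 : (0 < n)%N).
Hypotheses (x0 : forall r, x r != 0) (rho10 : rho1 != 0) (rho20 : rho2 != 0).
Variables a b : C.
Hypothesis gen : transformed_generic q p x rho1 rho2 a b.
Let c := b * rho1 * rho2 / (a * q).

Let a0 : a != 0. Proof. by case: gen => -[]. Qed.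
Let b0 : b != 0. Proof. by case: gen => -[]. Qed.
Let c0 : c != 0. Proof. by rewrite /c !mulf_neq0 ?invr_eq0 ?mulf_neq0. Qed.

Let thVq (z : C) : z != 0 -> th z^-1 = - th z / z. Proof. exact: thetaV. Qed.

Let thq m : th (q ^+ m.+1) != 0.
Proof.
case: gen => -[_ _ h] _ _ _; pose r := Ordinal n0.
have [|/(_ r r) + _] := h [ffun=> m.+1] [ffun=> 0%N]; first by move=> s; rewrite !ffunE.
rewrite !ffunE (_ : 1 + 0%N%:Z - 0%N%:Z = 1) // expr1z mulfK // subr0 qpfact_nat pochSr mulf_eq0 negb_or.
by case/andP => _; rewrite -exprS.
Qed.

(* A multi-index j with 1 + j_r - j_s = i exhibits the quotient among the
   denominators of B1. *)
Let thx r s (i : int) : r != s -> th (q ^ i * x r / x s) != 0.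
Proof.
move=> rs; case: gen => -[_ _ h] _ _ _.
pose u := (absz i + 1)%N; pose v := absz (u%:Z + 1 - i)%R.
pose j : multi_index n := [ffun t => if t == r then u else v].
have [|/(_ r s) + _] := h [ffun t => (j t).+1] j; first by move=> t; rewrite !ffunE.
rewrite !ffunE eqxx [s == r]eq_sym (negPf rs).
have -> : u.+1%:Z - u%:Z = 1%N by lia.
have -> : 1 + u%:Z - v%:Z = i by rewrite /v /u; lia.
by rewrite qpfact_nat /poch big_ord1 expr0 mulr1.
Qed.

Let hcq r s i : th (c * q * x r * x s * q ^+ i) != 0.
Proof.
case: gen => _ _ _ /(_ [ffun=> i.+1] [ffun=> 0%N]) [|_ _ _ _ /(_ r s) [+ _]].
  by move=> t; rewrite !ffunE.
rewrite !ffunE addn0 qpfact_nat pochSr mulf_eq0 negb_or => /andP[_].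
suff -> : b * rho1 * rho2 * x r * x s / a = c * q * x r * x s by [].
by rewrite /c; field; rewrite a0 q0.
Qed.

Let hc r s i : th (c * x r * x s * q ^+ i) != 0.
Proof.
case: i => [|i]; last first.
  have -> : c * x r * x s * q ^+ i.+1 = c * q * x r * x s * q ^+ i by rewrite exprS; ring.
  exact: hcq.
have e r' s' : b * rho1 * rho2 * x r' * x s' / (a * q) = c * x r' * x s'.
  by rewrite /c; ring.
rewrite expr0 mulr1.
case: gen => _ _ _ /(_ [ffun=> 0%N] [ffun=> 0%N]) [|_ _ h1 h2 _].
  by move=> t; rewrite !ffunE.
case: (ltngtP r s) => [rs|sr|/ord_inj ->].
- by rewrite -e h1.
- by rewrite (mulrAC c) -e h1.
by have := h2 s; rewrite expr2 (mulrA _ (x s) (x s)) e.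
Qed.

Definition beta_prefactor (N : multi_index n) : C :=
  (\prod_(r < n) (qf (b * rho1 * x r / a) (N r) * qf (b * rho2 * x r / a) (N r)))
  / (qf (a * q / rho1) (weight N) * qf (a * q / rho2) (weight N)).

Definition beta_summand (N k : multi_index n) : C :=
      (\prod_(r < n)
         (qf (rho1 * x r) (k r) * qf (rho2 * x r) (k r)
          * qf (a * q ^ (1 + (weight N)%:Z - (N r)%:Z) / (rho1 * rho2 * x r))
              ((N r)%:Z - (k r)%:Z)
          / (qf (b * rho1 * x r / a) (k r)
             * qf (b * rho2 * x r / a) (k r))))
      * (\prod_(r < n) \prod_(s < n | (r < s)%N)
           (theta (b * rho1 * rho2 * x r * x s * q ^+ (k r + k s) / (a * q)) p
            / theta (b * rho1 * rho2 * x r * x s / (a * q)) p))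
      * (\prod_(r < n)
           (theta (b * rho1 * rho2 * x r ^+ 2 * q ^+ (2 * k r) / (a * q)) p
            / theta (b * rho1 * rho2 * x r ^+ 2 / (a * q)) p))
      * (((\prod_(r < n) \prod_(s < n | (r < s)%N)
             qf (b * rho1 * rho2 * x r * x s / a) (N r + N s)%N)
          * (\prod_(r < n) qf (b * x r) ((weight N)%:Z + (k r)%:Z)))
         / \prod_(r < n) \prod_(s < n)
             (qf (b * rho1 * rho2 * x r * x s / a) (N s + k r)%N
              * qf (q ^ (1 + (k r)%:Z - (k s)%:Z) * x r / x s)
                  ((N r)%:Z - (k r)%:Z)))
      * (a * q / (rho1 * rho2)) ^+ weight k
      * (\prod_(r < n) x r ^- k r)
      * q ^+ e2 k.

Definition alpha_factor (j : multi_index n) : C :=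
  (\prod_(r < n) (qf (rho1 * x r) (j r) * qf (rho2 * x r) (j r)))
  / (qf (a * q / rho1) (weight j) * qf (a * q / rho2) (weight j))
  * (a * q / (rho1 * rho2)) ^+ weight j
  * (\prod_(r < n) x r ^- j r)
  * q ^+ e2 j.

Section Sum.
Variables (N j : multi_index n).
Hypothesis jN : forall r, (j r <= N r)%N.
Let L r := (N r - j r)%N.
Let J := weight j.
Let NN := weight N.
(* The points gamma x_r q^l with j_r <= l < N_r, with gamma^2 = c q, and the
   parameters t1, t2, t3, t4 are found by matching theta(t z) and theta(t / z)
   with the factors of the summand in rho1, rho2, a and b. *)
Let gamma := sqrtC (c * q).
Let t1 := gamma / rho1.
Let t2 := gamma / rho2.
Let t3 := gamma * a * q ^+ J / c.
Let t4 := gamma / (b * q ^+ NN).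
Let zss r := string q (gamma * x r * q ^+ j r) (L r).
Let g := site_weight th t1 t2 t3 t4.

Let gamma2 : gamma ^+ 2 = c * q. Proof. by rewrite /gamma sqrtCK. Qed.
Let gamma0 : gamma != 0. Proof. by rewrite /gamma sqrtC_eq0 mulf_neq0. Qed.
Let qn i : q ^+ i != 0. Proof. by rewrite expf_neq0. Qed.

Let NE r : N r = (j r + L r)%N. Proof. by rewrite subnKC. Qed.

Lemma weight_excess : NN = (J + \sum_(r < n) L r)%N.
Proof. by rewrite /NN /J /weight -big_split; apply: eq_bigr => r _; exact: NE. Qed.

Lemma size_points : size (flatten [seq zss r | r <- enum 'I_n]) = (NN - J)%N.
Proof.
rewrite weight_excess addKn size_flatten /shape -map_comp sumnE big_map big_enum.
by apply: eq_bigr => r _ /=; rewrite size_string.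
Qed.

Let thq_frac u v : u != v -> th (q ^+ u / q ^+ v) != 0.
Proof. exact: (thq_ratio q0 thVq thq). Qed.

Let th1' : th 1 = 0. Proof. exact: theta1. Qed.

Lemma points_quotient r s u v : (r, u) != (s, v) ->
  th ((gamma * x r * q ^+ u) / (gamma * x s * q ^+ v)) != 0.
Proof.
move=> ne; have [rs|rs] := eqVneq r s.
  have -> : gamma * x r * q ^+ u / (gamma * x s * q ^+ v) = q ^+ u / q ^+ v.
    by rewrite rs; field; rewrite gamma0 x0 qn.
  by apply: thq_frac; apply: contraNneq ne => ->; rewrite rs.
have -> : gamma * x r * q ^+ u / (gamma * x s * q ^+ v) = q ^ (u%:Z - v%:Z) * x r / x s.
  by rewrite expfzDr // -invr_expz -!exprnP; field; rewrite gamma0 x0 qn.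
exact: thx.
Qed.

(** Equal points or zeros would give zeros of theta at q^i x_r / x_s, at q^i with
    i > 0, or at c q^i x_r x_s, all of which occur as denominators. *)
Lemma points_generic : generic_points th (flatten [seq zss r | r <- enum 'I_n]).
Proof.
pose f r l := gamma * x r * q ^+ j r * q ^+ l.
have fE r l : f r l = gamma * x r * q ^+ (j r + l) by rewrite /f exprD mulrA.
have zsE z : z \in flatten [seq zss r | r <- enum 'I_n] -> exists r l, z = f r l.
  by move=> /flatten_mapP [r _ /mapP [l _ ->]]; exists r, l.
have f0 r l : f r l != 0 by rewrite fE !mulf_neq0.
split.
- apply: (@allpairs_uniq_dep _ _ _ f (enum 'I_n) (fun r => iota 0 (L r))).
  + exact: enum_uniq.
  + by move=> r _; exact: iota_uniq.
  move=> [r l] [s v] _ _ /= e; apply/eqP; apply: contraT => ne.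
  have /eqP[] : th (f r l / f s v) != 0.
    rewrite !fE; apply: points_quotient; apply: contra ne => /eqP [rs].
    by rewrite rs => /addnI ->.
  by rewrite e divff.
- move=> z /zsE [r [l ->]]; split=> //.
  have -> : f r l ^+ 2 = c * q * x r * x r * q ^+ ((j r + l) + (j r + l)).
    by rewrite fE -gamma2 (exprD q (j r + l) (j r + l)); ring.
  exact: hcq.
move=> y z /zsE [r [l ->]] /zsE [s [v ->]] ne; split.
  have -> : f r l * f s v = c * q * x r * x s * q ^+ ((j r + l) + (j s + v)).
    by rewrite !fE -gamma2 (exprD q (j r + l) (j s + v)); ring.
  exact: hcq.
rewrite !fE; apply: points_quotient; apply: contra ne => /eqP [rs].
by rewrite rs => /addnI ->.
Qed.

Let t10 : t1 != 0. Proof. by rewrite mulf_neq0 ?invr_eq0. Qed.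
Let t20 : t2 != 0. Proof. by rewrite mulf_neq0 ?invr_eq0. Qed.
Let t30 : t3 != 0. Proof. by rewrite !mulf_neq0 ?invr_eq0. Qed.
Let t40 : t4 != 0. Proof. by rewrite mulf_neq0 ?invr_eq0 ?mulf_neq0. Qed.

(** The choice of c as b rho1 rho2 / (a q) is what balances the parameters. *)
Lemma parameters_balanced : t1 * t2 * t3 * t4 * q ^+ (NN - J) = q.
Proof.
have -> : t1 * t2 * t3 * t4 = gamma ^+ 2 * gamma ^+ 2 * a * q ^+ J / (rho1 * rho2 * c * b * q ^+ NN).
  by rewrite /t1 /t2 /t3 /t4; field; rewrite rho10 rho20 c0 b0 qn.
have -> : q ^+ NN = q ^+ J * q ^+ (NN - J) by rewrite -exprD weight_excess addKn.
by rewrite gamma2 /c; field; rewrite !(a0, b0, q0, rho10, rho20, qn).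
Qed.

Lemma jackson_points :
  \sum_(m <- box [ffun r => L r])
    \prod_(r < n) signed_term th q g (invert_prefix (m r) (zss r)) *
    \prod_(r < n) \prod_(s < n | (r < s)%N)
      \prod_(v <- invert_prefix (m s) (zss s))
        \prod_(w <- invert_prefix (m r) (zss r)) interaction th q v w =
  sum_value th q t1 t2 t3 (NN - J).
Proof.
have [fo [fe thA]] := theta_addition p1.
have thU (u v : C) : u != 0 -> v != 0 -> th u = 0 -> th v = 0 -> th (u / v) = 0.
  exact: theta_eq0_div.
have srt r : sorted (fun y z => interaction th q z^-1 y == 0) (zss r).
  apply: (@string_sorted _ th q _ _ q0 th1'); by rewrite !mulf_neq0.
rewrite -size_points.
have sum_eq : summation_at th q (flatten [seq zss r | r <- enum 'I_n]) t1 t2 t3 t4.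
  apply: (signsum_summation q0 thVq thA thq thU points_generic t10 t20 t30 t40).
  by rewrite size_points parameters_balanced.
rewrite -sum_eq (signsum_strings _ srt); apply: congr_big => //.
by congr box; apply/ffunP => r; rewrite !ffunE size_string.
Qed.

Let intB (u v w : nat) : (u = v + w)%N -> u%:Z - v%:Z = w%:Z.
Proof. by move=> ->; rewrite PoszD addrC addKr. Qed.

Lemma term_diag r m : (m <= L r)%N ->
  qf (b * rho1 * x r / a) (N r) * qf (b * rho2 * x r / a) (N r)
  * (qf (rho1 * x r) (j r + m)%N * qf (rho2 * x r) (j r + m)%N
      * qf (a * q ^ (1 + NN%:Z - (N r)%:Z) / (rho1 * rho2 * x r)) ((N r)%:Z - (j r + m)%N%:Z)
      / (qf (b * rho1 * x r / a) (j r + m)%N * qf (b * rho2 * x r / a) (j r + m)%N))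
  * (theta (b * rho1 * rho2 * x r ^+ 2 * q ^+ (2 * (j r + m)) / (a * q)) p
     / theta (b * rho1 * rho2 * x r ^+ 2 / (a * q)) p)
  * (qf (b * x r) (NN%:Z + (j r + m)%N%:Z)
     / (qf (b * rho1 * rho2 * x r * x r / a) (N r + (j r + m))%N
        * qf (q ^ (1 + (j r + m)%N%:Z - (j r + m)%N%:Z) * x r / x r)
             ((N r)%:Z - (j r + m)%N%:Z)))
  * (a * q / (rho1 * rho2)) ^+ (j r + m) * x r ^- (j r + m)
  * (qf (c * x r * x r) ((j r + m)%N%:Z + (j r)%:Z)
     / qf (q ^ (1 + (j r)%:Z - (j r)%:Z) * x r / x r) ((j r + m)%N%:Z - (j r)%:Z)
     * (qf (c * x r / a) ((j r + m)%N%:Z - J%:Z)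
        / (qf (c * x r / a) ((j r)%:Z - J%:Z) * qf (a * x r * q) ((j r + m)%N%:Z + J%:Z))))
  * (q ^+ (m * J) / q ^+ (m * j r)) =
  qf (rho1 * x r) (j r) * qf (rho2 * x r) (j r) * qf (b * x r) ((j r)%:Z + NN%:Z)
  / (qf (q ^ (1 + (j r)%:Z - (j r)%:Z) * x r / x r) ((N r)%:Z - (j r)%:Z)
     * qf (a * x r * q) ((N r)%:Z + J%:Z))
  * ((a * q / (rho1 * rho2)) ^+ j r * x r ^- j r) / (- t4) ^+ L r
  * signed_term th q g (invert_prefix m (zss r)).
Proof.
move=> mL.
have [G1 G4 GA GB] := gen.
have cJ0 : qf (c * x r / a) ((j r)%:Z - J%:Z) != 0.
  case: G4 => _ _ /(_ j j) [|_ _ /(_ r) + _] //.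
have nzB k : P (b * rho1 * x r / a) k != 0 /\ P (b * rho2 * x r / a) k != 0.
  have [|_ /(_ r) h _ _ _] := GB [ffun=> k] [ffun=> k]; first by move=> s.
  by move: h; rewrite ffunE !qpfact_nat.
have nzA k : P (a * x r * q) k != 0.
  have w0 : weight ([ffun=> 0%N] : multi_index n) = 0%N.
    by rewrite /weight big1 // => s _; rewrite ffunE.
  case: G1 => _ _ /(_ [ffun=> k] [ffun=> 0%N]) [|_ /(_ r)]; first by move=> s; rewrite !ffunE.
  by rewrite ffunE -PoszD qpfact_nat w0 addn0.
have Nk : (N r)%:Z - (j r + m)%N%:Z = (L r - m)%N.
  by apply: intB; rewrite {1}NE -addnA subnKC.
have Nj : (N r)%:Z - (j r)%:Z = L r by apply: intB; exact: NE.
have kj : (j r + m)%N%:Z - (j r)%:Z = m by exact: intB.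
have kJ : (j r + m)%N%:Z - J%:Z = ((j r)%:Z - J%:Z) + m%:Z by rewrite PoszD addrAC.
have qq (k : int) : q ^ (1 + k - k) * x r / x r = q by rewrite addrK expr1z mulfK.
rewrite Nk Nj kj kJ (qpfact_shift _ q0 cJ0) !qq !qpfact_natD !qpfact_nat.
have e1 : b * rho1 * rho2 * x r ^+ 2 * q ^+ (2 * (j r + m)) / (a * q) =
    c * x r * x r * q ^+ (2 * (j r + m)) by rewrite /c; ring.
have e2 : b * rho1 * rho2 * x r ^+ 2 / (a * q) = c * x r * x r by rewrite /c; ring.
have e3 : b * rho1 * rho2 * x r * x r / a = c * q * x r * x r.
  by rewrite /c; field; rewrite a0 q0.
rewrite e1 e2 e3 -/J NE [(j r + NN)%N]addnC.
have H := (diag_factor q0 thVq thq c0 gamma2 NN mL (erefl c) (x0 r) a0 b0 rho10 rho20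
  (hc r r) (fun k => (nzB k).1) (fun k => (nzB k).2) nzA cJ0 (erefl _)).
exact: H.
Qed.

Lemma term_pair r s m m' : r != s -> (m <= L r)%N -> (m' <= L s)%N ->
  (theta (b * rho1 * rho2 * x r * x s * q ^+ (j r + m + (j s + m')) / (a * q)) p
            / theta (b * rho1 * rho2 * x r * x s / (a * q)) p)
  * qf (b * rho1 * rho2 * x r * x s / a) (N r + N s)%N
  / (qf (b * rho1 * rho2 * x r * x s / a) (N s + (j r + m))%N
     * qf (q ^ (1 + (j r + m)%N%:Z - (j s + m')%N%:Z) * x r / x s) ((N r)%:Z - (j r + m)%N%:Z)
     * (qf (b * rho1 * rho2 * x s * x r / a) (N r + (j s + m'))%N
     * qf (q ^ (1 + (j s + m')%N%:Z - (j r + m)%N%:Z) * x s / x r) ((N s)%:Z - (j s + m')%N%:Z)))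
  * q ^+ ((j r + m) * (j s + m'))
  * (qf (c * x r * x s) ((j r + m)%N%:Z + (j s)%:Z) * qf (c * x s * x r) ((j s + m')%N%:Z + (j r)%:Z))
  / (qf (c * x r * x s) ((j r)%:Z + (j s)%:Z)
     * (qf (q ^ (1 + (j r)%:Z - (j s)%:Z) * x r / x s) ((j r + m)%N%:Z - (j r)%:Z)
        * qf (q ^ (1 + (j s)%:Z - (j r)%:Z) * x s / x r) ((j s + m')%N%:Z - (j s)%:Z))) =
  q ^+ (j r * j s) * (q ^+ (m * j s) * q ^+ (m' * j r)) *
  (\prod_(v <- invert_prefix m' (zss s)) \prod_(w <- invert_prefix m (zss r)) interaction th q v w)
  / (qf (q ^ (1 + (j r)%:Z - (j s)%:Z) * x r / x s) ((N r)%:Z - (j r)%:Z)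
     * qf (q ^ (1 + (j s)%:Z - (j r)%:Z) * x s / x r) ((N s)%:Z - (j s)%:Z)).
Proof.
move=> rs mL mL'.
have Nk t k : (k <= L t)%N -> (N t)%:Z - (j t + k)%N%:Z = (L t - k)%N.
  by move=> kL; apply: intB; rewrite {1}NE -addnA subnKC.
have Nj t : (N t)%:Z - (j t)%:Z = L t by apply: intB; exact: NE.
have kj t k : (j t + k)%N%:Z - (j t)%:Z = k by exact: intB.
rewrite !Nk // !Nj !kj !qpfact_natD !qpfact_nat.
have e1 : b * rho1 * rho2 * x r * x s * q ^+ (j r + m + (j s + m')) / (a * q) =
    c * x r * x s * q ^+ (j r + m + (j s + m')) by rewrite /c; ring.
have e2 : b * rho1 * rho2 * x r * x s / (a * q) = c * x r * x s by rewrite /c; ring.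
have e3 : b * rho1 * rho2 * x r * x s / a = c * q * x r * x s.
  by rewrite /c; field; rewrite a0 q0.
have e4 : b * rho1 * rho2 * x s * x r / a = c * q * x r * x s by rewrite -e3; ring.
rewrite e1 e2 e3 e4 (mulrAC c (x s)) !NE.
have hD (i : int) : th (q ^ i * x r / x s) != 0 by exact: thx.
have H := pair_factor q0 thVq c0 gamma2 (j r) (j s) mL mL' (x0 r) (x0 s) (hc r s) hD.
exact: H.
Qed.

Lemma pow_weight (y : C) (k : multi_index n) : y ^+ weight k = \prod_(r < n) y ^+ k r.
Proof. by rewrite /weight expr_sum. Qed.

Lemma pow_e2 (k : multi_index n) :
  q ^+ e2 k = \prod_(r < n) \prod_(s < n | (r < s)%N) q ^+ (k r * k s).
Proof. by rewrite /e2 expr_sum; apply: eq_bigr => r _; rewrite expr_sum. Qed.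

(** Turns the powers of q of pairs of rows into powers of single rows. *)
Lemma prod_pairs_pow (m : multi_index n) :
  \prod_(r < n) (q ^+ (m r * J) / q ^+ (m r * j r)) =
  \prod_(r < n) \prod_(s < n | (r < s)%N) (q ^+ (m r * j s) * q ^+ (m s * j r)).
Proof.
have h := prod_pairs (fun r s => q ^+ (m r * j s)).
have e : \prod_(r < n) \prod_(s < n) q ^+ (m r * j s) = \prod_(r < n) q ^+ (m r * J).
  apply: eq_bigr => r _; rewrite /J /weight big_distrr /= expr_sum.
  by [].
have nz : \prod_(r < n) q ^+ (m r * j r) != 0 by apply/prodf_neq0 => r _.
by rewrite prodf_div -e h mulrAC divff // mul1r.
Qed.

(* The quotients of the factors of the summand by those of the sum over signs,
   which do not depend on the summation index. *)
Let diag_const r : C :=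
  qf (rho1 * x r) (j r) * qf (rho2 * x r) (j r) * qf (b * x r) ((j r)%:Z + NN%:Z)
  / (qf (q ^ (1 + (j r)%:Z - (j r)%:Z) * x r / x r) ((N r)%:Z - (j r)%:Z)
     * qf (a * x r * q) ((N r)%:Z + J%:Z))
  * ((a * q / (rho1 * rho2)) ^+ j r * x r ^- j r) / (- t4) ^+ L r.

Let pair_const r s : C :=
  q ^+ (j r * j s)
  / (qf (q ^ (1 + (j r)%:Z - (j s)%:Z) * x r / x s) ((N r)%:Z - (j r)%:Z)
     * qf (q ^ (1 + (j s)%:Z - (j r)%:Z) * x s / x r) ((N s)%:Z - (j s)%:Z)).

Lemma term_factorization (m k : multi_index n) :
  m \in box [ffun r => L r] -> k = [ffun r => (j r + m r)%N] ->
  beta_prefactor N * (beta_summand N k * B4 q p x k j a c) =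
  (qf (a * q / rho1) NN * qf (a * q / rho2) NN)^-1
  * (\prod_(r < n) diag_const r * \prod_(r < n) \prod_(s < n | (r < s)%N) pair_const r s)
  * (\prod_(r < n) signed_term th q g (invert_prefix (m r) (zss r)) *
     \prod_(r < n) \prod_(s < n | (r < s)%N)
      \prod_(v <- invert_prefix (m s) (zss s))
        \prod_(w <- invert_prefix (m r) (zss r)) interaction th q v w).
Proof.
rewrite mem_box => /forallP mL ek.
have mL' r : (m r <= L r)%N by have := mL r; rewrite ffunE.
have kE r : k r = (j r + m r)%N by rewrite ek ffunE.
rewrite /beta_prefactor /beta_summand /B4 pow_weight pow_e2 regroup_products -!mulrA.
congr (_ * _); rewrite !mulrA.
transitivity ((\prod_(r < n) (diag_const r * signed_term th q g (invert_prefix (m r) (zss r))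
      / (q ^+ (m r * J) / q ^+ (m r * j r)))) *
   \prod_(r < n) \prod_(s < n | (r < s)%N) (pair_const r s * (q ^+ (m r * j s) * q ^+ (m s * j r))
     * \prod_(v <- invert_prefix (m s) (zss s))
        \prod_(w <- invert_prefix (m r) (zss r)) interaction th q v w)).
  congr (_ * _).
    apply: eq_bigr => r _.
    have qq0 : q ^+ (m r * J) / q ^+ (m r * j r) != 0 by rewrite mulf_neq0 ?invr_eq0.
    apply: (canRL (mulfK qq0)); rewrite kE; exact: term_diag.
  apply: eq_bigr => r _; apply: eq_bigr => s rs.
  rewrite !kE term_pair // ?(ltn_eqF rs) //; last by rewrite -val_eqE /= ltn_eqF.
  by rewrite /pair_const; ring.
have inner (G H : 'I_n -> 'I_n -> C) :
   \prod_(r < n) \prod_(s < n | (r < s)%N) (G r s * H r s) =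
   (\prod_(r < n) \prod_(s < n | (r < s)%N) G r s) *
   (\prod_(r < n) \prod_(s < n | (r < s)%N) H r s).
  by rewrite -big_split; apply: eq_bigr => r _; rewrite big_split.
rewrite (inner (fun r s => pair_const r s * (q ^+ (m r * j s) * q ^+ (m s * j r)))).
rewrite (inner pair_const) -prod_pairs_pow big_split prodfV big_split /=.
have nz : \prod_(r < n) (q ^+ (m r * J) / q ^+ (m r * j r)) != 0.
  by apply/prodf_neq0 => r _; rewrite mulf_neq0 ?invr_eq0.
by move: nz; move: (\prod_(r < n) (_ / _)) => w w0; field.
Qed.

(** Up to the constants, the sum is [jackson_points]; the constants give the
    factors of B1 and alpha', and the balancing condition removes all powers of
    t4 and of -1. *)
Lemma jackson_sum :
  \sum_(k <- box N | [forall r, (j r <= k r)%N])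
    beta_prefactor N * (beta_summand N k * B4 q p x k j a c) =
  B1 q p x N j a b * alpha_factor j.
Proof.
rewrite big_box_shift //.
have -> : [ffun r => (N r - j r)%N] = [ffun r => L r] by [].
under eq_big_seq => m hm do rewrite (term_factorization hm (erefl _)).
rewrite -mulr_sumr jackson_points /sum_value.
set M := (NN - J)%N.
have eM : NN = (J + M)%N by rewrite /M weight_excess addKn.
have gg : gamma * gamma = c * q by rewrite -expr2.
have -> : t1 * t2 = b / a.
  transitivity (gamma * gamma / (rho1 * rho2)); first by rewrite /t1 /t2; field; rewrite rho10 rho20.
  by rewrite gg /c; field; rewrite a0 rho10 rho20 q0.
have -> : t1 * t3 = a * q / rho1 * q ^+ J.
  transitivity (gamma * gamma / c * a * q ^+ J / rho1); first by rewrite /t1 /t3; ring.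
  by rewrite gg; field; rewrite rho10 c0.
have -> : t2 * t3 = a * q / rho2 * q ^+ J.
  transitivity (gamma * gamma / c * a * q ^+ J / rho2); first by rewrite /t2 /t3; ring.
  by rewrite gg; field; rewrite rho20 c0.
have bal : b / a * t3 * t4 * q ^+ M = q.
  rewrite -[RHS]parameters_balanced -/M; congr (_ * _ * _ * _).
  transitivity (gamma * gamma / (rho1 * rho2)); last by rewrite /t1 /t2; field; rewrite rho10 rho20.
  by rewrite gg /c; field; rewrite a0 rho10 rho20 q0.
have qM : qf (b / a) (NN%:Z - J%:Z) = P (b / a) M.
  by rewrite (intB eM) qpfact_nat.
have [_ _ GA _] := gen.
have [R1 R2] := GA N; have {GA} [R3 R4] := GA j; rewrite -/NN -/J in R1 R2 R3 R4.
have splitN u : qf u NN = qf u J * P (u * q ^+ J) M.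
  by rewrite !qpfact_nat -pochD -eM.
rewrite !splitN in R1 R2 *.
rewrite /B1 qM prod_pairs /alpha_factor pow_weight pow_e2 -/NN -/J.
rewrite /diag_const /pair_const !big_split /= !prodfV !big_split /=.
have inner (G H : 'I_n -> 'I_n -> C) :
   \prod_(r < n) \prod_(s < n | (r < s)%N) (G r s / H r s) =
   (\prod_(r < n) \prod_(s < n | (r < s)%N) G r s) /
   (\prod_(r < n) \prod_(s < n | (r < s)%N) H r s).
  by rewrite -prodf_div; apply: eq_bigr => r _; rewrite prodf_div.
rewrite inner.
have -> : \prod_(r < n) (- t4) ^+ L r = (- t4) ^+ M.
  by rewrite -expr_sum; congr (_ ^+ _); rewrite /M weight_excess addKn.
have monomials : (-1) ^+ M / ((b / a * t3) ^+ M * q ^+ (M * M.-1)) / (- t4) ^+ M = 1.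
  have t4M : t4 ^+ M != 0 by rewrite expf_neq0.
  have uM : (b / a * t3) ^+ M != 0 by rewrite expf_neq0 // !mulf_neq0 ?invr_eq0.
  have h : (b / a * t3) ^+ M * t4 ^+ M * q ^+ (M * M.-1) = 1.
    have := congr1 (fun z => z ^+ M) bal; rewrite /= (exprMn M _ (q ^+ M)) (exprMn M _ t4) -exprM.
    have -> : q ^+ (M * M) = q ^+ (M * M.-1) * q ^+ M.
      by rewrite -exprD; case: (M) => // M'; rewrite -mulnSr.
    by rewrite mulrA => h; apply: (mulIf (qn M)); rewrite h mul1r.
  have s0 : (-1 : C) ^+ M != 0 by rewrite expf_neq0 // oppr_eq0 oner_neq0.
  rewrite (exprNn t4) -[RHS]invr1 -[in RHS]h.
  move: s0 uM t4M (qn (M * M.-1)%N).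
  move: ((-1 : C) ^+ M) ((b / a * t3) ^+ M) (t4 ^+ M) (q ^+ (M * M.-1)) => u1 u2 u3 u4 n1 n2 n3 n4.
  by field; rewrite n1 n2 n3 n4.
move: monomials R1 R2 R3 R4; rewrite -/NN -/J.
move: (P (a * q / rho1 * q ^+ J) M) (P (a * q / rho2 * q ^+ J) M) (P (b / a) M).
move: (qf (a * q / rho1) J) (qf (a * q / rho2) J) => R1 R2 P1 P2 P3.
rewrite !mulf_eq0 !negb_or.
move: ((-1 : C) ^+ M) ((- t4) ^+ M) ((b / a * t3) ^+ M * q ^+ (M * M.-1)) => s1 s2 s3 monomials.
move=> /andP[_ P1n0] /andP[_ P2n0] _ _.
set rhs := (X in _ = X).
rewrite -[rhs]mul1r -[X in _ = X * _]monomials -[RHS]mul1r -[X in _ = X * _](divff P1n0).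
rewrite -[RHS]mul1r -[X in _ = X * _](divff P2n0) /rhs !invfM; ring.
Qed.

End Sum.
End Final.

(** * The transformation of Bailey pairs *)
Lemma box_sumE (V : nmodType) n (N : multi_index n) (F : multi_index n -> V) :
  box_sum N F = \sum_(k <- box N) F k.
Proof. by rewrite /box_sum /box big_image. Qed.

Lemma big_box_sub (V : nmodType) n (N k : {ffun 'I_n -> nat})
    (F : {ffun 'I_n -> nat} -> V) :
  k \in box N ->
  \sum_(j <- box k) F j = \sum_(j <- box N | [forall r, (j r <= k r)%N]) F j.
Proof.
rewrite mem_box => /forallP kN; rewrite -[RHS]big_filter; apply: eq_big_box.

  by rewrite filter_uniq ?box_uniq.
move=> j; rewrite mem_filter !mem_box; apply/andP/idP => [[]//|jk].
by split=> //; apply/forallP => r; exact: leq_trans (forallP jk r) (kN r).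
Qed.

Theorem theorem9p1 (R : realType) (q p : R[i]) (n : nat) (x : 'I_n -> R[i])
    (rho1 rho2 : R[i]) (alpha beta : multi_index n -> R[i] -> R[i] -> R[i])
    (hq : q != 0) (hp : `|p| < 1) (hn : (1 <= n)%N)
    (hx : forall r : 'I_n, x r != 0) (hrho1 : rho1 != 0) (hrho2 : rho2 != 0)
    (hpair : WP_Bailey_pair (B4_generic q p x) (B4 q p x) alpha beta) :
  WP_Bailey_pair (transformed_generic q p x rho1 rho2) (B1 q p x)
    (alpha' q p x rho1 rho2 alpha) (beta' q p x rho1 rho2 beta).
Proof.
move=> N a b gen; set c := b * rho1 * rho2 / (a * q).
have p1 : normc p < 1 by move: hp; rewrite -ltcR.
have [_ gen4 _ _] := gen.
transitivity (beta_prefactor q p x rho1 rho2 a b N *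
    box_sum N (fun k => beta_summand q p x rho1 rho2 a b N k * beta k a c)).
  by [].
rewrite !box_sumE.
transitivity (\sum_(k <- box N) \sum_(j <- box N | [forall r, (j r <= k r)%N])
   beta_prefactor q p x rho1 rho2 a b N *
   (beta_summand q p x rho1 rho2 a b N k * B4 q p x k j a c) * alpha j a c).
  rewrite mulr_sumr; apply: eq_big_seq => k kN.
  rewrite (hpair k _ _ gen4) box_sumE (big_box_sub _ kN) mulr_sumr mulr_sumr.
  by apply: eq_bigr => j _; rewrite !mulrA.
rewrite (exchange_big_dep xpredT) //=; apply: eq_big_seq => j.
rewrite mem_box => /forallP jN.
rewrite -mulr_suml (jackson_sum hq p1 hn hx hrho1 hrho2 gen jN) -mulrA.
by [].
Qed.
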